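(* For any $(\beta,\boldsymbol{\beta})\in\mathcal{B}$ and any (possibly degenerate) Gaussian random variable $h$, the limit $F(\beta,\boldsymbol{\beta},h):=\lim_{N\to\infty}F_N(\beta,\boldsymbol{\beta},h)$ exists and $$F(\beta,\boldsymbol{\beta},h)=\max_{\mu\in[-1,1]}\left\{F^{SK}(\boldsymbol{\beta},\beta\mu+h)-\frac{\beta\mu^2}{2}\right\}.$$
   Context: Let $\mathcal{B}=\{(\beta,\boldsymbol{\beta}):\boldsymbol{\beta}=(\beta_p)_{p\ge1}\subset\mathbb{R},\ \beta\ge 0,\ \sum_{p\ge1}2^p\beta_p^2<\infty\}$. Let $h$ be a Gaussian random variable (possibly degenerate, not necessarily centered) and let $(h_i)_{i\ge 1}$ be i.i.d. copies of $h$. Let $\boldsymbol{g}=(g_{i_1,\ldots,i_{2p}})$ be i.i.d. standard Gaussian random variables, independent of $(h_i)$. For $N\ge1$ and $\boldsymbol{\sigma}\in\Sigma_N=\{-1,+1\}^N$ set $m(\boldsymbol{\sigma})=N^{-1}\sum_{i\le N}\sigma_i$, $$H_N^{SK}(\boldsymbol{\sigma})=\sum_{p\ge1}\frac{\beta_p}{N^{p-1/2}}\sum_{1\le i_1,\ldots,i_{2p}\le N}g_{i_1,\ldots,i_{2p}}\sigma_{i_1}\cdots\sigma_{i_{2p}},$$ $$H_N(\boldsymbol{\sigma})=\frac{\beta N}{2}m(\boldsymbol{\sigma})^2+H_N^{SK}(\boldsymbol{\sigma})+\sum_{i\le N}h_i\sigma_i.$$ Set $Z_N(\beta,\boldsymbol{\beta},h)=\sum_{\boldsymbol{\sigma}\in\Sigma_N}\exp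 H_N(\boldsymbol{\sigma})$ and $F_N(\beta,\boldsymbol{\beta},h)=N^{-1}\mathbb{E}\ln Z_N(\beta,\boldsymbol{\beta},h)$. The case $\beta=0$ is the mixed even-spin SK model: $F_N^{SK}(\boldsymbol{\beta},h)=F_N(0,\boldsymbol{\beta},h)$, and $F^{SK}(\boldsymbol{\beta},h)=\lim_{N\to\infty}F_N^{SK}(\boldsymbol{\beta},h)$, a limit which is known to exist for every Gaussian $h$. For $x\in\mathbb{R}$, $F^{SK}(\boldsymbol{\beta},x+h)$ refers to the SK model with external field the Gaussian random variable $x+h$ (i.e. with $h_i$ replaced by $x+h_i$). *)

(* Defs.v *)
From HB Require Import structures.
From mathcomp Require Import all_boot all_order all_algebra.
From mathcomp Require Import finmap.
From mathcomp Require Import all_classical all_reals all_analysis.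
Import Order.TTheory GRing.Theory Num.Theory.
Import numFieldNormedType.Exports.

Set Implicit Arguments.
Unset Strict Implicit.
Unset Printing Implicit Defensive.

Local Open Scope classical_set_scope.
Local Open Scope ring_scope.

Section gaussian_disorder.
Context {d : measure_display} {T : measurableType d} {R : realType}.
Variable P : probability T R.

(* [normal_prob m 0] is the uniform law on [0, 1] in the library, so the
   degenerate Gaussian has to be singled out as a Dirac mass. *)
Definition gaussian (X : {RV P >-> R}) : Prop :=
  exists m s : R, 0 <= s /\
    forall A : set R, measurable A ->
      distribution P X A = if s == 0 then \d_m A else normal_prob m s A.

Definition standard_gaussian (X : {RV P >-> R}) : Prop :=
  forall A : set R, measurable A -> distribution P X A = normal_prob 0 1 A.

Definition same_law (X Y : {RV P >-> R}) : Prop :=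
  forall A : set R, measurable A -> distribution P X A = distribution P Y A.

Definition mutually_independent (I : choiceType) (D : set I)
    (X : I -> {RV P >-> R}) : Prop :=
  forall (J : {fset I}) (B : I -> set R),
    (forall i, i \in J -> D i) ->
    (forall i, i \in J -> measurable (B i)) ->
    P (\bigcap_(i in [set` J]) X i @^-1` B i) =
      (\prod_(i <- J) P (X i @^-1` B i))%E.

End gaussian_disorder.

(* The coupling g_{i_1, ..., i_2p} is indexed by the sequence
   [:: i_1; ...; i_2p]; sites are numbered from 0. *)
Definition coupling_index : set (seq nat) :=
  [set s | exists2 p : nat, (1 <= p)%N & size s = (2 * p)%N].

Definition disorder_index : set (nat + seq nat) :=
  [set x | if x is inr s then coupling_index s else True].

Definition disorder {U : Type} (h : nat -> U) (g : seq nat -> U)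
    (x : nat + seq nat) : U :=
  match x with inl i => h i | inr s => g s end.

Section model.
Context {d : measure_display} {T : measurableType d} {R : realType}.
Variable P : probability T R.
Variable g : seq nat -> T -> R.

Definition config (N : nat) : Type := {ffun 'I_N -> bool}.

Definition spin N (sigma : config N) (i : 'I_N) : R :=
  if sigma i then 1 else -1.

Definition magnetization N (sigma : config N) : R :=
  N%:R^-1 * \sum_(i < N) spin sigma i.

(* The value beta_ 0 is never used. When \sum_p 2^p beta_p^2 is finite, the
   series below converges almost surely. *)
Definition H_SK (beta_ : nat -> R) N (sigma : config N) (w : T) : R :=
  \big[+%R/0]_(1 <= p <oo)
    (beta_ p / (N%:R `^ (p%:R - 2^-1)) *
     \sum_(i : (2 * p).-tuple 'I_N)
        g [seq val k | k <- i] w * \prod_(k <- i) spin sigma k).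

Definition H (beta : R) (beta_ : nat -> R) (h : nat -> T -> R)
    N (sigma : config N) (w : T) : R :=
  beta * N%:R / 2 * magnetization sigma ^+ 2 + H_SK beta_ sigma w
  + \sum_(i < N) h i w * spin sigma i.

Definition Z (beta : R) (beta_ : nat -> R) (h : nat -> T -> R)
    (N : nat) (w : T) : R :=
  \sum_(sigma : {ffun 'I_N -> bool}) expR (H beta beta_ h sigma w).

(* The expectation is finite in the Gaussian model, so [fine] loses nothing. *)
Definition F_ (beta : R) (beta_ : nat -> R) (h : nat -> T -> R)
    (N : nat) : R :=
  N%:R^-1 * fine 'E_P[fun w => ln (Z beta beta_ h N w)].

Definition F_SK (beta_ : nat -> R) (h : nat -> T -> R) : R :=
  limn (F_ 0 beta_ h).

End model.

Definition is_max {R : realType} (A : set R) (M : R) : Prop :=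
  A M /\ ubound A M.

(* Main.v *)
Require Import Defs.
From HB Require Import structures.
From mathcomp Require Import all_boot all_order all_algebra.
From mathcomp Require Import finmap.
From mathcomp Require Import all_classical all_reals all_analysis.
From mathcomp Require Import measurable_realfun ring lra.
Import Order.TTheory GRing.Theory Num.Theory.
Import numFieldNormedType.Exports.

(* Keep only the interactions of order at most 2M. By independence, the expected
   log-partition function is an iterated average of log-sum-exp, as a functional of
   the energy vector, along one direction per random variable. By convexity of
   u^(2p), gluing two systems of sizes N1 and N2 keeps the variances of the energies
   and does not increase their covariances, so Gaussian comparison makes the expected
   log-partition function superadditive in N (Guerra and Toninelli), and Fekete's
   lemma gives the limit for beta = 0. Since the expected supremum of the term of
   order 2p is O(N |beta_p|) and the beta_p are absolutely summable, the limit
   persists for the full model.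

   For beta > 0 the lower bound is m^2 >= 2 mu m - mu^2. For the upper bound,
   m^2 <= 2 mu_k m - mu_k^2 + delta^2 for some point mu_k of a finite grid, so Z is
   at most a sum over k of partition functions with external field beta mu_k + h.
   No concentration of measure is needed: the soft maximum of parameter theta of
   these log-partition functions exceeds the soft maximum of their averages by
   O(theta N) in average, and by O(1 / theta) their maximum. *)

Set Implicit Arguments.
Unset Strict Implicit.
Unset Printing Implicit Defensive.

Local Open Scope classical_set_scope.
Local Open Scope ring_scope.

(** * Integration *)

(** Averaging operators stand in both for expectations and for derivatives along an interpolation. A
    functional of the energy vector that is Lipschitz for the supremum norm keeps its constant under
    every average, averages along different directions commute, and log-sum-exp is 1-Lipschitz: this
    supplies the integrability that is needed. Gaussian comparison then becomes a discrete argument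
    that rests on the stability of the normal law under (x + y) / sqrt 2, its moments, and the fact
    that the second-order term of log-sum-exp is a Gibbs variance.

    A field x + h_i is obtained by adding x times the total spin to the deterministic energy, so the
    law of h_i stays fixed while mu varies. Degenerate and nondegenerate fields enter through the
    same exponential moment condition.

    The truncation error per site is small uniformly in N, beta and x. Hence M is fixed before N
    tends to infinity. The admissible range of theta depends on M but not on N, so theta is fixed in
    between, and the grid has a size independent of N. *)

Section real_integration.
Context {R : realType}.

Lemma integrable_dominated d (T : measurableType d)
    (mu : {measure set T -> \bar R}) (f g : T -> R) :
  measurable_fun setT f -> (forall x, `|f x| <= g x) ->
  mu.-integrable setT (EFin \o g) -> mu.-integrable setT (EFin \o f).
Proof.
move=> mf fg; apply: le_integrable => //; first exact/measurable_EFinP.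
by move=> x _ /=; rewrite lee_fin (le_trans (fg x))// ler_norm.
Qed.

Lemma integrable_cst d (T : measurableType d) (P : probability T R) (c : R) :
  P.-integrable setT (EFin \o (fun=> c)).
Proof. exact: finite_measure_integrable_cst. Qed.

Lemma Rintegral_probability_cst d (T : measurableType d)
    (P : probability T R) (c : R) : \int[P]_x c = c.
Proof. by rewrite Rintegral_cst//= probability_setT mulr1. Qed.

Lemma integrable_realD d (T : measurableType d) (mu : {measure set T -> \bar R})
    (f g : T -> R) :
  mu.-integrable setT (EFin \o f) -> mu.-integrable setT (EFin \o g) ->
  mu.-integrable setT (EFin \o (fun x => f x + g x)).
Proof.
move=> /(integrableD measurableT) /[apply].
by apply: eq_integrable.
Qed.

Lemma integrable_realB d (T : measurableType d) (mu : {measure set T -> \bar R})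
    (f g : T -> R) :
  mu.-integrable setT (EFin \o f) -> mu.-integrable setT (EFin \o g) ->
  mu.-integrable setT (EFin \o (fun x => f x - g x)).
Proof.
move=> /(integrableB measurableT) /[apply].
by apply: eq_integrable.
Qed.

Lemma integrable_realZ d (T : measurableType d) (mu : {measure set T -> \bar R})
    (k : R) (f : T -> R) :
  mu.-integrable setT (EFin \o f) ->
  mu.-integrable setT (EFin \o (fun x => k * f x)).
Proof.
move=> /(integrableZl measurableT k).
by apply: eq_integrable.
Qed.

Lemma Rintegral_sum d (T : measurableType d) (mu : {measure set T -> \bar R})
    (I : finType) (f : I -> T -> R) :
  (forall i, mu.-integrable setT (EFin \o f i)) ->
  \int[mu]_x (\sum_i f i x) = \sum_i \int[mu]_x f i x.
Proof.
move=> fi; rewrite /Rintegral.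
under eq_integral do rewrite -sumEFin.
rewrite integral_sum//=; apply: EFin_inj; rewrite fineK; last first.
  by apply/sum_fin_numP => i _ _; exact: integrable_fin_num (fi i).
rewrite -sumEFin; apply: eq_bigr => i _.
by rewrite fineK//; exact: integrable_fin_num (fi i).
Qed.

Section product.
Context d1 d2 (T1 : measurableType d1) (T2 : measurableType d2).
Variables (m1 : probability T1 R) (m2 : probability T2 R).

(** Tonelli's theorem is applied to the positive and the negative part separately, so measurability
    of [F] suffices; [fine] is measurable. *)
Lemma measurable_fun_Rintegral2 (F : T1 * T2 -> R) :
  measurable_fun setT F ->
  measurable_fun setT (fun x => \int[m2]_y F (x, y)).
Proof.
move=> mF; rewrite /Rintegral; apply: measurableT_comp => //.
have mE : measurable_fun setT (EFin \o F) by exact/measurable_EFinP.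
under eq_fun do rewrite integralE.
apply: emeasurable_funB => //.
  have := @measurable_fun_fubini_tonelli_F _ _ _ _ _ m2 _ (measurable_funepos mE).
  rewrite (_ : fubini_F _ _ = fun x =>
    (\int[m2]_y (fun z => (F (x, z))%:E)^\+ y)%E); first by apply.
  by apply/funext => x; apply: eq_integral => y _; rewrite !funeposE.
have := @measurable_fun_fubini_tonelli_F _ _ _ _ _ m2 _ (measurable_funeneg mE).
rewrite (_ : fubini_F _ _ = fun x =>
  (\int[m2]_y (fun z => (F (x, z))%:E)^\- y)%E); first by apply.
by apply/funext => x; apply: eq_integral => y _; rewrite !funenegE.
Qed.

Variable (F : T1 * T2 -> R) (u : T1 -> R) (v : T2 -> R).
Hypothesis mF : measurable_fun setT F.
Hypothesis Fuv : forall x y, `|F (x, y)| <= u x * v y.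
Hypothesis u0 : forall x, 0 <= u x.
Hypothesis v0 : forall y, 0 <= v y.
Hypothesis iu : m1.-integrable setT (EFin \o u).
Hypothesis iv : m2.-integrable setT (EFin \o v).

(** A bound of product form makes the iterated integral of |F| factor. Both later uses of Fubini's
    theorem, in [avgC] and in [Rintegral_conditioning], provide such a bound. *)
Lemma integrable_prod_dominated : (m1 \x m2)%E.-integrable setT (EFin \o F).
Proof.
apply/integrable12ltyP; first exact/measurable_EFinP.
have mu' := measurable_int _ iu; have mv := measurable_int _ iv.
apply: (@le_lt_trans _ _
    (\int[m1]_x ((\int[m2]_y (v y)%:E) * (u x)%:E)%E)%E).
  apply: ge0_le_integral => //.
  - by move=> x _; apply: integral_ge0.
  - apply: (measurable_fun_fubini_tonelli_F (abse \o (EFin \o F))) => //=.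
    by apply: measurableT_comp => //; exact/measurable_EFinP.
  - by apply: emeasurable_funM => //; exact: measurable_cst.
  - move=> x _; rewrite muleC -ge0_integralZl//; last 2 first.
      by move=> y _; rewrite lee_fin.
      by rewrite lee_fin.
    apply: ge0_le_integral => //.
    + apply: measurableT_comp => //; apply/measurable_EFinP.
      exact: measurableT_comp mF (pair1_measurable x).
    + exact: measurable_funeM.
    + by move=> y _; rewrite /= lee_fin Fuv.
rewrite ge0_integralZl//; last 2 first.
  by move=> x _; rewrite lee_fin.
  by apply: integral_ge0 => y _; rewrite lee_fin.
apply: lte_mul_pinfty.
- by apply: integral_ge0 => y _; rewrite lee_fin.
- exact: integrable_fin_num.
- by rewrite ltey_eq; apply/orP; left; exact: integrable_fin_num iu.
Qed.

Lemma Rintegral_prod :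
  \int[(m1 \x m2)%E]_z F z = \int[m1]_x \int[m2]_y F (x, y).
Proof.
have iF := integrable_prod_dominated.
rewrite /Rintegral -(integral12_prod_meas1 iF); congr fine.
apply: eq_integral => x _; rewrite /fubini_F fineK//.
apply: integrable_fin_num => //; apply: (@integrable_dominated _ _ _ _ (fun y => u x * v y)) => //.
  exact: measurableT_comp mF (pair1_measurable x).
exact: integrable_realZ.
Qed.

Lemma Rintegral_prod_swap :
  \int[(m1 \x m2)%E]_z F z = \int[m2]_y \int[m1]_x F (x, y).
Proof.
have iF := integrable_prod_dominated.
rewrite /Rintegral -(integral21_prod_meas1 iF); congr fine.
apply: eq_integral => y _; rewrite /fubini_G fineK//.
apply: integrable_fin_num => //; apply: (@integrable_dominated _ _ _ _ (fun x => v y * u x)) => //.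
  exact: measurableT_comp mF (pair2_measurable y).
  by move=> x; rewrite mulrC Fuv.
exact: integrable_realZ.
Qed.

End product.

End real_integration.

(** * Integrals against normal laws *)

Section normal_integrals.
Context {R : realType}.
Local Notation mu := (@lebesgue_measure R).

Let borel_id : measurableTypeR R -> R := idfun.

#[local] HB.instance Definition _ :=
  @isMeasurableFun.Build _ _ _ _ borel_id (@measurable_id _ _ setT).

(* The library puts [normal_prob] on [measurableTypeR R], whose display differs
   from that of [R]; random variables take values in the latter. *)
Definition normal_law (m s : R) : probability R R :=
  distribution (normal_prob m s) (borel_id : {RV (normal_prob m s) >-> R}).

Lemma normal_lawE (m s : R) (A : set R) : normal_law m s A = normal_prob m s A.
Proof. by []. Qed.

(** The Radon-Nikodym derivative and [normal_pdf] have the same integral over every measurable set,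
    so they agree almost everywhere. *)
Lemma ge0_integral_normal_prob (m s : R) (f : R -> \bar R) :
  measurable_fun setT f -> (forall x, 0 <= f x)%E ->
  (\int[normal_prob m s]_x f x =
   \int[mu]_x (f x * (normal_pdf m s x)%:E))%E.
Proof.
move=> mf f0.
have dom := normal_prob_dominates m s.
rewrite -(Radon_Nikodym_SigmaFinite.change_of_variables dom)//.
set g := Radon_Nikodym_SigmaFinite.f _ _.
have mg : measurable_fun setT g.
  exact: measurable_int (Radon_Nikodym_SigmaFinite.f_integrable dom).
have mp : measurable_fun setT (fun x => (normal_pdf m s x)%:E).
  by apply/measurable_EFinP; exact: measurable_normal_pdf.
apply: ae_eq_integral => //.
- exact: emeasurable_funM.
- exact: emeasurable_funM.
have : ae_eq mu setT g (fun x => (normal_pdf m s x)%:E).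
  apply: integral_ae_eq => //.
    exact: Radon_Nikodym_SigmaFinite.f_integrable.
  by move=> E _ mE; rewrite -Radon_Nikodym_SigmaFinite.f_integral.
by apply: filterS => x /(_ Logic.I) /= h _; rewrite h.
Qed.

Lemma ge0_integral_normal_law (m s : R) (f : R -> \bar R) :
  measurable_fun setT f -> (forall x, 0 <= f x)%E ->
  (\int[normal_law m s]_x f x =
   \int[mu]_x (f x * (normal_pdf m s x)%:E))%E.
Proof.
by move=> mf f0; rewrite ge0_integral_distribution// ge0_integral_normal_prob.
Qed.

Lemma integrable_normal_expR (m s t : R) : s != 0 ->
  (normal_law m s).-integrable setT (EFin \o (fun z => expR (t * z))).
Proof.
move=> s0; apply/integrableP; split.
  by apply/measurable_EFinP; apply: measurableT_comp => //; exact: measurable_funM.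
under eq_integral do rewrite /= ger0_norm ?expR_ge0//.
rewrite ge0_integral_normal_law//; last first.
- by apply/measurable_EFinP; apply: measurableT_comp => //; exact: measurable_funM.
(* Completing the square: the exponential tilt moves the mean by s^2 t and leaves a constant
   factor. *)
have shiftE x : ((expR (t * x))%:E * (normal_pdf m s x)%:E =
    (expR (m * t + s ^+ 2 * t ^+ 2 / 2))%:E *
    (normal_pdf (m + s ^+ 2 * t) s x)%:E)%E.
  rewrite !normal_pdfE// -!EFinM; congr EFin.
  rewrite mulrCA [RHS]mulrCA; congr (_ * _); rewrite /normal_fun -!expRD.
  by congr expR; field.
under eq_integral do rewrite shiftE.
rewrite ge0_integralZl//.
- by rewrite integral_normal_pdf mule1 ltry.
- by apply/measurable_EFinP; exact: measurable_normal_pdf.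
- by move=> x _; rewrite lee_fin normal_pdf_ge0.
Qed.

(** Disintegration of two independent standard normals along z = (x + y) / r: given z, the variable
    x is normal with mean z / r and standard deviation 1 / r. The factor [r] on the left is the
    Jacobian of y = r z - x. *)
Lemma normal_pdf_convolution (x z : R) (r := Num.sqrt 2 : R) :
  normal_pdf 0 1 (r * z - x) * normal_pdf 0 1 x * r =
  normal_pdf 0 1 z * normal_pdf (z / r) r^-1 x.
Proof.
have r2 : r ^+ 2 = 2 by rewrite sqr_sqrtr.
have r0 : 0 < r by rewrite sqrtr_gt0.
have rN0 : r != 0 by rewrite gt_eqF.
pose p : R := Num.sqrt pi.
have p0 : p != 0 by rewrite gt_eqF// sqrtr_gt0 pi_gt0.
have peak1 : normal_peak 1 = p^-1 / r.
  by rewrite /normal_peak expr1n mul1r -mulr_natr sqrtrM ?pi_ge0// invfM.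
have peakr : normal_peak r^-1 = p^-1.
  rewrite /normal_peak exprVn r2 (_ : _ *+ 2 = pi)//.
  by rewrite -mulr_natr; field.
rewrite !normal_pdfE ?invr_eq0 ?oner_eq0// peak1 peakr /normal_fun.
rewrite expr1n !subr0 exprVn r2.
rewrite [LHS](_ : _ = p^-1 ^+ 2 * r^-1 * (expR (- (r * z - x) ^+ 2 / (1 *+ 2)) *
  expR (- x ^+ 2 / (1 *+ 2)))); last by field; rewrite ?rN0 ?p0.
rewrite [RHS](_ : _ = p^-1 ^+ 2 * r^-1 * (expR (- z ^+ 2 / (1 *+ 2)) *
  expR (- (x - z / r) ^+ 2 / (2^-1 *+ 2)))); last by field; rewrite ?rN0 ?p0.
congr (_ * _); rewrite -!expRD; congr expR.
have -> : z / r = r * z / 2 by rewrite -r2; field.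
rewrite [LHS](_ : _ = - (r ^+ 2 * z ^+ 2 - 2 * r * z * x + 2 * x ^+ 2) / 2);
  last by field.
rewrite [RHS](_ : _ = - (x ^+ 2 - r * z * x + r ^+ 2 * z ^+ 2 / 4 + z ^+ 2 / 2));
  last by field.
by rewrite r2; field.
Qed.

(** Substitute y = r z - x, exchange the integrals by Tonelli's theorem, and integrate out the
    conditional density of x given z. *)
Lemma ge0_normal_law_convolution (f : R -> R) (r := Num.sqrt 2 : R) :
  continuous f -> (forall x, 0 <= f x) ->
  (\int[normal_law 0 1]_x \int[normal_law 0 1]_y (f ((x + y) / r))%:E =
   \int[normal_law 0 1]_z (f z)%:E)%E.
Proof.
move=> cf f0.
have r0 : 0 < r by rewrite sqrtr_gt0.
have rN0 : r != 0 by rewrite gt_eqF.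
have mf : measurable_fun setT f by exact: continuous_measurable_fun.
have inner x : (\int[normal_law 0 1]_y (f ((x + y) / r))%:E =
    \int[mu]_z (f z * normal_pdf 0 1 (r * z - x) * r)%:E)%E.
  rewrite ge0_integral_normal_law; last 2 first.
  - apply/measurable_EFinP; apply: measurableT_comp => //.
    by apply: measurable_funM => //; exact: measurable_funD.
  - by move=> y; rewrite lee_fin.
  pose F (z : R) : R := r * z - x.
  have dF (z : R) : is_derive z 1 F r.
    apply: is_derive_eq; rewrite subr0.
    by rewrite scaler1.
  have F'E : (F^`())%classic = cst r.
    by apply/funext => z; rewrite derive1E; exact: derive_val.
  under eq_integral do rewrite -EFinM.
  rewrite (@increasing_ge0_integration_by_substitutionT _ F
    (fun y => f ((x + y) / r) * normal_pdf 0 1 y)).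
  - apply: eq_integral => z _; rewrite F'E /F /=; congr EFin.
    congr (_ * _ * _); congr f; field; rewrite //.
  - by move=> u v uv; rewrite /F ltrD2r ltr_pM2l.
  - by rewrite F'E => ?; exact: cvg_cst.
  - by rewrite F'E; exact: is_cvg_cst.
  - by rewrite F'E; exact: is_cvg_cst.
  - by move=> z; exact: ex_derive.
  - apply: (@cvg_comp _ _ _ (fun z => r * z) (fun z => z - x)).
      exact: (gt0_cvgMrNy r0).
    exact: cvg_addrr_Ny.
  - apply: (@cvg_comp _ _ _ (fun z => r * z) (fun z => z - x)).
      exact: (gt0_cvgMry r0).
    exact: cvg_addrr.
  - move=> z; apply: cvgM; last exact: continuous_normal_pdf.
    apply: (@continuous_comp _ _ _ (fun y => (x + y) / r) f); last exact: cf.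
    by apply: cvgM; [apply: cvgD; [exact: cvg_cst|exact: cvg_id]|exact: cvg_cst].
  - by move=> z; rewrite mulr_ge0// normal_pdf_ge0.
have mpdf d (T : measurableType d) (u : T -> R) : measurable_fun setT u ->
    measurable_fun setT (fun x => normal_pdf 0 1 (u x)).
  by apply: measurableT_comp; exact: measurable_normal_pdf.
have mk x : measurable_fun setT (fun z : R => f z * normal_pdf 0 1 (r * z - x) * r).
  apply: measurable_funM => //; apply: measurable_funM => //; apply: mpdf.
  by apply: measurable_funB => //; exact: measurable_funM.
under eq_integral do rewrite inner.
rewrite [LHS]ge0_integral_normal_law; last 2 first.
- pose G (p : R * R) := (f p.2 * normal_pdf 0 1 (r * p.2 - p.1) * r)%:E.
  have mG : measurable_fun setT G.
    apply/measurable_EFinP; apply: measurable_funM => //.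
    apply: measurable_funM; first exact: measurableT_comp.
    apply: mpdf; apply: measurable_funB => //.
    exact: measurable_funM.
  have G0 p : (0 <= G p)%E.
    by rewrite lee_fin !mulr_ge0// ?normal_pdf_ge0// ltW.
  exact: (@measurable_fun_fubini_tonelli_F _ _ _ _ R mu G mG G0).
- by move=> x; apply: integral_ge0 => z _;
    rewrite lee_fin !mulr_ge0// ?normal_pdf_ge0// ltW.
pose G (p : R * R) :=
  (f p.2 * normal_pdf 0 1 (r * p.2 - p.1) * r * normal_pdf 0 1 p.1)%:E.
have mG : measurable_fun setT G.
  apply/measurable_EFinP; apply: measurable_funM; last exact: mpdf.
  apply: measurable_funM => //.
  apply: measurable_funM; first exact: measurableT_comp.
  apply: mpdf; apply: measurable_funB => //.
  exact: measurable_funM.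
have G0 p : (0 <= G p)%E.
  by rewrite lee_fin !mulr_ge0// ?normal_pdf_ge0// ltW.
transitivity (\int[mu]_x \int[mu]_z G (x, z))%E.
  apply: eq_integral => x _; rewrite -ge0_integralZr//.
  - by have /measurable_EFinP := mk x.
  - by move=> z _; rewrite lee_fin !mulr_ge0// ?normal_pdf_ge0// ltW.
  - by rewrite lee_fin normal_pdf_ge0.
rewrite (@fubini_tonelli _ _ _ _ R mu mu G mG G0).
rewrite ge0_integral_normal_law; last 2 first.
- exact/measurable_EFinP.
- by move=> z; rewrite lee_fin.
apply: eq_integral => z _.
have GE x : G (x, z) = ((f z * normal_pdf 0 1 z)%:E *
    (normal_pdf (z / r) r^-1 x)%:E)%E.
  rewrite /G /= -EFinM; congr EFin.
  rewrite -!mulrA -normal_pdf_convolution -/r; congr (_ * _).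
  by rewrite -!mulrA; congr (_ * _); rewrite mulrC.
under eq_integral do rewrite GE.
rewrite ge0_integralZl//.
- by rewrite integral_normal_pdf mule1.
- by apply/measurable_EFinP; exact: measurable_normal_pdf.
- by move=> x _; rewrite lee_fin normal_pdf_ge0.
- by rewrite lee_fin mulr_ge0// normal_pdf_ge0.
Qed.

End normal_integrals.

Section exponential_moments.
Context {R : realType}.

(** Satisfied by nondegenerate normal laws and by Dirac masses alike. It makes Lipschitz functions
    and their exponentials integrable. *)
Definition exp_moments (nu : probability R R) : Prop :=
  forall t : R, nu.-integrable setT (EFin \o (fun z : R => expR (t * `|z|))).

Definition lipschitzR (L : R) (f : R -> R) : Prop :=
  forall x y, `|f x - f y| <= L * `|x - y|.

Lemma lipschitzR_continuous (L : R) (f : R -> R) : lipschitzR L f -> continuous f.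
Proof.
move=> fL x; apply/cvgrPdist_le => e e0.
have L0 : 0 < `|L| + 1 by rewrite ltr_wpDl.
near=> y; apply: le_trans (fL x y) _.
apply: (@le_trans _ _ ((`|L| + 1) * `|x - y|)).
  by rewrite ler_wpM2r// (le_trans (ler_norm _))// lerDl.
rewrite mulrC -ler_pdivlMr//; near: y.
by apply: cvgr_dist_le; [exact: cvg_id|rewrite divr_gt0].
Unshelve. all: by end_near. Qed.

Lemma lipschitzR_measurable (L : R) (f : R -> R) :
  lipschitzR L f -> measurable_fun setT f.
Proof. by move=> /lipschitzR_continuous; exact: continuous_measurable_fun. Qed.

Section with_exponential_moments.
Variable nu : probability R R.
Hypothesis nuexp : exp_moments nu.

Lemma exp_moments_dominated (f : R -> R) (C t : R) :
  measurable_fun setT f -> (forall z, `|f z| <= C * expR (t * `|z|)) ->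
  nu.-integrable setT (EFin \o f).
Proof.
move=> mf fC; apply: (@integrable_dominated _ _ _ nu _ _ mf fC).
exact: integrable_realZ.
Qed.

Lemma lipschitzR_integrable (L : R) (f : R -> R) :
  lipschitzR L f -> nu.-integrable setT (EFin \o f).
Proof.
move=> fL; apply: (@exp_moments_dominated _ (`|f 0| + `|L|) 1).
  exact: lipschitzR_measurable fL.
move=> z; rewrite mul1r.
have fz : `|f z| <= `|f 0| + `|L| * `|z|.
  rewrite -[f z](subrK (f 0)) addrC (le_trans (ler_normD _ _))// lerD2l.
  by apply: (le_trans (fL z 0)); rewrite subr0 ler_wpM2r// ler_norm.
apply: (le_trans fz); rewrite mulrDl lerD//.
  by rewrite ler_peMr// -expR0 ler_expR.
by rewrite ler_wpM2l// (le_trans _ (expR_ge1Dx _))// lerDr.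
Qed.

End with_exponential_moments.

Lemma normal_exp_moments (m s : R) : s != 0 -> exp_moments (normal_law m s).
Proof.
move=> s0 t; apply: (@integrable_dominated _ _ _ _ _
    (fun z => expR (t * z) + expR (- t * z))).
- by apply: measurableT_comp => //; apply: measurable_funM => //; exact: measurableT_comp.
- move=> z; rewrite ger0_norm ?expR_ge0//.
  have [z0|z0] := leP 0 z; first by rewrite ger0_norm// lerDl expR_ge0.
  by rewrite ltr0_norm// mulrN -mulNr lerDr expR_ge0.
- by apply: integrable_realD; exact: integrable_normal_expR.
Qed.

Lemma dirac_exp_moments (m : R) : exp_moments (\d_ m).
Proof.
move=> t; apply/integrableP; split.
  apply/measurable_EFinP; apply: measurableT_comp => //.
  by apply: measurable_funM => //; exact: measurableT_comp.
rewrite integral_dirac//; first by rewrite diracT mul1e ltry.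
apply: measurableT_comp => //; apply/measurable_EFinP; apply: measurableT_comp => //.
by apply: measurable_funM => //; exact: measurableT_comp.
Qed.

(** Write f as |f| - (|f| - f): both terms are nonnegative and Lipschitz, so the nonnegative case
    applies to each of them. *)
Lemma Rintegral_normal_convolution (L : R) (f : R -> R) : lipschitzR L f ->
  \int[normal_law 0 1]_x \int[normal_law 0 1]_y f ((x + y) / Num.sqrt 2) =
  \int[normal_law 0 1]_z f z.
Proof.
set r := Num.sqrt 2; set gam := normal_law 0 1 => fL.
have r0 : 0 < r by rewrite sqrtr_gt0.
have gexp : exp_moments gam by apply: normal_exp_moments; rewrite oner_eq0.
have intL g K : lipschitzR K g -> gam.-integrable setT (EFin \o g).
  exact: lipschitzR_integrable.
have lipx g K : lipschitzR K g -> forall x,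
    lipschitzR (K / r) (fun y => g ((x + y) / r)).
  move=> gK x y y'; apply: le_trans (gK _ _) _.
  rewrite -mulrBl opprD addrACA subrr add0r normrM normfV (gtr0_norm r0).
  by rewrite mulrA mulrAC.
have lipI g K : lipschitzR K g ->
    lipschitzR (K / r) (fun x => \int[gam]_y g ((x + y) / r)).
  move=> gK x x'; rewrite -RintegralB//;
    [|exact: intL (lipx _ _ gK x)|exact: intL (lipx _ _ gK x')].
  apply: le_trans (le_normr_Rintegral _ _) _ => //.
    by apply: integrable_realB; [exact: intL (lipx _ _ gK x)|exact: intL (lipx _ _ gK x')].
  rewrite -[leRHS](Rintegral_probability_cst gam); apply: le_Rintegral => //.
  - apply: integrable_norm.
    by apply: integrable_realB; [exact: intL (lipx _ _ gK x)|exact: intL (lipx _ _ gK x')].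
  - exact: integrable_cst.
  - move=> y _; apply: le_trans (gK _ _) _.
    rewrite -mulrBl opprD addrACA subrr addr0 normrM normfV (gtr0_norm r0).
    by rewrite mulrA mulrAC.
have pos g K : lipschitzR K g -> (forall x, 0 <= g x) ->
    \int[gam]_x \int[gam]_y g ((x + y) / r) = \int[gam]_z g z.
  move=> gK g0; rewrite /Rintegral -(ge0_normal_law_convolution (lipschitzR_continuous gK) g0).
  congr fine; apply: eq_integral => x _; rewrite fineK//.
  by apply: integrable_fin_num => //; exact: intL (lipx _ _ gK x).
pose g1 (x : R) : R := `|f x|; pose g2 (x : R) : R := `|f x| - f x.
have g1L : lipschitzR L g1.
  by move=> x y; apply: le_trans (ler_dist_dist _ _) (fL x y).
have g2L : lipschitzR (L + L) g2.
  move=> x y; rewrite /g2 opprD addrACA (le_trans (ler_normD _ _))// mulrDl.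
  by rewrite lerD//; [exact: g1L|rewrite -opprD normrN; exact: fL].
have fE x : f x = g1 x - g2 x by rewrite /g2 opprB addrC subrK.
have -> : \int[gam]_z f z = \int[gam]_z g1 z - \int[gam]_z g2 z.
  rewrite -RintegralB//; [|exact: intL g1L|exact: intL g2L].
  by apply: eq_Rintegral => x _.
have E1 := pos _ _ g1L (fun=> normr_ge0 _).
have E2 : \int[gam]_x \int[gam]_y g2 ((x + y) / r) = \int[gam]_z g2 z.
  by apply: (pos _ _ g2L) => x; rewrite subr_ge0 ler_norm.
rewrite -E1 -E2.
rewrite -RintegralB//; [|exact: intL (lipI _ _ g1L)|exact: intL (lipI _ _ g2L)].
apply: eq_Rintegral => x _.
rewrite -RintegralB//; [|exact: intL (lipx _ _ g1L x)|exact: intL (lipx _ _ g2L x)].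
by apply: eq_Rintegral => y _.
Qed.

(** The convolution identity applied to the identity function gives sqrt 2 * m = m for the mean
    m. *)
Lemma Rintegral_normal_id : \int[normal_law 0 1]_z z = 0 :> R.
Proof.
set gam := normal_law 0 1.
have gexp : exp_moments gam by apply: normal_exp_moments; rewrite oner_eq0.
have idL : lipschitzR 1 (fun z : R => z) by move=> x y; rewrite mul1r.
have intid : gam.-integrable setT (EFin \o (fun z : R => z)).
  exact: lipschitzR_integrable idL.
have r2 : Num.sqrt 2 ^+ 2 = 2 :> R by rewrite sqr_sqrtr.
set r : R := Num.sqrt 2 in r2 *.
have r0 : 0 < r by rewrite sqrtr_gt0.
have := Rintegral_normal_convolution idL.
rewrite -/gam -/r; set m := \int[gam]_z z.
have inner x : \int[gam]_y ((x + y) / r) = r^-1 * x + r^-1 * m.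
  under eq_Rintegral do rewrite mulrC.
  rewrite RintegralZl//; last by apply: integrable_realD => //; exact: integrable_cst.
  rewrite RintegralD//; last exact: integrable_cst.
  by rewrite Rintegral_probability_cst mulrDr.
under eq_Rintegral do rewrite inner.
rewrite RintegralD//; [|exact: integrable_realZ|exact: integrable_cst].
rewrite Rintegral_probability_cst RintegralZl// -/m => fixm.
have rm : r * m = m.
  by rewrite -[RHS]fixm -mulrDr -mulr2n -mulr_natl -r2; field; rewrite gt_eqF.
have : (r - 1) * m = 0 by rewrite mulrBl rm mul1r subrr.
move=> /eqP; rewrite mulf_eq0 => /orP[|/eqP//].
rewrite subr_eq0 => /eqP r1.
by move: r2; rewrite r1 expr1n => /eqP; rewrite eq_sym pnatr_eq1.
Qed.

End exponential_moments.

(** * Averaging operators *)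

Lemma Rintegral_dist_le {R : realType} d (T : measurableType d)
    (P : probability T R) (f g : T -> R) (e : T -> R) :
  P.-integrable setT (EFin \o f) -> P.-integrable setT (EFin \o g) ->
  P.-integrable setT (EFin \o e) -> (forall x, `|f x - g x| <= e x) ->
  `|\int[P]_x f x - \int[P]_x g x| <= \int[P]_x e x.
Proof.
move=> fi gi ei fg; rewrite -RintegralB//.
apply: le_trans (le_normr_Rintegral _ _) _ => //; first exact: integrable_realB.
by apply: le_Rintegral => //; apply: integrable_norm; exact: integrable_realB.
Qed.

Section averaging.
Context {R : realType} {S : finType}.
Implicit Types (f : (S -> R) -> R) (a x : S -> R) (L c : R)
  (nu : probability R R).

Definition sup_lipschitz L f : Prop := forall x y (e : R), 0 <= e ->
  (forall s, `|x s - y s| <= e) -> `|f x - f y| <= L * e.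

(* Closed under composition with any finite family of measurable functions;
   this avoids putting a sigma-algebra on [S -> R]. *)
Definition measurable_functional f : Prop :=
  forall d (U : measurableType d) (X : S -> U -> R),
    (forall s, measurable_fun setT (X s)) ->
    measurable_fun setT (fun u => f (fun s => X s u)).

(** The class in which the functionals live. It is closed under averages and soft maxima with the
    same [L], and under sums and multiples with the corresponding constant. *)
Definition admissible L f : Prop :=
  [/\ 0 <= L, sup_lipschitz L f & measurable_functional f].

Definition dir_bound c a : Prop := forall s, `|a s| <= c.

Lemma dir_bound_exists a : exists2 c : R, 0 <= c & dir_bound c a.
Proof.
exists (\sum_s `|a s|); first by apply: sumr_ge0.
by move=> s; rewrite (bigD1 s)//= lerDl sumr_ge0.
Qed.

Definition shift x (z : R) a : S -> R := fun s => x s + z * a s.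

Definition avg nu a f x : R := \int[nu]_z f (shift x z a).

Lemma sup_lipschitz_shift L f c a x : admissible L f -> 0 <= c -> dir_bound c a ->
  lipschitzR (L * c) (fun z => f (shift x z a)).
Proof.
move=> [L0 fL _] c0 ac z z'; rewrite -mulrA; apply: fL; first exact: mulr_ge0.
move=> s; rewrite /shift opprD addrACA subrr add0r -mulrBl normrM mulrC.
by rewrite ler_wpM2r.
Qed.

Lemma admissible_integrable nu L f a x : exp_moments nu -> admissible L f ->
  nu.-integrable setT (EFin \o (fun z => f (shift x z a))).
Proof.
move=> nuexp fL; have [c c0 ac] := dir_bound_exists a.
exact: lipschitzR_integrable nuexp _ _ (sup_lipschitz_shift x fL c0 ac).
Qed.

Section fixed_law.
Variable nu : probability R R.
Hypothesis nuexp : exp_moments nu.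

Lemma avg_le L1 L2 a f1 f2 e x : admissible L1 f1 -> admissible L2 f2 ->
  (forall y, f1 y <= f2 y + e) -> avg nu a f1 x <= avg nu a f2 x + e.
Proof.
move=> f1L f2L f12; rewrite -(Rintegral_probability_cst nu e) -RintegralD//.
- apply: le_Rintegral => //; first exact: admissible_integrable f1L.
  apply: integrable_realD; first exact: admissible_integrable f2L.
  exact: integrable_cst.
- exact: admissible_integrable f2L.
- exact: integrable_cst.
Qed.

Lemma avg_dist_le L1 L2 a f1 f2 e x : admissible L1 f1 -> admissible L2 f2 ->
  (forall y, `|f1 y - f2 y| <= e) -> `|avg nu a f1 x - avg nu a f2 x| <= e.
Proof.
move=> f1L f2L f12; rewrite -(Rintegral_probability_cst nu e).
apply: Rintegral_dist_le => //; last exact: integrable_cst.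
- exact: admissible_integrable f1L.
- exact: admissible_integrable f2L.
Qed.

Lemma admissible_avg L f a : admissible L f -> admissible L (avg nu a f).
Proof.
move=> fL; have [L0 fLip fm] := fL; split => //.
  move=> x y e e0 xy; rewrite -(Rintegral_probability_cst nu (L * e)).
  apply: Rintegral_dist_le; [exact: admissible_integrable fL|
    exact: admissible_integrable fL|exact: integrable_cst|].
  move=> z; apply: fLip => // s.
  by rewrite /shift opprD addrACA subrr addr0.
move=> d U X mX.
have mf : measurable_fun setT (fun p : U * R => f (fun s => X s p.1 + p.2 * a s)).
  apply: fm => s; apply: measurable_funD; last exact: measurable_funM.
  exact: measurableT_comp.
exact: (measurable_fun_Rintegral2 nu mf).
Qed.

Lemma avg_dist_id L c f a x : admissible L f -> 0 <= c -> dir_bound c a ->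
  `|avg nu a f x - f x| <= L * c * \int[nu]_z `|z|.
Proof.
move=> fL c0 ac; have aL := sup_lipschitz_shift x fL c0 ac.
rewrite -(Rintegral_probability_cst nu (f x)).
have absI : nu.-integrable setT (EFin \o (fun z : R => `|z|)).
  apply: (@lipschitzR_integrable _ nu nuexp 1) => u v; rewrite mul1r.
  exact: ler_dist_dist.
rewrite -RintegralZl//; apply: Rintegral_dist_le.
- exact: admissible_integrable fL.
- exact: integrable_cst.
- exact: integrable_realZ.
- move=> z; rewrite [X in `|_ - f X|](_ : x = shift x 0 a).
    by have := aL z 0; rewrite subr0.
  by apply/funext => s; rewrite /shift mul0r addr0.
Qed.

End fixed_law.

(** Fubini's theorem, with the product bound K exp |y| exp |z| deduced from the Lipschitz property.
    All rearrangements of random variables go back to this lemma. *)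
Lemma avgC nu1 nu2 L f a b x : exp_moments nu1 -> exp_moments nu2 ->
  admissible L f -> avg nu1 a (avg nu2 b f) x = avg nu2 b (avg nu1 a f) x.
Proof.
move=> e1 e2 fL; have [L0 fLip fm] := fL.
have [c c0 ac] := dir_bound_exists a; have [c' c'0 bc] := dir_bound_exists b.
pose F (p : R * R) := f (fun s => x s + p.1 * a s + p.2 * b s).
have mF : measurable_fun setT F.
  apply: fm => s; apply: measurable_funD; last exact: measurable_funM.
  by apply: measurable_funD => //; exact: measurable_funM.
pose K : R := `|f x| + L * c + L * c'.
have K0 : 0 <= K by rewrite !addr_ge0// mulr_ge0.
have FK y z : `|F (y, z)| <= (K * expR (1 * `|y|)) * expR (1 * `|z|).
  rewrite !mul1r.
  have ey : 1 + `|y| <= expR `|y| by exact: expR_ge1Dx.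
  have ez : 1 + `|z| <= expR `|z| by exact: expR_ge1Dx.
  have Fx : `|F (y, z) - f x| <= L * (`|y| * c + `|z| * c').
    apply: fLip; first by rewrite addr_ge0// mulr_ge0.
    move=> s; rewrite /= [X in `|X|](_ : _ = y * a s + z * b s); last by ring.
    by rewrite (le_trans (ler_normD _ _))// !normrM lerD// ler_wpM2l.
  have Fle : `|F (y, z)| <= `|f x| + L * (`|y| * c + `|z| * c').
    by rewrite -[F _](subrK (f x)) addrC (le_trans (ler_normD _ _))// lerD2l.
  apply: (le_trans Fle); apply: (@le_trans _ _ (K * (1 + `|y|) * (1 + `|z|))).
    rewrite /K -subr_ge0 [X in 0 <= X](_ : _ =
      `|f x| * (`|y| + `|z| + `|y| * `|z|) +
      L * c * (1 + `|z| + `|y| * `|z|) + L * c' * (1 + `|y| + `|y| * `|z|));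
      last by ring.
    by rewrite !addr_ge0// !mulr_ge0// ?addr_ge0// ?mulr_ge0.
  have n1 (u : R) : 0 <= 1 + `|u| by rewrite addr_ge0.
  by apply: ler_pM; rewrite ?ler_wpM2l// mulr_ge0.
have u0 (y : R) : 0 <= K * expR (1 * `|y|) by rewrite mulr_ge0// expR_ge0.
have v0 (z : R) : 0 <= expR (1 * `|z|) :> R by exact: expR_ge0.
have iu := integrable_realZ K (e1 1).
have H := Rintegral_prod mF FK u0 v0 iu (e2 1).
have := Rintegral_prod_swap mF FK u0 v0 iu (e2 1); rewrite H.
move=> swap; rewrite /avg [RHS](_ : _ = \int[nu1]_y \int[nu2]_z F (y, z)); last first.
  rewrite swap; apply: eq_Rintegral => z _; apply: eq_Rintegral => y _.
  by rewrite /F /=; congr f; apply/funext => s; rewrite /shift addrAC.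
apply: eq_Rintegral => y _; apply: eq_Rintegral => z _.
by rewrite /F /=; congr f; apply/funext => s; rewrite /shift.
Qed.

End averaging.

(** * Soft maxima *)

Section exponential_bounds.
Context {R : realType}.

(** One step of a Taylor remainder estimate: the bound on the derivative increases with |y|, so the
    mean value theorem turns it into a bound on [k] with one more power. Iterating from the
    exponential gives the next three lemmas. *)
Lemma mvt_abs_bound (k g : R -> R) (n : nat) :
  k 0 = 0 -> (forall y : R, is_derive y 1 k (g y)) ->
  (forall y : R, `|g y| <= `|y| ^+ n * expR `|y|) ->
  forall y : R, `|k y| <= `|y| ^+ n.+1 * expR `|y|.
Proof.
move=> k0 dk gn y.
have ck (a b : R) : {within `[a, b], continuous k}.
  apply: continuous_subspaceT => z; apply: differentiable_continuous.
  by apply/derivable1_diffP; have := dk z => ?; exact: ex_derive.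
have main (c : R) : `|c| <= `|y| -> k y = g c * y -> `|k y| <= `|y| ^+ n.+1 * expR `|y|.
  move=> cy ->; rewrite normrM exprSr mulrAC ler_wpM2r//.
  by apply: le_trans (gn c) _; rewrite ler_pM ?exprn_ge0 ?expR_ge0 ?lerXn2r ?nnegrE ?ler_expR.
have [y0|y0] := leP 0 y.
  have [c cI] := MVT_segment y0 (fun x _ => dk x) (ck _ _).
  rewrite k0 !subr0; apply: main.
  by move: cI; rewrite in_itv/= => /andP[c0 cy]; rewrite !ger0_norm.
have [c cI] := MVT_segment (ltW y0) (fun x _ => dk x) (ck _ _).
rewrite k0 !sub0r mulrN => /oppr_inj; apply: main.
move: cI; rewrite in_itv/= => /andP[c0 cy].
by rewrite !ler0_norm ?lerN2// ltW.
Qed.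

Lemma expR_taylor1 (y : R) : `|expR y - 1| <= `|y| * expR `|y|.
Proof.
rewrite -[X in X * _]expr1.
apply: (@mvt_abs_bound (fun y => expR y - 1) expR 0).
- by rewrite expR0 subrr.
- by move=> z; apply: is_derive_eq; rewrite subr0.
- by move=> z; rewrite mul1r ger0_norm ?expR_ge0// ler_expR ler_norm.
Qed.

Lemma expR_taylor2 (y : R) : `|expR y - 1 - y| <= `|y| ^+ 2 * expR `|y|.
Proof.
apply: (@mvt_abs_bound (fun y => expR y - 1 - y) (fun y => expR y - 1) 1).
- by rewrite expR0 subrr subr0.
- by move=> z; apply: is_derive_eq; rewrite subr0.
- by move=> z; rewrite expr1 expR_taylor1.
Qed.

Lemma expR_taylor3 (y : R) :
  `|expR y - 1 - y - y ^+ 2 / 2| <= `|y| ^+ 3 * expR `|y|.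
Proof.
apply: (@mvt_abs_bound (fun y => expR y - 1 - y - y ^+ 2 / 2)
  (fun y => expR y - 1 - y) 2).
- by rewrite expR0 subrr subr0 expr0n mul0r subr0.
- move=> z; apply: is_derive_eq.
  by rewrite subr0 !scaler0 add0r /GRing.scale/=; field.
- exact: expR_taylor2.
Qed.

End exponential_bounds.

Section log_sum_exp.
Context {R : realType}.

Section basic.
Context {K : finType} (k0 : K).
Implicit Types y : K -> R.

Definition lse y : R := ln (\sum_k expR (y k)).

Lemma sum_expR_gt0 y : 0 < \sum_k expR (y k).
Proof.
rewrite (bigD1 k0)//= ltr_wpDr// ?expR_gt0//.
by apply: sumr_ge0 => k _; exact: expR_ge0.
Qed.

Lemma expR_lse y : expR (lse y) = \sum_k expR (y k).
Proof. by rewrite lnK// posrE sum_expR_gt0. Qed.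

Lemma lse_le y y' (e : R) : (forall k, y k <= y' k + e) -> lse y <= lse y' + e.
Proof.
move=> yy'; rewrite -ler_expR expRD !expR_lse mulr_suml ler_sum// => k _.
by rewrite -expRD ler_expR.
Qed.

Lemma lse_lipschitz y y' (e : R) : (forall k, `|y k - y' k| <= e) ->
  `|lse y - lse y'| <= e.
Proof.
move=> yy'; rewrite ler_norml; apply/andP; split.
  rewrite lerBrDr addrC lerBlDr; apply: lse_le => k; rewrite -lerBlDl.
  by have := yy' k; rewrite distrC; apply: le_trans; rewrite ler_norm.
rewrite lerBlDr addrC; apply: lse_le => k; rewrite -lerBlDl.
by apply: le_trans (yy' k); exact: ler_norm.
Qed.

Lemma le_lse y k : y k <= lse y.
Proof.
rewrite -ler_expR expR_lse (bigD1 k)//= lerDl.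
by apply: sumr_ge0 => i _; exact: expR_ge0.
Qed.

Lemma lse_le_card y (M : R) : (forall k, y k <= M) -> lse y <= ln #|K|%:R + M.
Proof.
move=> yM; have K0 : (0 : R) < #|K|%:R by rewrite ltr0n; apply/card_gt0P; exists k0.
rewrite -ler_expR expR_lse expRD lnK ?posrE// mulr_natl.
apply: (@le_trans _ _ (\sum_(k : K) expR M)); last by rewrite sumr_const.
by apply: ler_sum => k _; rewrite ler_expR.
Qed.

End basic.

Lemma measurable_lse (K : finType) d (U : measurableType d) (X : K -> U -> R) :
  (forall k, measurable_fun setT (X k)) ->
  measurable_fun setT (fun u => lse (fun k => X k u)).
Proof.
move=> mX; apply: measurableT_comp => //.
by apply: measurable_sum => k; exact: measurableT_comp.
Qed.

Lemma admissible_lse (S : finType) (s0 : S) : admissible 1 (@lse S).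
Proof.
split => //; last by move=> d U X mX; exact: measurable_lse.
by move=> x y e e0 xy; rewrite mul1r; exact: lse_lipschitz.
Qed.

Section soft_maximum.
Context {K S : finType} (k0 : K).
Variable nu : probability R R.
Hypothesis nuexp : exp_moments nu.

(** For theta > 0 it lies between the maximum of the F k and this maximum plus ln #|K| / theta: a
    large [theta] brings it close to the maximum, a small one makes it cheap to exchange with
    averages. *)
Definition smax (theta : R) (F : K -> (S -> R) -> R) (x : S -> R) : R :=
  theta^-1 * lse (fun k => theta * F k x).

Lemma admissible_smax (L theta : R) F : 0 < theta ->
  (forall k, admissible L (F k)) -> admissible L (smax theta F).
Proof.
move=> t0 FL; split; first by have [] := FL k0.
- move=> x y e e0 xy; rewrite /smax -mulrBr normrM gtr0_norm ?invr_gt0//.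
  rewrite ler_pdivrMl//; apply: (lse_lipschitz k0) => k.
  rewrite -mulrBr normrM gtr0_norm// ler_wpM2l ?(ltW t0)//.
  by have [_ FkL _] := FL k; exact: (FkL _ _ _ e0 xy).
- move=> d U X mX; apply: measurable_funM => //; apply: measurable_lse => k.
  by apply: measurable_funM => //; have [_ _] := FL k; exact.
Qed.

Definition abs_mean : R := \int[nu]_z `|z|.

(** A [c]-Lipschitz F deviates from its mean by at most c (|z| + [abs_mean]), so this integral
    bounds the second-order Taylor remainder of exp (theta (F - m)) after the factor (theta c)^2 is
    taken out. *)
Definition softmax_cst : R :=
  \int[nu]_z ((`|z| + abs_mean) ^+ 2 * expR (`|z| + abs_mean)).

Lemma integrable_abs : nu.-integrable setT (EFin \o (fun z : R => `|z|)).
Proof.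
apply: (@lipschitzR_integrable _ nu nuexp 1) => u v; rewrite mul1r.
exact: ler_dist_dist.
Qed.

Lemma abs_mean_ge0 : 0 <= abs_mean.
Proof. exact: Rintegral_ge0. Qed.

Lemma sqr_le_expR (w : R) : 0 <= w -> w ^+ 2 <= 4 * expR w.
Proof.
move=> w0; have := @expR_ge1Dx R (w / 2) => h.
have h2 : (1 + w / 2) ^+ 2 <= expR w.
  rewrite (_ : expR w = expR (w / 2) ^+ 2); last by rewrite expr2 -expRD; congr expR; field.
  by rewrite lerXn2r ?nnegrE ?expR_ge0// addr_ge0// divr_ge0.
nra.
Qed.

Lemma integrable_softmax_cst : nu.-integrable setT
  (EFin \o (fun z : R => (`|z| + abs_mean) ^+ 2 * expR (`|z| + abs_mean))).
Proof.
apply: (@exp_moments_dominated _ nu nuexp _ (4 * expR (2 * abs_mean)) 2).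
  have mw : measurable_fun setT (fun z : R => `|z| + abs_mean).
    by apply: measurable_funD => //; exact: measurableT_comp.
  by apply: measurable_funM; [exact: measurable_funX|exact: measurableT_comp].
move=> z; have w0 : 0 <= `|z| + abs_mean by rewrite addr_ge0// abs_mean_ge0.
rewrite ger0_norm; last by rewrite mulr_ge0 ?exprn_ge0 ?expR_ge0.
apply: (@le_trans _ _ (4 * expR (`|z| + abs_mean) * expR (`|z| + abs_mean))).
  by rewrite ler_wpM2r ?expR_ge0// sqr_le_expR.
by rewrite -!mulrA ler_wpM2l// -!expRD ler_expR; lra.
Qed.

Lemma softmax_cst_ge0 : 0 <= softmax_cst.
Proof.
by apply: Rintegral_ge0 => z _; rewrite mulr_ge0 ?expR_ge0 ?exprn_ge0// addr_ge0// abs_mean_ge0.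
Qed.

Lemma lipschitzR_exp_integrable (theta c : R) (F : R -> R) (m : R) :
  0 <= theta -> lipschitzR c F ->
  nu.-integrable setT (EFin \o (fun z => expR (theta * (F z - m)))).
Proof.
move=> t0 FL; apply: (@exp_moments_dominated _ nu nuexp _
  (expR (theta * (F 0 - m))) (theta * c)).
  apply: measurableT_comp => //; apply: measurable_funM => //.
  by apply: measurable_funB => //; exact: lipschitzR_measurable FL.
move=> z; rewrite ger0_norm ?expR_ge0// -expRD ler_expR -mulrA -mulrDr.
rewrite ler_wpM2l// addrAC lerB// -lerBlDl (le_trans (ler_norm _))//.
by rewrite (le_trans (FL z 0))// subr0.
Qed.

(** The first-order term of the exponential integrates to 0, and only the second-order remainder is
    left. The condition theta c <= 1 replaces the exponent theta c w by w in that remainder. *)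
Lemma lipschitzR_subgaussian (theta c : R) (F : R -> R) (m := \int[nu]_z F z) :
  0 <= theta -> 0 <= c -> theta * c <= 1 -> lipschitzR c F ->
  \int[nu]_z expR (theta * (F z - m)) <= 1 + softmax_cst * (theta * c) ^+ 2.
Proof.
move=> t0 c0 tc FL.
have iF := lipschitzR_integrable nuexp FL.
(* The mean is an average over an independent copy y, and |F z - F y| <= c (|z| + |y|). *)
have Fm z : `|F z - m| <= c * (`|z| + abs_mean).
  rewrite -(Rintegral_probability_cst nu (F z)).
  rewrite (_ : c * _ = \int[nu]_y (c * (`|z| + `|y|))); last first.
    rewrite RintegralZl//; last by apply: integrable_realD; [exact: integrable_cst|exact: integrable_abs].
    rewrite RintegralD//; [|exact: integrable_cst|exact: integrable_abs].
    by rewrite Rintegral_probability_cst.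
  apply: Rintegral_dist_le => //; first exact: integrable_cst.
    by apply: integrable_realZ; apply: integrable_realD; [exact: integrable_cst|exact: integrable_abs].
  by move=> y; rewrite (le_trans (FL z y))// ler_wpM2l// ler_normB.
have pt z : expR (theta * (F z - m)) <= 1 + (theta * (F z - m) +
    (theta * c) ^+ 2 * ((`|z| + abs_mean) ^+ 2 * expR (`|z| + abs_mean))).
  have w0 : 0 <= `|z| + abs_mean by rewrite addr_ge0// abs_mean_ge0.
  set u := theta * (F z - m); set w := `|z| + abs_mean in w0 *.
  have uw : `|u| <= theta * c * w.
    by rewrite normrM ger0_norm// -mulrA ler_wpM2l.
  have uw1 : `|u| <= w by rewrite (le_trans uw)// ler_piMl.
  have := expR_taylor2 u => /(le_trans (ler_norm _)); rewrite -!lerBlDl => /le_trans; apply.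
  rewrite mulrA -exprMn; apply: ler_pM; rewrite ?exprn_ge0 ?expR_ge0 ?ler_expR//.
  by rewrite lerXn2r ?nnegrE// mulr_ge0// mulr_ge0.
have iu : nu.-integrable setT (EFin \o (fun z => theta * (F z - m))).
  by apply: integrable_realZ; apply: integrable_realB => //; exact: integrable_cst.
have iv := integrable_realZ ((theta * c) ^+ 2) integrable_softmax_cst.
have iuv := integrable_realD iu iv.
apply: le_trans (le_Rintegral _ _ _ (fun z _ => pt z)) _ => //.
- exact: lipschitzR_exp_integrable FL.
- by apply: integrable_realD => //; exact: integrable_cst.
rewrite RintegralD//; last exact: integrable_cst.
rewrite RintegralD// Rintegral_probability_cst RintegralZl//; last first.
  by apply: integrable_realB => //; exact: integrable_cst.
rewrite RintegralB//; last exact: integrable_cst.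
rewrite Rintegral_probability_cst subrr mulr0 add0r RintegralZl//.
  by rewrite [X in _ <= _ + X]mulrC.
exact: integrable_softmax_cst.
Qed.

Lemma ln_tangent (v A : R) : 0 < v -> 0 < A -> ln v <= ln A + v / A - 1.
Proof.
move=> v0 A0; have := @expR_ge1Dx R (ln (v / A)); rewrite lnK ?posrE ?divr_gt0//.
by rewrite ln_div ?posrE//; lra.
Qed.

(* Linearizing [ln] at [A], where each [F k] is replaced by its average, reduces the
   claim to the exponential moments of each [F k] separately; hence the error term
   does not depend on the number of elements of [K]. *)
Lemma avg_smax_le (theta c : R) (F : K -> (S -> R) -> R) (a x : S -> R) :
  0 < theta -> 0 <= c -> theta * c <= 1 -> dir_bound c a ->
  (forall k, admissible 1 (F k)) ->
  avg nu a (smax theta F) x <=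
  smax theta (fun k => avg nu a (F k)) x + softmax_cst * theta * c ^+ 2.
Proof.
move=> t0 c0 tc ac FL.
have t0' := ltW t0.
have lipF k : lipschitzR c (fun z => F k (shift x z a)).
  by have := sup_lipschitz_shift x (FL k) c0 ac; rewrite mul1r.
pose m k := avg nu a (F k) x.
pose A := \sum_k expR (theta * m k).
have A0 : 0 < A by exact: sum_expR_gt0.
pose w k := expR (theta * m k) / A.
have w0 k : 0 <= w k by rewrite divr_ge0 ?expR_ge0 ?ltW.
have w1 : \sum_k w k = 1 by rewrite -mulr_suml divff// gt_eqF.
pose E k z := expR (theta * (F k (shift x z a) - m k)).
have iE k : nu.-integrable setT (EFin \o E k).
  exact: lipschitzR_exp_integrable (lipF k).
have iS : nu.-integrable setT (EFin \o (fun z => \sum_k w k * E k z)).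
  have : nu.-integrable setT (fun z => \sum_(k : K) (w k * E k z)%:E)%E.
    by apply: integrable_sum => // k _; exact: integrable_realZ.
  by apply: eq_integrable => // z _ /=; rewrite sumEFin.
have pt z : smax theta F (shift x z a) <=
    theta^-1 * (ln A - 1) + theta^-1 * \sum_k w k * E k z.
  rewrite -mulrDr ler_wpM2l ?invr_ge0// /lse.
  have := ln_tangent (sum_expR_gt0 k0 (fun k => theta * F k (shift x z a))) A0.
  move=> /le_trans; apply; rewrite addrAC lerD2l mulr_suml ler_sum// => k _.
  by rewrite /w /E mulrAC -expRD -mulrDr addrC subrK.
have iL := admissible_integrable a x nuexp (admissible_smax t0 FL).
apply: le_trans (le_Rintegral _ iL _ (fun z _ => pt z)) _ => //.
  by apply: integrable_realD; [exact: integrable_cst|exact: integrable_realZ].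
rewrite RintegralD//; [|exact: integrable_cst|exact: integrable_realZ].
rewrite Rintegral_probability_cst RintegralZl// -mulrDr.
have -> : \int[nu]_z (\sum_k w k * E k z) = \sum_k w k * \int[nu]_z E k z.
  rewrite Rintegral_sum// => [|k]; last exact: integrable_realZ.
  by apply: eq_bigr => k _; rewrite RintegralZl.
have le1 : \sum_k w k * \int[nu]_z E k z <= 1 + softmax_cst * (theta * c) ^+ 2.
  rewrite -[leRHS]mul1r -{1}w1 mulr_suml ler_sum// => k _.
  by rewrite ler_wpM2l//; exact: (lipschitzR_subgaussian t0' c0 tc (lipF k)).
rewrite /smax (_ : lse _ = ln A)//.
rewrite [X in _ <= X](_ : _ = theta^-1 * (ln A + softmax_cst * (theta * c) ^+ 2)); last first.
  by field; rewrite gt_eqF.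
by rewrite ler_wpM2l ?invr_ge0//; lra.
Qed.

End soft_maximum.
End log_sum_exp.

(** * Iterated averages, exchange of blocks and splitting of normal variables *)

Section iterated_averaging.
Context {R : realType} {S : finType}.
Implicit Types (f : (S -> R) -> R) (a x : S -> R) (l : seq (S -> R)).

Definition avgs (nu : probability R R) l f := foldr (avg nu) f l.

Definition sup_norm a : R := \big[Num.max/0]_s `|a s|.

Lemma sup_norm_ge0 a : 0 <= sup_norm a.
Proof. by rewrite /sup_norm; elim/big_rec: _ => // s y _ y0; rewrite le_max y0 orbT. Qed.

Lemma sup_norm_bound a : dir_bound (sup_norm a) a.
Proof. by move=> s; rewrite /sup_norm (bigD1 s)//= le_max lexx. Qed.

Lemma sup_norm_le a (c : R) : 0 <= c -> dir_bound c a -> sup_norm a <= c.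
Proof.
move=> c0 ac; rewrite /sup_norm; elim/big_rec: _ => // s y _ yc.
by rewrite ge_max ac.
Qed.

Section fixed_law.
Variable nu : probability R R.
Hypothesis nuexp : exp_moments nu.

Lemma admissible_avgs (L : R) l f : admissible L f -> admissible L (avgs nu l f).
Proof. by elim: l => //= a l IH fL; apply: admissible_avg => //; exact: IH. Qed.

Lemma avgs_le (L1 L2 e : R) l f1 f2 x : admissible L1 f1 -> admissible L2 f2 ->
  (forall y, f1 y <= f2 y + e) -> avgs nu l f1 x <= avgs nu l f2 x + e.
Proof.
move=> f1L f2L f12; elim: l x => [x|a l IH x]; first exact: f12.
by apply: avg_le; [exact: nuexp|exact: admissible_avgs f1L|exact: admissible_avgs f2L|exact: IH].
Qed.

Lemma avgs_cat l1 l2 f : avgs nu (l1 ++ l2) f = avgs nu l1 (avgs nu l2 f).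
Proof. exact: foldr_cat. Qed.

(** The averaged F k remain admissible with constant 1, so the one-direction estimate can be
    repeated, and the costs of the directions add up. *)
Lemma avgs_smax_le (K : finType) (k0 : K) (theta : R)
    (F : K -> (S -> R) -> R) l x :
  0 < theta -> (forall k, admissible 1 (F k)) ->
  all (fun a => theta * sup_norm a <= 1) l ->
  avgs nu l (smax theta F) x <=
  smax theta (fun k => avgs nu l (F k)) x +
  softmax_cst nu * theta * \sum_(a <- l) sup_norm a ^+ 2.
Proof.
move=> t0 FL; elim: l x => [x _|a l IH x /= /andP[ta tl]].
  by rewrite big_nil mulr0 addr0.
have AL k : admissible 1 (avgs nu l (F k)) by exact: admissible_avgs.
have := @avg_le _ _ nu nuexp 1 1 a (avgs nu l (smax theta F))
  (smax theta (fun k => avgs nu l (F k))) _ x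
  (admissible_avgs _ (admissible_smax k0 t0 FL)) (admissible_smax k0 t0 AL)
  (fun y => IH y tl).
move=> /le_trans; apply; rewrite big_cons mulrDr addrA lerD2r.
exact: avg_smax_le (sup_norm_ge0 a) ta (sup_norm_bound a) AL.
Qed.

End fixed_law.

Lemma avgsC (nu1 nu2 : probability R R) (L : R) l1 l2 f :
  exp_moments nu1 -> exp_moments nu2 -> admissible L f ->
  avgs nu1 l1 (avgs nu2 l2 f) = avgs nu2 l2 (avgs nu1 l1 f).
Proof.
move=> e1 e2 fL.
have one a g : admissible L g -> avg nu1 a (avgs nu2 l2 g) = avgs nu2 l2 (avg nu1 a g).
  move=> gL; elim: l2 => //= b l2 <-; apply/funext => x.
  by apply: (@avgC _ _ _ _ L) => //; exact: admissible_avgs.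
elim: l1 => //= a l1 ->; apply: one; exact: admissible_avgs.
Qed.

Section telescoping.
Variables (nu : probability R R) (L : R) (lX lY : seq (S -> R)).
Hypothesis nuexp : exp_moments nu.

Lemma admissible_iter_avgs n l f : admissible L f ->
  admissible L (iter n (avgs nu l) f).
Proof. by move=> fL; elim: n => //= n IH; exact: admissible_avgs. Qed.

Lemma iter_avgsC n l1 l2 f : admissible L f ->
  iter n (avgs nu l1) (avgs nu l2 f) = avgs nu l2 (iter n (avgs nu l1) f).
Proof.
move=> fL; elim: n => //= n ->; apply: (@avgsC _ _ L) => //.
exact: admissible_iter_avgs.
Qed.

(** The hypothesis compares blocks applied directly to [f]. Commutation moves the [lY] block that is
    to be exchanged to the innermost place, where the hypothesis applies; the outer averages
    preserve the error [e]. *)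
Lemma iter_avgs_telescope n f (e : R) : admissible L f ->
  (forall y, avgs nu lY f y <= avgs nu lX f y + e) ->
  forall x, iter n (avgs nu lY) f x <= iter n (avgs nu lX) f x + n%:R * e.
Proof.
move=> fL YX; elim: n => [|n IH] x; first by rewrite mul0r addr0.
rewrite [iter n.+1 (avgs nu lX) f]iterSr iterS -natr1 mulrDl mul1r addrA.
have := @avgs_le nu nuexp L L _ lY _ _ x (admissible_iter_avgs n lY fL)
  (admissible_iter_avgs n lX fL) IH.
rewrite -(@iter_avgsC n lX lY f fL) => /le_trans; apply.
rewrite [X in _ <= X]addrAC lerD2r.
have : forall y, avgs nu lY f y <= avgs nu lX f y + e by [].
have f1 := @admissible_avgs nu nuexp L lY f fL.
have f2 := @admissible_avgs nu nuexp L lX f fL.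
move=> H; elim: n {IH} x => [|n IH2] x /=; first exact: H.
by apply: (@avgs_le _ nuexp L L) => //; exact: admissible_iter_avgs.
Qed.

End telescoping.

Definition scale_dirs (r : R) l : seq (S -> R) := [seq (fun s => r * a s) | a <- l].

Lemma scale_dirs1 l : scale_dirs 1 l = l.
Proof.
rewrite /scale_dirs -[RHS]map_id; apply: eq_map => a.
by apply/funext => s; rewrite mul1r.
Qed.

Lemma scale_dirsM (r1 r2 : R) l : scale_dirs r1 (scale_dirs r2 l) = scale_dirs (r1 * r2) l.
Proof.
rewrite /scale_dirs -map_comp; apply: eq_map => a /=.
by apply/funext => s; rewrite mulrA.
Qed.

Local Notation gam := (normal_law (0 : R) 1).

Lemma normal_law01_exp_moments : exp_moments gam.
Proof. by apply: normal_exp_moments; rewrite oner_eq0. Qed.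

Lemma avg_normal_double (L : R) f a x (b := fun s => (Num.sqrt 2)^-1 * a s) :
  admissible L f -> avg gam b (avg gam b f) x = avg gam a f x.
Proof.
move=> fL.
have H := Rintegral_normal_convolution
  (sup_lipschitz_shift x fL (sup_norm_ge0 a) (sup_norm_bound a)).
rewrite /avg -[RHS]H; apply: eq_Rintegral => z _; apply: eq_Rintegral => y _.
congr f; apply/funext => s; rewrite /shift /b -addrA -mulrDl; congr (_ + _).
by rewrite mulrA.
Qed.

Lemma avgs_normal_double (L : R) f l (r := (Num.sqrt 2)^-1 : R) :
  admissible L f ->
  avgs gam (scale_dirs r l) (avgs gam (scale_dirs r l) f) = avgs gam l f.
Proof.
move=> fL; elim: l => //= a l IH.
set b := fun s => r * a s.
have gexp := normal_law01_exp_moments.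
have AL := admissible_avgs gexp (scale_dirs r l) fL.
(* Commutation brings the two copies of [b] next to each other, where they merge into one average
   along [a]. *)
have E := @avgsC _ _ L (scale_dirs r l) [:: b] _ gexp gexp AL.
rewrite /= in E; rewrite E IH; apply/funext => x.
by apply: (@avg_normal_double L); exact: (admissible_avgs gexp).
Qed.

Lemma avgs_normal_dyadic (L : R) f l (j : nat) : admissible L f ->
  iter (2 ^ j) (avgs gam (scale_dirs ((Num.sqrt 2)^-1 ^+ j) l)) f = avgs gam l f.
Proof.
move=> fL; elim: j => [|j IH]; first by rewrite expr0 scale_dirs1.
rewrite -IH exprS -scale_dirsM.
set l' := scale_dirs (_ ^+ j) l.
have gexp := normal_law01_exp_moments.
(* Blocks merge in pairs: 2 n blocks at the finer scale are n blocks at the coarser one. *)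
rewrite expnS; elim: (2 ^ j)%N => [|n IHn]; first by rewrite muln0.
rewrite mulnS add2n !iterS IHn; apply: (@avgs_normal_double L).
exact: (admissible_iter_avgs gexp).
Qed.

End iterated_averaging.

(** * Gaussian comparison *)

Section gibbs.
Context {R : realType} {S : finType} (s0 : S).
Implicit Types (a b x y : S -> R).

Definition gibbs x (s : S) : R := expR (x s - lse x).

Lemma gibbs_ge0 x s : 0 <= gibbs x s. Proof. exact: expR_ge0. Qed.

Lemma sum_gibbs x : \sum_s gibbs x s = 1.
Proof.
under eq_bigr do rewrite /gibbs expRD.
by rewrite -mulr_suml -(expR_lse s0) -expRD subrr expR0.
Qed.

Definition gmean x b : R := \sum_s gibbs x s * b s.

(** Variance of [a] under the Gibbs weights at [x]; it is the second derivative of [lse] at [x] in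
    the direction [a]. *)
Definition gvar a x : R := gmean x (fun s => a s ^+ 2) - gmean x a ^+ 2.

Lemma gmean_bound x b (m : R) : (forall s, `|b s| <= m) -> `|gmean x b| <= m.
Proof.
move=> bm; rewrite (le_trans (ler_norm_sum _ _ _))//.
rewrite -[m]mul1r -(sum_gibbs x) mulr_suml ler_sum// => s _.
by rewrite normrM ger0_norm ?gibbs_ge0// ler_wpM2l// gibbs_ge0.
Qed.

Lemma gmeanB x b b' : gmean x (fun s => b s - b' s) = gmean x b - gmean x b'.
Proof. by rewrite /gmean -sumrB; apply: eq_bigr => s _; rewrite mulrBr. Qed.

Lemma gmeanZ x b (k : R) : gmean x (fun s => k * b s) = k * gmean x b.
Proof. by rewrite /gmean mulr_sumr; apply: eq_bigr => s _; rewrite mulrCA. Qed.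

Lemma gmean_cst x (k : R) : gmean x (fun=> k) = k.
Proof. by rewrite /gmean -mulr_suml sum_gibbs mul1r. Qed.

Lemma gvarZ a x (k : R) : gvar (fun s => k * a s) x = k ^+ 2 * gvar a x.
Proof.
rewrite /gvar gmeanZ exprMn mulrBr -gmeanZ; congr (gmean _ _ - _).
by apply/funext => s; rewrite exprMn.
Qed.

(** The increment t of [lse] satisfies exp t = Gibbs mean of exp y. Expanding both sides to third
    order and replacing t^2 by the square of the Gibbs mean avoids differentiating [lse]. The
    constant is 1 + 1 + 4 / 2: one remainder on each side, and half the error in t^2. *)
Lemma lse_expansion x y (m : R) : (forall s, `|y s| <= m) ->
  `|lse (fun s => x s + y s) -
    (lse x + gmean x y + (gmean x (fun s => y s ^+ 2) - gmean x y ^+ 2) / 2)|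
  <= 4 * (m ^+ 3 * expR m).
Proof.
move=> ym; have m0 : 0 <= m by apply: le_trans (ym s0).
set t := lse (fun s => x s + y s) - lse x.
have tm : `|t| <= m.
  by apply: (lse_lipschitz s0) => s; rewrite [_ + y s]addrC addrK.
set p1 := gmean x y; set p2 := gmean x _.
have p1m : `|p1| <= m by exact: gmean_bound.
have et : expR t = gmean x (fun s => expR (y s)).
  rewrite /t expRB (expR_lse s0) (expR_lse s0) mulr_suml; apply: eq_bigr => s _.
  by rewrite /gibbs -(expR_lse s0) -expRB -expRD; congr expR; ring.
have powm (u : R) (n : nat) : `|u| <= m -> `|u| ^+ n * expR `|u| <= m ^+ n * expR m.
  by move=> um; rewrite ler_pM ?exprn_ge0 ?expR_ge0 ?ler_expR// lerXn2r ?nnegrE.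
set e := expR m; have e0 : 0 <= e by exact: expR_ge0.
have t2 : `|expR t - 1 - t| <= m ^+ 2 * e by rewrite (le_trans (expR_taylor2 t))// powm.
have t3 : `|expR t - 1 - t - t ^+ 2 / 2| <= m ^+ 3 * e.
  by rewrite (le_trans (expR_taylor3 t))// powm.
have y2 : `|expR t - 1 - p1| <= m ^+ 2 * e.
  have <- : gmean x (fun s => expR (y s) - 1 - y s) = expR t - 1 - p1.
    by rewrite !gmeanB gmean_cst -et.
  apply: gmean_bound => s.
  by rewrite (le_trans (expR_taylor2 _))// powm.
have y3 : `|expR t - 1 - p1 - p2 / 2| <= m ^+ 3 * e.
  have <- : gmean x (fun s => expR (y s) - 1 - y s - 2^-1 * y s ^+ 2) =
      expR t - 1 - p1 - p2 / 2.
    by rewrite !gmeanB gmean_cst gmeanZ -et [p2 / 2]mulrC.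
  apply: gmean_bound => s.
  by rewrite [2^-1 * _]mulrC (le_trans (expR_taylor3 _))// powm.
have tp : `|t - p1| <= 2 * (m ^+ 2 * e).
  rewrite (_ : t - p1 = (expR t - 1 - p1) - (expR t - 1 - t)); last by ring.
  by rewrite (le_trans (ler_normB _ _))// mulr_natl mulr2n lerD.
have tp2 : `|t ^+ 2 - p1 ^+ 2| <= 4 * (m ^+ 3 * e).
  rewrite subr_sqr normrM (_ : 4 * _ = 2 * (m ^+ 2 * e) * (m + m)); last by ring.
  by rewrite ler_pM// (le_trans (ler_normD _ _))// lerD.
rewrite (_ : _ - _ = (expR t - 1 - p1 - p2 / 2) - (expR t - 1 - t - t ^+ 2 / 2)
   - (t ^+ 2 - p1 ^+ 2) / 2); last by rewrite /t; field.
set A := expR t - 1 - p1 - p2 / 2 in y3 *.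
set B := expR t - 1 - t - t ^+ 2 / 2 in t3 *.
set C := t ^+ 2 - p1 ^+ 2 in tp2 *.
have C2 : `|C / 2| = `|C| / 2 by rewrite normrM [X in _ * X]ger0_norm.
have := ler_normB (A - B) (C / 2); have := ler_normB A B; rewrite C2.
lra.
Qed.

Definition gibbs_cst : R := 2 * expR 2.

Lemma gibbs_cst_ge2 : 2 <= gibbs_cst.
Proof. by rewrite /gibbs_cst ler_peMr// -expR0 ler_expR. Qed.

(** Each Gibbs weight changes by a factor exp u with |u| <= 2 e. For e <= 1 the bound |u| exp |u|
    gives [gibbs_cst] = 2 exp 2; for larger e the trivial bound 2 c is enough. *)
Lemma gmean_lipschitz x y b (c e : R) : 0 <= e -> (forall s, `|x s - y s| <= e) ->
  (forall s, `|b s| <= c) -> `|gmean x b - gmean y b| <= gibbs_cst * c * e.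
Proof.
move=> e0 xy bc; have c0 : 0 <= c by apply: le_trans (bc s0).
have k2 := gibbs_cst_ge2.
have [e1|e1] := leP e 1; last first.
  rewrite (le_trans (ler_normB _ _))//.
  apply: (@le_trans _ _ (c + c)); first by rewrite lerD// gmean_bound.
  apply: (@le_trans _ _ (2 * c * 1)); first lra.
  by apply: ler_pM => //; [exact: mulr_ge0|exact: ler_wpM2r|exact: ltW].
rewrite /gmean -sumrB (le_trans (ler_norm_sum _ _ _))//.
rewrite -[leRHS]mul1r -{1}(sum_gibbs y) mulr_suml ler_sum// => s _.
rewrite -mulrBl normrM.
have -> : gibbs x s - gibbs y s =
    gibbs y s * (expR ((x s - lse x) - (y s - lse y)) - 1).
  by rewrite mulrBr mulr1 /gibbs -expRD; congr (expR _ - _); ring.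
set u := x s - lse x - (y s - lse y).
have u2e : `|u| <= 2 * e.
  rewrite (_ : u = (x s - y s) - (lse x - lse y)); last by rewrite /u; ring.
  by rewrite (le_trans (ler_normB _ _))// mulr_natl mulr2n lerD//; exact: lse_lipschitz.
rewrite normrM ger0_norm ?gibbs_ge0// -mulrA ler_wpM2l ?gibbs_ge0//.
rewrite mulrAC; apply: ler_pM => //.
rewrite (le_trans (expR_taylor1 u))// /gibbs_cst mulrAC; apply: ler_pM => //.
by rewrite ler_expR; lra.
Qed.

Lemma measurable_gmean d (U : measurableType d) (X : S -> U -> R) b :
  (forall s, measurable_fun setT (X s)) ->
  measurable_fun setT (fun u => gmean (fun s => X s u) b).
Proof.
move=> mX; apply: measurable_sum => s; apply: measurable_funM => //.
apply: measurableT_comp => //; apply: measurable_funB => //.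
exact: measurable_lse.
Qed.

Lemma admissible_gvar a (c : R) : 0 <= c -> dir_bound c a ->
  admissible (3 * gibbs_cst * c ^+ 2) (gvar a).
Proof.
move=> c0 ac; have k2 := gibbs_cst_ge2.
have k0 : 0 <= gibbs_cst by rewrite (le_trans _ k2).
split; first by rewrite !mulr_ge0 ?exprn_ge0.
  move=> x y e e0 xy.
  have a2 s : `|a s ^+ 2| <= c ^+ 2 by rewrite normrX lerXn2r ?nnegrE.
  have h2 := gmean_lipschitz e0 xy a2.
  have h1 := gmean_lipschitz e0 xy ac.
  have sqrB (p q u v : R) : p - u ^+ 2 - (q - v ^+ 2) = (p - q) - (u - v) * (u + v).
    by ring.
  rewrite /gvar sqrB.
  rewrite (le_trans (ler_normB _ _))// normrM.
  apply: (@le_trans _ _ (gibbs_cst * c ^+ 2 * e + gibbs_cst * c * e * (c + c))).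
    apply: lerD => //; apply: ler_pM => //.
    by rewrite (le_trans (ler_normD _ _))// lerD// gmean_bound.
  lra.
move=> d U X mX; apply: measurable_funB; first exact: measurable_gmean.
by apply: measurable_funX; exact: measurable_gmean.
Qed.

(** The total Gibbs variance depends on the directions only through their covariances: with equal
    diagonals, smaller covariances give a larger total variance. *)
Lemma sum_gvar (l : seq (S -> R)) x :
  \sum_(a <- l) gvar a x = \sum_s gibbs x s * (\sum_(a <- l) a s ^+ 2) -
    \sum_s \sum_t gibbs x s * gibbs x t * (\sum_(a <- l) a s * a t).
Proof.
rewrite /gvar sumrB; congr (_ - _).
  by rewrite exchange_big /=; apply: eq_bigr => s _; rewrite mulr_sumr.
rewrite (eq_bigr (fun a => \sum_s \sum_t gibbs x s * gibbs x t * (a s * a t))); last first.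
  move=> a _; rewrite expr2 mulr_suml; apply: eq_bigr => s _.
  by rewrite mulr_sumr; apply: eq_bigr => t _; ring.
rewrite exchange_big /=; apply: eq_bigr => s _.
by rewrite exchange_big /=; apply: eq_bigr => t _; rewrite mulr_sumr.
Qed.

End gibbs.

Section admissible_closure.
Context {R : realType} {S : finType}.
Implicit Types (f : (S -> R) -> R) (a x : S -> R).

Lemma admissibleD (L1 L2 : R) f1 f2 : admissible L1 f1 -> admissible L2 f2 ->
  admissible (L1 + L2) (fun x => f1 x + f2 x).
Proof.
move=> [L10 fL1 fm1] [L20 fL2 fm2]; split; first exact: addr_ge0.
  move=> x y e e0 xy; rewrite opprD addrACA (le_trans (ler_normD _ _))// mulrDl.
  by rewrite lerD ?fL1 ?fL2.
by move=> d U X mX; apply: measurable_funD; [exact: fm1|exact: fm2].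
Qed.

Lemma admissibleZ (L k : R) f : admissible L f ->
  admissible (`|k| * L) (fun x => k * f x).
Proof.
move=> [L0 fL fm]; split; first exact: mulr_ge0.
  by move=> x y e e0 xy; rewrite -mulrBr normrM -mulrA ler_wpM2l ?fL.
by move=> d U X mX; apply: measurable_funM => //; exact: fm.
Qed.

Lemma admissible_cst (k : R) : admissible 0 (fun _ : S -> R => k).
Proof.
by split => // x y e _ _; rewrite subrr normr0 mul0r.
Qed.

Variable nu : probability R R.
Hypothesis nuexp : exp_moments nu.

Lemma avgD (L1 L2 : R) a f1 f2 x : admissible L1 f1 -> admissible L2 f2 ->
  avg nu a (fun y => f1 y + f2 y) x = avg nu a f1 x + avg nu a f2 x.
Proof.
move=> f1L f2L; rewrite /avg RintegralD//; [exact: admissible_integrable f1L|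
  exact: admissible_integrable f2L].
Qed.

Lemma avgZ (L k : R) a f x : admissible L f ->
  avg nu a (fun y => k * f y) x = k * avg nu a f x.
Proof. by move=> fL; rewrite /avg RintegralZl//; exact: admissible_integrable fL. Qed.

Lemma avg_cst (k : R) a x : avg nu a (fun=> k) x = k.
Proof. exact: Rintegral_probability_cst. Qed.

End admissible_closure.

Section gaussian_comparison.
Context {R : realType} {S : finType} (s0 : S).
Implicit Types (a b x y : S -> R) (l : seq (S -> R)).
Local Notation gam := (normal_law (0 : R) 1).
Local Notation gexp := (@normal_law01_exp_moments R).

(** Kept symbolic: the same factor multiplies the Gibbs variances on both sides of the comparison,
    where its sign is what matters. *)
Definition second_moment : R := \int[gam]_z (z ^+ 2).
Definition third_moment : R := \int[gam]_z (`|z| ^+ 3 * expR `|z|).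

Lemma integrable_second_moment :
  gam.-integrable setT (EFin \o (fun z : R => z ^+ 2)).
Proof.
apply: (@exp_moments_dominated _ gam gexp _ 4 1); first exact: measurable_funX.
by move=> z; rewrite mul1r normrX sqr_le_expR.
Qed.

Lemma integrable_third_moment :
  gam.-integrable setT (EFin \o (fun z : R => `|z| ^+ 3 * expR `|z|)).
Proof.
apply: (@exp_moments_dominated _ gam gexp _ 4 3).
  have mz : measurable_fun setT (fun z : R => `|z|) by exact: measurableT_comp.
  by apply: measurable_funM; [exact: measurable_funX|exact: measurableT_comp].
move=> z; rewrite ger0_norm; last by rewrite mulr_ge0 ?exprn_ge0 ?expR_ge0.
have z1 : `|z| <= expR `|z| by rewrite (le_trans _ (expR_ge1Dx _))// lerDr.
have e0 := expR_ge0 `|z|.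
apply: (@le_trans _ _ (4 * expR `|z| * expR `|z| * expR `|z|)).
  rewrite ler_wpM2r// exprSr; apply: ler_pM => //.
  exact: sqr_le_expR.
by rewrite -!mulrA ler_wpM2l// -!expRD ler_expR; lra.
Qed.

Lemma second_moment_ge0 : 0 <= second_moment.
Proof. by apply: Rintegral_ge0 => z _; exact: sqr_ge0. Qed.

Lemma third_moment_ge0 : 0 <= third_moment.
Proof. by apply: Rintegral_ge0 => z _; rewrite mulr_ge0 ?exprn_ge0 ?expR_ge0. Qed.

(** The first-order term vanishes because the normal law is centered. With c <= 1 the remainder is
    controlled by [third_moment], independently of the exponent |z| c. *)
Lemma avg_lse_expansion a x (c : R) : 0 <= c -> c <= 1 -> dir_bound c a ->
  `|avg gam a (@lse R S) x - (lse x + second_moment / 2 * gvar a x)| <=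
  4 * third_moment * c ^+ 3.
Proof.
move=> c0 c1 ac.
pose g1 := gmean x a; pose q := gvar a x / 2.
have intz : gam.-integrable setT (EFin \o (fun z : R => z)).
  by apply: (@lipschitzR_integrable _ gam gexp 1) => u v; rewrite mul1r.
have i1 : gam.-integrable setT (EFin \o (fun z : R => g1 * z + q * z ^+ 2)).
  by apply: integrable_realD; apply: integrable_realZ => //; exact: integrable_second_moment.
rewrite [X in `|_ - X|](_ : _ = \int[gam]_z (lse x + (g1 * z + q * z ^+ 2))); last first.
  rewrite RintegralD//; last exact: integrable_cst.
  rewrite Rintegral_probability_cst RintegralD//; last 2 first.
  - exact: integrable_realZ.
  - by apply: integrable_realZ; exact: integrable_second_moment.
  rewrite RintegralZl// Rintegral_normal_id mulr0 add0r RintegralZl//.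
    by rewrite /q -/second_moment; congr (_ + _); rewrite mulrC mulrA mulrAC.
  exact: integrable_second_moment.
rewrite [leRHS](_ : _ =
    \int[gam]_z (4 * c ^+ 3 * (`|z| ^+ 3 * expR `|z|))); last first.
  by rewrite RintegralZl//; [rewrite mulrAC|exact: integrable_third_moment].
apply: Rintegral_dist_le.
- exact: (admissible_integrable a x gexp (admissible_lse s0)).
- by apply: integrable_realD => //; exact: integrable_cst.
- by apply: integrable_realZ; exact: integrable_third_moment.
move=> z.
have za s : `|z * a s| <= `|z| * c by rewrite normrM ler_wpM2l.
have := lse_expansion s0 x za.
rewrite gmeanZ [gmean x (fun s => (z * a s) ^+ 2)](_ : _ =
    z ^+ 2 * gmean x (fun s => a s ^+ 2)); last first.
  by rewrite -gmeanZ; congr gmean; apply/funext => s; rewrite exprMn.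
rewrite (_ : lse x + _ + _ = lse x + (g1 * z + q * z ^+ 2)); last first.
  by rewrite /g1 /q /gvar; field.
move=> /le_trans; apply.
rewrite [leLHS](_ : _ = 4 * c ^+ 3 * (`|z| ^+ 3 * expR (`|z| * c))); last by ring.
apply: ler_wpM2l; first by rewrite mulr_ge0 ?exprn_ge0.
by apply: ler_wpM2l; rewrite ?exprn_ge0// ler_expR ler_piMr.
Qed.

(** A Gibbs variance has Lipschitz constant of order c^2, and the average along [a] displaces its
    argument by order c. The drift is therefore of the same order c^3 as the Taylor remainder. *)
Lemma avg_sum_gvar l a (c : R) : 0 <= c -> dir_bound c a ->
  (forall i, (i < size l)%N -> dir_bound c (nth (fun=> 0) l i)) ->
  exists2 L : R, admissible L (fun x => \sum_(b <- l) gvar b x) &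
  forall x, `|avg gam a (fun x => \sum_(b <- l) gvar b x) x -
      \sum_(b <- l) gvar b x| <=
    (size l)%:R * (3 * @gibbs_cst R * abs_mean gam * c ^+ 3).
Proof.
move=> c0 ac; elim: l => [_|b l IH lc].
  have E : (fun x => \sum_(b <- [::]) gvar b x) = (fun _ : S -> R => 0).
    by apply/funext => x; rewrite big_nil.
  exists 0; first by rewrite E; exact: admissible_cst.
  by move=> x; rewrite E avg_cst big_nil subrr normr0 mul0r.
have [L LA Lb] := IH (fun i => lc i.+1).
have bc : dir_bound c b := lc 0%N isT.
have bA := admissible_gvar s0 c0 bc.
have E : (fun x => \sum_(d <- b :: l) gvar d x) =
    (fun x => gvar b x + \sum_(d <- l) gvar d x).
  by apply/funext => x; rewrite big_cons.
exists (3 * @gibbs_cst R * c ^+ 2 + L); first by rewrite E; exact: admissibleD.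
move=> x; rewrite E big_cons (avgD gexp a x bA LA) opprD addrACA.
rewrite (le_trans (ler_normD _ _))// [size _]/= -natr1 mulrDl mul1r.
rewrite [leLHS]addrC; apply: lerD; first exact: Lb.
apply: le_trans (avg_dist_id gexp x bA c0 ac) _.
by rewrite -/(abs_mean gam) le_eqVlt; apply/orP; left; apply/eqP; ring.
Qed.

(** [B] depends on the number of directions only, not on their size [c] nor on [x]; it thus stays
    the same when the directions are rescaled. *)
Lemma avgs_lse_expansion (n : nat) : exists2 B : R, 0 <= B &
  forall l, size l = n -> forall c : R, 0 <= c -> c <= 1 ->
  (forall i, (i < n)%N -> dir_bound c (nth (fun=> 0) l i)) -> forall x,
  `|avgs gam l (@lse R S) x -
    (lse x + second_moment / 2 * \sum_(a <- l) gvar a x)| <= B * c ^+ 3.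
Proof.
have v0 := second_moment_ge0; have w0 := third_moment_ge0.
have k0 : 0 <= @gibbs_cst R by rewrite (le_trans _ gibbs_cst_ge2).
have m0 : 0 <= abs_mean gam by exact: abs_mean_ge0.
elim: n => [|n [B B0 IH]].
  exists 0 => // l /size0nil -> c _ _ _ x /=.
  by rewrite big_nil mulr0 addr0 subrr normr0 mul0r.
(* Accounts for the drift of the [n] inner variances under the new outermost average. *)
pose D := second_moment / 2 * n%:R * (3 * @gibbs_cst R * abs_mean gam).
have D0 : 0 <= D by rewrite !mulr_ge0 ?ler0n.
exists (B + 4 * third_moment + D); first by rewrite !addr_ge0 ?mulr_ge0.
case=> // a l [ln] c c0 c1 acl x /=.
have ac : dir_bound c a := acl 0%N isT.
have lc i : (i < n)%N -> dir_bound c (nth (fun=> 0) l i) := acl i.+1.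
pose Q y := \sum_(b <- l) gvar b y.
have [L QA Qb] : exists2 L, admissible L Q & forall x, `|avg gam a Q x - Q x| <=
    n%:R * (3 * @gibbs_cst R * abs_mean gam * c ^+ 3).
  by rewrite -ln; apply: avg_sum_gvar => //; rewrite ln.
have lseA := @admissible_lse R S s0.
have vQA := admissibleZ (second_moment / 2) QA.
have H1 := avg_dist_le gexp a x (admissible_avgs gexp l lseA) (admissibleD lseA vQA)
  (IH l ln c c0 c1 lc).
rewrite (avgD gexp a x lseA vQA) (avgZ gexp _ a x QA) in H1.
have H2 := avg_lse_expansion x c0 c1 ac.
have H3 := Qb x.
rewrite big_cons -/(Q x).
set A := avg gam a (avgs gam l _) x in H1 *.
set A1 := avg gam a _ x in H1 H2 *; set A2 := avg gam a Q x in H1 H3 *.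
rewrite (_ : A - _ = (A - (A1 + second_moment / 2 * A2)) +
  (A1 - (lse x + second_moment / 2 * gvar a x)) +
  second_moment / 2 * (A2 - Q x)); last by ring.
rewrite (le_trans (ler_normD _ _))// 2!mulrDl lerD//.
  by rewrite (le_trans (ler_normD _ _))// lerD.
rewrite normrM ger0_norm ?divr_ge0//.
apply: le_trans (ler_wpM2l _ H3) _; first by rewrite divr_ge0.
by rewrite /D le_eqVlt; apply/orP; left; apply/eqP; ring.
Qed.

Lemma sum_gvar_scale l x (r : R) :
  \sum_(a <- scale_dirs r l) gvar a x = r ^+ 2 * \sum_(a <- l) gvar a x.
Proof. by rewrite big_map mulr_sumr; apply: eq_bigr => a _; exact: gvarZ. Qed.

(* Lindeberg's argument: splitting every standard normal into [2 ^ j] independent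
   copies scaled by [2 ^- (j / 2)], the lists are exchanged one block at a time. The
   second-order terms compare since the Gibbs variances do, and the third-order
   errors add up to [O(2 ^ j * 2 ^- (3 * j / 2))]. *)
Lemma gaussian_comparison lX lY x :
  (forall s, \sum_(a <- lX) a s ^+ 2 = \sum_(a <- lY) a s ^+ 2) ->
  (forall s t, \sum_(a <- lX) a s * a t <= \sum_(a <- lY) a s * a t) ->
  avgs gam lY (@lse R S) x <= avgs gam lX (@lse R S) x.
Proof.
move=> diag cov.
have QXY y : \sum_(a <- lY) gvar a y <= \sum_(a <- lX) gvar a y.
  rewrite !sum_gvar; under [X in _ <= X - _]eq_bigr do rewrite diag.
  rewrite lerB// ler_sum// => s _; rewrite ler_sum// => t _.
  by rewrite ler_wpM2l ?mulr_ge0 ?gibbs_ge0.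
pose c : R := \sum_(a <- lX) sup_norm a + \sum_(a <- lY) sup_norm a.
have bnd l : (\sum_(a <- l) sup_norm a <= c) -> forall i, (i < size l)%N ->
    dir_bound c (nth (fun=> 0) l i).
  move=> lc i il s; apply: le_trans (sup_norm_bound _ s) _; apply: le_trans lc.
  rewrite (big_nth (fun=> 0)) big_mkord (bigD1 (Ordinal il))//= lerDl.
  by apply: sumr_ge0 => j _; exact: sup_norm_ge0.
have s0X : 0 <= \sum_(a <- lX) sup_norm a by apply: sumr_ge0 => a _; exact: sup_norm_ge0.
have s0Y : 0 <= \sum_(a <- lY) sup_norm a by apply: sumr_ge0 => a _; exact: sup_norm_ge0.
have cX := bnd lX; rewrite lerDl s0Y in cX; move: cX => /(_ isT) cX.
have cY := bnd lY; rewrite lerDr s0X in cY; move: cY => /(_ isT) cY.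
have c0 : 0 <= c by rewrite addr_ge0.
have [BX BX0 HX] := avgs_lse_expansion (size lX).
have [BY BY0 HY] := avgs_lse_expansion (size lY).
have v0 := second_moment_ge0.
have lseA := @admissible_lse R S s0.
pose r j : R := (Num.sqrt 2)^-1 ^+ j.
have r0 j : 0 < r j by rewrite exprn_gt0// invr_gt0 sqrtr_gt0.
have r2 j : (2 ^ j)%:R * r j ^+ 2 = 1.
  rewrite /r -exprM mulnC exprM exprVn sqr_sqrtr// natrX -exprMn divff//.
  by rewrite expr1n.
have key j : r j * c <= 1 ->
    avgs gam lY (@lse R S) x <= avgs gam lX (@lse R S) x + (BX + BY) * c ^+ 3 * r j.
  move=> rc1; have rj0 := ltW (r0 j).
  have rc0 : 0 <= r j * c by rewrite mulr_ge0.
  have sc l : (forall i, (i < size l)%N -> dir_bound c (nth (fun=> 0) l i)) ->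
      forall i, (i < size l)%N -> dir_bound (r j * c) (nth (fun=> 0) (scale_dirs (r j) l) i).
    move=> lc i il s; rewrite (nth_map (fun=> 0))// normrM ger0_norm//.
    by rewrite ler_wpM2l// lc.
  have step y : avgs gam (scale_dirs (r j) lY) (@lse R S) y <=
      avgs gam (scale_dirs (r j) lX) (@lse R S) y + (BX + BY) * (r j * c) ^+ 3.
    have := HX _ (size_map _ _) _ rc0 rc1 (sc _ cX) y.
    have := HY _ (size_map _ _) _ rc0 rc1 (sc _ cY) y.
    rewrite !sum_gvar_scale !ler_norml => /andP[_ h1] /andP[h2 _].
    have h3 : second_moment / 2 * (r j ^+ 2 * \sum_(a <- lY) gvar a y) <=
        second_moment / 2 * (r j ^+ 2 * \sum_(a <- lX) gvar a y).
      by rewrite ler_wpM2l ?divr_ge0// ler_wpM2l ?exprn_ge0.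
    lra.
  have := @iter_avgs_telescope _ _ gam 1 _ _ gexp (2 ^ j) _ _ lseA step x.
  rewrite !(avgs_normal_dyadic _ _ lseA) => /le_trans; apply; rewrite lerD2l.
  rewrite [leLHS](_ : _ = (BX + BY) * c ^+ 3 * ((2 ^ j)%:R * r j ^+ 2) * r j); last by ring.
  by rewrite r2 mulr1.
apply/ler_addgt0Pr => e e0.
have rcvg : r j @[j --> \oo] --> 0.
  apply: cvg_expr; rewrite ger0_norm ?invr_ge0 ?sqrtr_ge0// invf_lt1 ?sqrtr_gt0//.
  by rewrite -[ltLHS]sqrtr1 ltr_sqrt// ltr1n.
pose K := (BX + BY) * c ^+ 3; have K0 : 0 <= K by rewrite mulr_ge0 ?addr_ge0 ?exprn_ge0.
pose d := Num.min (e / (K + 1)) (1 / (c + 1)).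
have K1 : 0 < K + 1 by rewrite ltr_wpDl.
have c1 : 0 < c + 1 by rewrite ltr_wpDl.
have d0 : 0 < d by rewrite lt_min !divr_gt0.
have [j _ /(_ j (leqnn _))] : \forall j \near \oo, r j <= d.
  near=> j; have : `|0 - r j| <= d by near: j; apply: cvgr_dist_le.
  by rewrite sub0r normrN ger0_norm// ltW.
rewrite /= le_min => /andP[rK rc].
apply: le_trans (key j _) _.
  rewrite ler_pdivlMr// mulrDr mulr1 in rc; apply: le_trans rc.
  by rewrite lerDl ltW.
rewrite lerD2l -/K; rewrite ler_pdivlMr// mulrDr mulr1 in rK.
by apply: le_trans rK; rewrite mulrC lerDl ltW.
Unshelve. all: by end_near. Qed.

End gaussian_comparison.

(** * Factorization over two systems without interaction *)

Section factorization.
Context {R : realType} {S S1 S2 : finType}.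
Variables (pi1 : S -> S1) (pi2 : S -> S2) (glue : S1 * S2 -> S).
Hypothesis pi1_glue : forall p, pi1 (glue p) = p.1.
Hypothesis pi2_glue : forall p, pi2 (glue p) = p.2.
Hypothesis glue_pi : forall s, glue (pi1 s, pi2 s) = s.

(** Additivity of [F] when the energy is a sum over the two parts. For [lse] this is the
    factorization of the partition function; averaging along a direction that depends on one part
    preserves it. *)
Definition splits (F : (S -> R) -> R) (F1 : (S1 -> R) -> R)
    (F2 : (S2 -> R) -> R) : Prop :=
  forall x1 x2, F (fun s => x1 (pi1 s) + x2 (pi2 s)) = F1 x1 + F2 x2.

Lemma splits_lse (s1 : S1) (s2 : S2) : splits (@lse R S) (@lse R S1) (@lse R S2).
Proof.
move=> x1 x2; apply: expR_inj; rewrite expRD.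
rewrite (expR_lse (glue (s1, s2))) (expR_lse s1) (expR_lse s2).
rewrite big_distrlr /= pair_big (reindex glue) /=; last first.
  exists (fun s => (pi1 s, pi2 s)) => // -[t1 t2] _.
  by rewrite pi1_glue pi2_glue.
by apply: eq_bigr => p _; rewrite pi1_glue pi2_glue expRD.
Qed.

Section with_law.
Variable nu : probability R R.
Hypothesis nuexp : exp_moments nu.

Lemma splits_avgs1 (L : R) (l : seq (S1 -> R)) F F1 F2 :
  admissible L F1 -> splits F F1 F2 ->
  splits (avgs nu [seq a \o pi1 | a <- l] F) (avgs nu l F1) F2.
Proof.
move=> F1L FF; elim: l => [|a l IH] //= x1 x2.
have AL := admissible_avgs nuexp l F1L.
rewrite -(Rintegral_probability_cst nu (F2 x2)) -RintegralD//; last 2 first.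
- exact: (admissible_integrable a x1 nuexp AL).
- exact: integrable_cst.
apply: eq_Rintegral => z _; rewrite -IH; congr (avgs _ _ _ _).
by apply/funext => s; rewrite /shift /= addrAC.
Qed.

Lemma splits_avgs2 (L : R) (l : seq (S2 -> R)) F F1 F2 :
  admissible L F2 -> splits F F1 F2 ->
  splits (avgs nu [seq a \o pi2 | a <- l] F) F1 (avgs nu l F2).
Proof.
move=> F2L FF; elim: l => [|a l IH] //= x1 x2.
have AL := admissible_avgs nuexp l F2L.
rewrite -(Rintegral_probability_cst nu (F1 x1)) -RintegralD//; last 2 first.
- exact: integrable_cst.
- exact: (admissible_integrable a x2 nuexp AL).
apply: eq_Rintegral => z _; rewrite -IH; congr (avgs _ _ _ _).
by apply/funext => s; rewrite /shift /= addrA.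
Qed.

End with_law.
End factorization.

(** * Superadditive sequences *)

Section fekete.
Context {R : realType}.

Lemma fekete (a : nat -> R) (C : R) :
  (forall m n, (0 < m)%N -> (0 < n)%N -> a m + a n <= a (m + n)%N) ->
  (forall n, (0 < n)%N -> a n <= C * n%:R) ->
  cvgn (fun n => n%:R^-1 * a n).
Proof.
move=> sup_add aC.
pose E : set R := [set u | exists2 n, (0 < n)%N & u = n%:R^-1 * a n].
have E0 : E !=set0 by exists (1%:R^-1 * a 1%N), 1%N.
have EC : has_ubound E.
  exists C => _ [n n0 ->]; rewrite mulrC ler_pdivrMr ?ltr0n//.
  exact: aC.
have mul_add k q : (0 < k)%N -> q.+1%:R * a k <= a (q.+1 * k)%N.
  move=> k0; elim: q => [|q IH]; first by rewrite mul1r mul1n.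
  rewrite mulSn -natr1 mulrDl mul1r addrC.
  apply: le_trans (sup_add _ _ k0 _); last by rewrite muln_gt0.
  by rewrite lerD2l.
apply/cvg_ex; exists (sup E); apply/cvgrPdist_le => e e0.
have e20 : 0 < e / 2 by rewrite divr_gt0.
have [_ [k k0 ->] ke] := sup_adherent e20 (conj E0 EC).
(* Bounds everything lost when n is divided by k: the value at the remainder r, and less than one
   block of value [a k]. *)
pose D := \sum_(r < k) `|a r| + `|a k|.
have D0 : 0 <= D by rewrite addr_ge0// sumr_ge0.
have Dr r : (r < k)%N -> - a r <= D - `|a k|.
  move=> rk; rewrite /D addrK (bigD1 (Ordinal rk))//=.
  rewrite (le_trans (ler_norm _))// normrN lerDl.
  by rewrite sumr_ge0.
near=> n.
have n0 : (0 < n)%N by near: n; exists 1%N.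
have nD : 2 * D / e <= n%:R by near: n; exact: nbhs_infty_ger.
have kn : (k <= n)%N by near: n; exists k.
have n0' : (0 : R) < n%:R by rewrite ltr0n.
have k0' : (0 : R) < k%:R by rewrite ltr0n.
have up : n%:R^-1 * a n <= sup E by apply: sup_upper_bound; [split|exists n].
rewrite ger0_norm ?subr_ge0// lerBlDr -lerBlDl.
suff : k%:R^-1 * a k - D / n%:R <= n%:R^-1 * a n.
  have : D / n%:R <= e / 2.
    by rewrite ler_pdivrMr// -ler_pdivrMl// (le_trans _ nD)// invf_div mulrAC.
  by lra.
rewrite [n%:R^-1 * _]mulrC ler_pdivlMr// mulrBl divfK ?gt_eqF//.
have [q [r [rk nE]]] : exists q r, (r < k)%N /\ n = (q.+1 * k + r)%N.
  exists (n %/ k).-1, (n %% k)%N; split; first by rewrite ltn_mod.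
  by rewrite prednK ?divn_gt0// -divn_eq.
have an : q.+1%:R * a k - (D - `|a k|) <= a n.
  have := mul_add k q k0.
  (* A zero remainder is treated apart, since superadditivity is assumed for positive arguments and
     says nothing of [a 0]. *)
  case: r rk nE => [|r] rk nE.
    rewrite nE addn0 => h; apply: le_trans h; rewrite gerBl /D addrK.
    by apply: sumr_ge0.
  move=> h; rewrite nE; have := sup_add (q.+1 * k)%N r.+1; rewrite muln_gt0 k0 => /(_ isT isT).
  have := Dr _ rk; lra.
have : k%:R^-1 * a k * n%:R <= q.+1%:R * a k + `|a k|.
  rewrite nE natrD natrM mulrDr; apply: lerD.
    by rewrite le_eqVlt; apply/orP; left; apply/eqP; field; rewrite gt_eqF.
  rewrite mulrC mulrA; apply: le_trans (ler_norm _) _.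
  rewrite normrM ler_piMl// ger0_norm ?divr_ge0// ler_pdivrMr// mul1r ler_nat.
  exact: ltnW.
lra.
Unshelve. all: by end_near. Qed.
End fekete.

(** * The model with finitely many interaction orders *)

Section directions.
Context {R : realType}.
Variable beta_ : nat -> R.

Definition coupling_coef (N p : nat) : R := beta_ p / N%:R `^ (p%:R - 2^-1).

Definition spin_prod N (i : seq 'I_N) (sigma : config N) : R :=
  \prod_(k <- i) spin sigma k.

(** The order p is recovered from the length 2 p of [i], so that directions of all orders form lists
    of a single type. *)
Definition coupling_dir N (i : seq 'I_N) (sigma : config N) : R :=
  coupling_coef N (size i)./2 * spin_prod i sigma.

Lemma coupling_dir_tuple N p (i : (2 * p).-tuple 'I_N) sigma :
  coupling_dir i sigma = coupling_coef N p * spin_prod i sigma.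
Proof.
rewrite /coupling_dir (_ : (size i)./2 = p)//.
by rewrite size_tuple mul2n doubleK.
Qed.

Definition coupling_dirs N (p : nat) : seq (config N -> R) :=
  [seq coupling_dir (tval i) | i <- enum {: (2 * p).-tuple 'I_N}].

Definition sk_dirs N (M : nat) : seq (config N -> R) :=
  flatten [seq coupling_dirs N p | p <- index_iota 1 M.+1].

Definition field_dirs N : seq (config N -> R) :=
  [seq (fun sigma : config N => spin sigma i) | i <- enum 'I_N].

Lemma spin_sqr N (sigma : config N) i : spin sigma i ^+ 2 = 1 :> R.
Proof. by rewrite /spin; case: ifP; rewrite ?sqrrN expr1n. Qed.

Lemma normr_spin N (sigma : config N) i : `|spin sigma i| = 1 :> R.
Proof. by rewrite /spin; case: ifP; rewrite ?normrN normr1. Qed.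

Lemma normr_spin_prod N i (sigma : config N) : `|spin_prod i sigma| = 1.
Proof. by rewrite normr_prod big1// => k _; exact: normr_spin. Qed.

Lemma coupling_coef_sqr N p : (0 < N)%N -> (0 < p)%N ->
  coupling_coef N p ^+ 2 = beta_ p ^+ 2 / N%:R ^+ (2 * p).-1.
Proof.
move=> N0 p0; rewrite /coupling_coef exprMn exprVn; congr (_ / _).
rewrite -powR_mulrn ?powR_ge0// -powRrM -powR_mulrn//; congr (_ `^ _).
rewrite mulrBl mulVf// -natrM mulnC.
by rewrite -[in LHS](prednK (_ : 0 < 2 * p)%N) ?muln_gt0//  -natr1 addrK.
Qed.

Lemma coupling_coef_le N p : (0 < N)%N -> (0 < p)%N ->
  `|coupling_coef N p| <= `|beta_ p|.
Proof.
move=> N0 p0; rewrite /coupling_coef normrM normfV ler_piMr// invf_le1.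
  rewrite ger0_norm ?powR_ge0// -[leLHS](powRr0 N%:R) ler_powR ?ler1n//.
  by rewrite subr_ge0 (@le_trans _ _ 1)// ?ler1n// invf_le1// ler1n.
by rewrite normr_gt0 gt_eqF// powR_gt0// ltr0n.
Qed.

Lemma sum_tuple_prod (I : finType) (f : I -> R) n :
  \sum_(i : n.-tuple I) \prod_(k <- i) f k = (\sum_k f k) ^+ n.
Proof.
transitivity (\prod_(j < n) \sum_k f k); last by rewrite prodr_const card_ord.
rewrite bigA_distr_bigA /= (reindex (fun t : n.-tuple I => finfun (tnth t))) /=.
  by apply: eq_bigr => t _; rewrite big_tuple; apply: eq_bigr => j _; rewrite ffunE.
exists (fun F : {ffun 'I_n -> I} => [tuple F j | j < n]) => [t _|F _].
  by apply: eq_from_tnth => j; rewrite tnth_mktuple ffunE.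
by apply/ffunP => j; rewrite ffunE tnth_mktuple.
Qed.

Definition overlap_sum N (sigma tau : config N) : R :=
  \sum_(i < N) spin sigma i * spin tau i.

Lemma overlap_sum_diag N (sigma : config N) : overlap_sum sigma sigma = N%:R.
Proof.
rewrite /overlap_sum; under eq_bigr do rewrite -expr2 spin_sqr.
by rewrite sumr_const card_ord.
Qed.

(** Summing a product of 2 p site factors over all tuples gives a power of the sum over sites; hence
    the covariance depends on the overlap only. *)
Lemma coupling_dirs_cov N p sigma tau :
  \sum_(a <- coupling_dirs N p) a sigma * a tau =
  coupling_coef N p ^+ 2 * overlap_sum sigma tau ^+ (2 * p).
Proof.
rewrite big_map big_enum /= -sum_tuple_prod mulr_sumr; apply: eq_bigr => i _.
rewrite !coupling_dir_tuple mulrACA -expr2; congr (_ * _).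
by rewrite /spin_prod -big_split.
Qed.

(** For N > 0 and p > 0 this is N beta_p^2 (u / N)^(2 p), where u / N is the overlap of two
    configurations. *)
Definition cov_term (p N : nat) (u : R) : R :=
  beta_ p ^+ 2 * (u ^+ (2 * p) / N%:R ^+ (2 * p).-1).

Lemma sk_dirs_cov N M sigma tau : (0 < N)%N ->
  \sum_(a <- sk_dirs N M) a sigma * a tau =
  \sum_(1 <= p < M.+1) cov_term p N (overlap_sum sigma tau).
Proof.
move=> N0; rewrite big_flatten big_map; apply: eq_big_nat => p /andP[p0 _].
by rewrite coupling_dirs_cov coupling_coef_sqr// /cov_term mulrAC mulrA.
Qed.

Lemma coupling_dirs_norm N p : (0 < N)%N -> (0 < p)%N ->
  all (fun a => sup_norm a <= `|beta_ p|) (coupling_dirs N p).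
Proof.
move=> N0 p0; apply/allP => a /mapP[i _ ->]; apply: sup_norm_le => // s.
rewrite coupling_dir_tuple normrM normr_spin_prod mulr1.
exact: coupling_coef_le.
Qed.

(** There are N^(2 p) directions, of squared norm at most beta_p^2 / N^(2 p - 1). This linear growth
    in N is what makes the soft maximum errors extensive. *)
Lemma coupling_dirs_norm_sum N p : (0 < N)%N -> (0 < p)%N ->
  \sum_(a <- coupling_dirs N p) sup_norm a ^+ 2 <= beta_ p ^+ 2 * N%:R.
Proof.
move=> N0 p0.
have N0' : (0 : R) < N%:R by rewrite ltr0n.
apply: (@le_trans _ _ (\sum_(a <- coupling_dirs N p) coupling_coef N p ^+ 2)).
  rewrite !big_map; apply: ler_sum => i _.
  rewrite -[leRHS]real_normK ?num_real// lerXn2r ?nnegrE ?sup_norm_ge0//.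
  apply: sup_norm_le => // s.
  by rewrite coupling_dir_tuple normrM normr_spin_prod mulr1.
rewrite big_map big_enum /= sumr_const card_tuple card_ord coupling_coef_sqr//.
rewrite -[leLHS]mulr_natr natrX -mulrA; apply: ler_wpM2l; first exact: sqr_ge0.
rewrite ler_pdivrMl ?exprn_gt0//.
by rewrite -exprSr prednK// muln_gt0.
Qed.

Lemma field_dirs_norm N : all (fun a => sup_norm a <= 1) (field_dirs N).
Proof.
apply/allP => a /mapP[i _ ->]; apply: sup_norm_le => // s.
by rewrite normr_spin.
Qed.

Lemma field_dirs_norm_sum N : \sum_(a <- field_dirs N) sup_norm a ^+ 2 <= N%:R.
Proof.
rewrite big_map big_enum /= -[N in leRHS]card_ord -sumr_const.
apply: ler_sum => i _; rewrite -[leRHS](expr1n _ 2) lerXn2r ?nnegrE ?sup_norm_ge0//.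
by apply: sup_norm_le => // s; rewrite normr_spin.
Qed.

(** Jensen's inequality for a power, by induction: one more power leaves the difference m1 m2 (a -
    b) (a^(n+1) - b^(n+1)), whose two factors have the same sign. *)
Lemma weighted_pow_convex (n : nat) (m1 m2 a b : R) :
  0 <= m1 -> 0 <= m2 -> 0 <= a -> 0 <= b ->
  (m1 * a + m2 * b) ^+ n.+1 <=
  (m1 + m2) ^+ n * (m1 * a ^+ n.+1 + m2 * b ^+ n.+1).
Proof.
move=> m10 m20 a0 b0; elim: n => [|n IH]; first by rewrite expr0 mul1r !expr1.
rewrite exprS; apply: le_trans (ler_wpM2l _ IH) _.
  by rewrite addr_ge0// mulr_ge0.
rewrite mulrCA [(m1 + m2) ^+ n.+1]exprSr -mulrA.
apply: ler_wpM2l; first by rewrite exprn_ge0 ?addr_ge0.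
rewrite -subr_ge0 [X in 0 <= X](_ : _ = m1 * m2 * ((a - b) * (a ^+ n.+1 - b ^+ n.+1))); last first.
  by rewrite !(exprSr _ n.+1); ring.
apply: mulr_ge0; first exact: mulr_ge0.
have [ab|ba] := leP a b.
  by rewrite mulr_le0 ?subr_le0// lerXn2r ?nnegrE.
by rewrite mulr_ge0 ?subr_ge0 ?lerXn2r ?nnegrE// ltW.
Qed.

(** The function m (u / m)^(n+1) is the perspective of a convex even power, hence subadditive in (u,
    m). With u, v the overlap sums of the two parts this is the covariance inequality. *)
Lemma even_pow_convex (n : nat) (m1 m2 u v : R) : 0 < m1 -> 0 < m2 ->
  ~~ odd n.+1 ->
  (u + v) ^+ n.+1 / (m1 + m2) ^+ n <= u ^+ n.+1 / m1 ^+ n + v ^+ n.+1 / m2 ^+ n.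
Proof.
move=> m10 m20 ev.
have absX (w : R) : w ^+ n.+1 = `|w| ^+ n.+1.
  by rewrite -normrX ger0_norm// exprn_even_ge0.
have conv (m w : R) : 0 < m -> w ^+ n.+1 / m ^+ n = m * (`|w| / m) ^+ n.+1.
  move=> m0; rewrite absX exprMn exprVn exprS [in RHS]exprS; field.
  by rewrite expf_neq0 gt_eqF.
rewrite (conv m1)// (conv m2)//.
have m0 : 0 < m1 + m2 by rewrite addr_gt0.
rewrite ler_pdivrMr ?exprn_gt0// mulrC absX.
have a0 (w m : R) : 0 < m -> 0 <= `|w| / m by move=> ?; rewrite divr_ge0 ?normr_ge0 ?(@ltW _ _ 0).
have := weighted_pow_convex n (ltW m10) (ltW m20) (a0 u _ m10) (a0 v _ m20).
apply: le_trans.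
rewrite [m1 * _]mulrC [m2 * _]mulrC !divfK ?gt_eqF//.
by rewrite lerXn2r ?nnegrE ?addr_ge0// ler_normD.
Qed.

End directions.

(** * Superadditivity of the truncated model *)

Section truncated_model.
Context {R : realType}.
Variables (nu : probability R R) (beta_ : nat -> R).
Hypothesis nuexp : exp_moments nu.
Local Notation gam := (normal_law (0 : R) 1).
Local Notation gexp := (@normal_law01_exp_moments R).

(* [trunc_energy M N B] is the expected log-partition function of the model with
   deterministic energy [B], interactions of order at most [2 * M] and random
   fields of law [nu]. *)
Definition trunc_energy (M N : nat) (B : config N -> R) : R :=
  avgs nu (field_dirs N) (avgs gam (sk_dirs beta_ N M) (@lse R _)) B.

(** The deterministic part x of a field x + h_i. *)
Definition field_base (x : R) N : config N -> R :=
  fun sigma => x * \sum_(i < N) spin sigma i.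

Arguments field_base x N : clear implicits.

Definition config0 N : config N := [ffun=> true].

Lemma admissible_avgs_sk M N : admissible 1 (avgs gam (sk_dirs beta_ N M) (@lse R _)).
Proof. exact: (admissible_avgs gexp _ (admissible_lse (config0 N))). Qed.

Section splitting.
Variables N1 N2 : nat.

Definition left_config (s : config (N1 + N2)) : config N1 := [ffun i => s (lshift N2 i)].
Definition right_config (s : config (N1 + N2)) : config N2 := [ffun i => s (rshift N1 i)].
Definition glue_config (p : config N1 * config N2) : config (N1 + N2) :=
  [ffun i => match fintype.split i with inl j => p.1 j | inr j => p.2 j end].

Lemma left_glue p : left_config (glue_config p) = p.1.
Proof.
by apply/ffunP => i; rewrite !ffunE -[lshift _ _]/(unsplit (inl _ i)) unsplitK.
Qed.

Lemma right_glue p : right_config (glue_config p) = p.2.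
Proof.
by apply/ffunP => i; rewrite !ffunE -[rshift _ _]/(unsplit (inr _ i)) unsplitK.
Qed.

Lemma glue_left_right s : glue_config (left_config s, right_config s) = s.
Proof.
apply/ffunP => i; rewrite ffunE; case: splitP => j ij /=; rewrite ffunE;
  by congr (s _); apply: val_inj.
Qed.

Lemma spin_left s i : spin (left_config s) i = spin s (lshift N2 i) :> R.
Proof. by rewrite /spin ffunE. Qed.

Lemma spin_right s i : spin (right_config s) i = spin s (rshift N1 i) :> R.
Proof. by rewrite /spin ffunE. Qed.

Lemma overlap_sum_split s t : overlap_sum s t =
  overlap_sum (left_config s) (left_config t) +
  overlap_sum (right_config s) (right_config t) :> R.
Proof.
rewrite /overlap_sum big_split_ord; congr (_ + _); apply: eq_bigr => i _.
  by rewrite !spin_left.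
by rewrite !spin_right.
Qed.

Lemma field_dirs_split : field_dirs (N1 + N2) =
  [seq a \o left_config | a <- field_dirs N1] ++
  [seq a \o right_config | a <- field_dirs N2] :> seq (config (N1 + N2) -> R).
Proof.
rewrite /field_dirs.
have -> : enum 'I_(N1 + N2) =
    [seq lshift N2 i | i <- enum 'I_N1] ++ [seq rshift N1 i | i <- enum 'I_N2].
  have ve n : map (@nat_of_ord n) (enum 'I_n) = iota 0 n by exact: val_enum_ord.
  apply: (@inj_map _ _ (@nat_of_ord _) (@ord_inj _)); rewrite map_cat ve iotaD.
  rewrite -(map_comp _ (lshift N2)) -(map_comp _ (@rshift N1 N2)).
  congr (_ ++ _); first by rewrite -ve; exact: eq_map.
  by rewrite add0n -[X in iota X _]addn0 iotaDl -ve -map_comp.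
rewrite map_cat -(map_comp _ (lshift N2)) -(map_comp _ (@rshift N1 N2)).
rewrite -(map_comp _ _ (enum 'I_N1)) -(map_comp _ _ (enum 'I_N2)).
by congr (_ ++ _); apply: eq_map => i /=; apply/funext => s /=;
  rewrite ?spin_left ?spin_right.
Qed.

Lemma field_base_split x : field_base x (N1 + N2)%N = fun s =>
  field_base x N1 (left_config s) + field_base x N2 (right_config s).
Proof.
apply/funext => s; rewrite /field_base big_split_ord mulrDr.
by congr (_ * _ + _ * _); apply: eq_bigr => i _; rewrite ?spin_left ?spin_right.
Qed.

Lemma trunc_energy_superadditive M x : (0 < N1)%N -> (0 < N2)%N ->
  trunc_energy M (field_base x N1) + trunc_energy M (field_base x N2) <=
  trunc_energy M (field_base x (N1 + N2)%N).
Proof.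
move=> N10 N20.
have N10' : (0 : R) < N1%:R by rewrite ltr0n.
have N20' : (0 : R) < N2%:R by rewrite ltr0n.
(* Couplings of two independent systems, lifted to configurations of all N1 + N2 sites. *)
pose l1 := [seq a \o left_config | a <- sk_dirs beta_ N1 M].
pose l2 := [seq a \o right_config | a <- sk_dirs beta_ N2 M].
have cov12 s t : \sum_(a <- l1 ++ l2) a s * a t = \sum_(1 <= p < M.+1)
    (cov_term beta_ p N1 (overlap_sum (left_config s) (left_config t)) +
     cov_term beta_ p N2 (overlap_sum (right_config s) (right_config t))).
  by rewrite big_cat !big_map /= !sk_dirs_cov// big_split.
have N0 : (0 < N1 + N2)%N by rewrite addn_gt0 N10.
have comp y : avgs gam (l1 ++ l2) (@lse R _) y <=
    avgs gam (sk_dirs beta_ (N1 + N2) M) (@lse R _) y.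
  apply: (gaussian_comparison (config0 _)) => [s|s t].
    (* The overlap sum of a configuration with itself is the number of sites, so the variances at
       order p are beta_p^2 (N1 + N2) on both sides. *)
    under eq_bigr do rewrite expr2.
    under [RHS]eq_bigr do rewrite expr2.
    rewrite cov12 sk_dirs_cov//; apply: eq_big_nat => p /andP[p0 _].
    rewrite !overlap_sum_diag /cov_term -mulrDr; congr (_ * _).
    have pE : (2 * p)%N = (2 * p).-1.+1 by rewrite prednK// muln_gt0.
    rewrite pE /= !exprS !mulfK ?expf_neq0 ?gt_eqF//; last by rewrite ltr0n.
    by rewrite natrD.
  rewrite cov12 sk_dirs_cov//; apply: ler_sum_nat => p /andP[p0 _].
  rewrite overlap_sum_split /cov_term -mulrDr; apply: ler_wpM2l; first exact: sqr_ge0.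
  have pE : (2 * p)%N = (2 * p).-1.+1 by rewrite prednK// muln_gt0.
  rewrite natrD pE; apply: even_pow_convex => //.
  by rewrite -pE mul2n odd_double.
have AL1 := admissible_avgs_sk M N1; have AL2 := admissible_avgs_sk M N2.
have lseA N := admissible_lse (R := R) (config0 N).
have ALl := admissible_avgs gexp (l1 ++ l2) (lseA (N1 + N2)%N).
have mono := avgs_le nuexp (field_dirs (N1 + N2)) (field_base x (N1 + N2)%N) ALl
   (admissible_avgs_sk M (N1 + N2)).
have : avgs nu (field_dirs (N1 + N2)) (avgs gam (l1 ++ l2) (@lse R _)) (field_base x (N1 + N2)%N)
    <= trunc_energy M (field_base x (N1 + N2)%N).
  by rewrite -[leRHS]addr0; apply: mono => y; rewrite addr0.
(* What remains is an identity: without interaction between the parts, both the coupling averages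
   and the field averages factorize. *)
apply: le_trans; rewrite le_eqVlt; apply/orP; left; apply/eqP.
have S0 := splits_lse (R := R) left_glue right_glue glue_left_right (config0 N1) (config0 N2).
have S1 : splits left_config right_config (avgs gam (l1 ++ l2) (@lse R _))
    (avgs gam (sk_dirs beta_ N1 M) (@lse R _)) (avgs gam (sk_dirs beta_ N2 M) (@lse R _)).
  rewrite avgs_cat; apply: (splits_avgs1 gexp _ (lseA N1)).
  exact: (splits_avgs2 gexp _ (lseA N2)).
rewrite field_dirs_split avgs_cat field_base_split.
apply/esym; apply: (splits_avgs1 nuexp _ AL1).
exact: (splits_avgs2 nuexp _ AL2).
Qed.

End splitting.
End truncated_model.

Arguments field_base {R} x N _.

(** * Monotone functionals and maximal inequalities *)

Section monotone_functionals.
Context {R : realType} {S : finType}.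
Implicit Types (f : (S -> R) -> R) (a b x y : S -> R) (l : seq (S -> R)).

(** One-sided counterpart of [sup_lipschitz]: an inequality such as m^2 >= 2 mu m - mu^2 bounds an
    energy from one side only. *)
Definition shift_monotone f : Prop := forall x y (e : R),
  (forall s, x s <= y s + e) -> f x <= f y + e.

Lemma shift_monotone_lse (s0 : S) : shift_monotone (@lse R S).
Proof. by move=> x y e xy; exact: (lse_le s0). Qed.

Section with_law.
Variable nu : probability R R.
Hypothesis nuexp : exp_moments nu.

Lemma shift_monotone_avg (L : R) a f : admissible L f -> shift_monotone f ->
  shift_monotone (avg nu a f).
Proof.
move=> fL fm x y e xy; rewrite -(Rintegral_probability_cst nu e) -RintegralD//; last 2 first.
- exact: (admissible_integrable a y nuexp fL).
- exact: integrable_cst.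
apply: le_Rintegral => //; first exact: (admissible_integrable a x nuexp fL).
- by apply: integrable_realD; [exact: (admissible_integrable a y nuexp fL)|exact: integrable_cst].
- move=> z _; apply: fm => s; rewrite /shift addrAC lerD2r; exact: xy.
Qed.

Lemma shift_monotone_avgs (L : R) l f : admissible L f -> shift_monotone f ->
  shift_monotone (avgs nu l f).
Proof.
move=> fL fm; elim: l => //= a l IH.
by apply: shift_monotone_avg IH; exact: (admissible_avgs nuexp l fL).
Qed.

(** Moves a deterministic energy from the base point into the functional, so that systems with
    different energies are functionals of the same random vector. *)
Lemma avgs_shift l f b x :
  avgs nu l f (fun s => b s + x s) = avgs nu l (fun y => f (fun s => b s + y s)) x.
Proof.
elim: l x => //= a l IH x; apply: eq_Rintegral => z _; rewrite -IH.
by congr (avgs _ _ _ _); apply/funext => s; rewrite /shift addrA.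
Qed.

Lemma admissible_shift (L : R) f b : admissible L f ->
  admissible L (fun y => f (fun s => b s + y s)).
Proof.
move=> [L0 fL fm]; split => //.
  by move=> x y e e0 xy; apply: fL => // s; rewrite opprD addrACA subrr add0r.
move=> d U X mX; apply: (fm _ _ (fun s u => b s + X s u)) => s.
exact: measurable_funD.
Qed.

Lemma avgs_addr (L c : R) l f x : admissible L f ->
  avgs nu l (fun y => f y + c) x = avgs nu l f x + c.
Proof.
move=> fL; elim: l x => //= a l IH x.
rewrite (_ : avgs nu l _ = fun y => avgs nu l f y + c); last exact/funext.
rewrite (avgD nuexp a x (admissible_avgs nuexp l fL) (admissible_cst c)).
by rewrite avg_cst.
Qed.

Lemma avgs_dist_id (L : R) l f x : admissible L f ->
  `|avgs nu l f x - f x| <= L * abs_mean nu * \sum_(a <- l) sup_norm a.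
Proof.
move=> fL; elim: l x => [|a l IH] x /=.
  by rewrite big_nil mulr0 subrr normr0.
rewrite big_cons mulrDr.
rewrite (_ : _ - f x = (avg nu a (avgs nu l f) x - avgs nu l f x) + (avgs nu l f x - f x)); last by ring.
rewrite (le_trans (ler_normD _ _))// lerD//.
have := avg_dist_id nuexp x (admissible_avgs nuexp l fL) (sup_norm_ge0 a) (sup_norm_bound a).
by rewrite -/(abs_mean nu) mulrAC.
Qed.

End with_law.

Definition coord (s : S) : (S -> R) -> R := fun x => x s.

Lemma admissible_coord s : admissible 1 (coord s).
Proof.
split => // [x y e e0 xy|d U X mX]; first by rewrite mul1r; exact: xy.
exact: mX.
Qed.

Local Notation gam := (normal_law (0 : R) 1).
Local Notation gexp := (@normal_law01_exp_moments R).

Lemma avgs_coord s l : avgs gam l (coord s) = coord s.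
Proof.
elim: l => //= a l ->; apply/funext => x; rewrite /avg /coord /shift.
have intz : gam.-integrable setT (EFin \o (fun z : R => z)).
  by apply: (@lipschitzR_integrable _ gam gexp 1) => u v; rewrite mul1r.
under eq_Rintegral do rewrite [_ * a s]mulrC.
rewrite RintegralD//; [|exact: integrable_cst|exact: integrable_realZ].
by rewrite Rintegral_probability_cst RintegralZl// Rintegral_normal_id mulr0 addr0.
Qed.

(** A maximal inequality for Gaussian energies: coordinates are linear and the normal law is
    centered, so averaging leaves each coordinate unchanged and only the soft maximum error
    appears. *)
Lemma avgs_smax_coord_le (s0 : S) (theta : R) l x : 0 < theta ->
  all (fun a => theta * sup_norm a <= 1) l ->
  avgs gam l (smax theta coord) x <=
  smax theta coord x + softmax_cst gam * theta * \sum_(a <- l) sup_norm a ^+ 2.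
Proof.
move=> t0 tl; have := avgs_smax_le gexp s0 x t0 admissible_coord tl.
by rewrite (_ : (fun k => avgs gam l (coord k)) = coord)//; apply/funext => s; exact: avgs_coord.
Qed.

Lemma le_smax (K : finType) (theta : R) (F : K -> (S -> R) -> R) k x : 0 < theta ->
  F k x <= smax theta F x.
Proof. by move=> t0; rewrite /smax ler_pdivlMl//; exact: (le_lse k (fun k => theta * F k x)). Qed.

Lemma smax_le (K : finType) (k0 : K) (theta m : R) (F : K -> (S -> R) -> R) x : 0 < theta ->
  (forall k, F k x <= m) -> smax theta F x <= theta^-1 * ln #|K|%:R + m.
Proof.
move=> t0 Fm; rewrite /smax ler_pdivrMl// mulrDr mulrA divff ?gt_eqF// mul1r.
by apply: (lse_le_card k0) => k; rewrite ler_pM2l.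
Qed.

Lemma avgs_lse_le (s0 : S) (theta : R) l x : 0 < theta ->
  all (fun a => theta * sup_norm a <= 1) l ->
  avgs gam l (@lse R S) x <= smax theta coord x +
    (softmax_cst gam * theta * (\sum_(a <- l) sup_norm a ^+ 2) + ln #|S|%:R).
Proof.
move=> t0 tl.
have H : forall y, lse y <= smax theta coord y + ln #|S|%:R.
  by move=> y; rewrite addrC; apply: (lse_le_card s0) => s; exact: (le_smax coord).
apply: le_trans (avgs_le gexp l x (admissible_lse s0)
  (admissible_smax s0 t0 admissible_coord) H) _.
by rewrite addrA lerD2r; exact: avgs_smax_coord_le.
Qed.

End monotone_functionals.

(** * Linear growth and the grid bound *)

Section truncated_bounds.
Context {R : realType}.
Variables (nu : probability R R) (beta_ : nat -> R) (M : nat).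
Hypothesis nuexp : exp_moments nu.
Local Notation gam := (normal_law (0 : R) 1).
Local Notation gexp := (@normal_law01_exp_moments R).
Local Notation E B := (trunc_energy nu beta_ M B).

Lemma trunc_energy_mono N (B B' : config N -> R) (e : R) :
  (forall s, B s <= B' s + e) -> E B <= E B' + e.
Proof.
move=> BB'; apply: (shift_monotone_avgs nuexp _ (admissible_avgs_sk beta_ M N)) => //.
apply: (shift_monotone_avgs gexp _ (admissible_lse (config0 N))).
exact: (shift_monotone_lse (config0 N)).
Qed.

Definition coupling_l1 : R := \sum_(1 <= p < M.+1) `|beta_ p|.
Definition coupling_l2 : R := \sum_(1 <= p < M.+1) beta_ p ^+ 2.

Lemma coupling_l1_ge0 : 0 <= coupling_l1. Proof. exact: sumr_ge0. Qed.

Lemma sk_dirs_norm N : (0 < N)%N ->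
  all (fun a => sup_norm a <= coupling_l1) (sk_dirs beta_ N M).
Proof.
move=> N0; apply/allP => a /flattenP[l /mapP[p pI ->] al].
move: pI; rewrite mem_index_iota => /andP[p0 pM].
have /allP/(_ a al) := coupling_dirs_norm beta_ N0 p0.
move=> /le_trans; apply; rewrite /coupling_l1 (bigD1_seq p) ?mem_index_iota ?p0 ?iota_uniq//=.
by rewrite lerDl sumr_ge0.
Qed.

Lemma sk_dirs_norm_sum N : (0 < N)%N ->
  \sum_(a <- sk_dirs beta_ N M) sup_norm a ^+ 2 <= coupling_l2 * N%:R.
Proof.
move=> N0; rewrite big_flatten big_map /coupling_l2 mulr_suml.
by apply: ler_sum_nat => p /andP[p0 _]; exact: coupling_dirs_norm_sum.
Qed.

(** Small enough for theta times the norm to be at most 1 in every direction: coupling directions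
    have norm at most [coupling_l1], field directions at most 1. *)
Definition theta0 : R := (coupling_l1 + 1)^-1.

Lemma theta0_gt0 : 0 < theta0.
Proof. by rewrite invr_gt0 ltr_wpDl// coupling_l1_ge0. Qed.

Lemma sk_dirs_theta N (theta : R) : (0 < N)%N -> 0 < theta -> theta <= theta0 ->
  all (fun a => theta * sup_norm a <= 1) (sk_dirs beta_ N M).
Proof.
move=> N0 t0 tt; apply: sub_all (sk_dirs_norm N0) => a al.
have c1 : 0 < coupling_l1 + 1 by rewrite ltr_wpDl// coupling_l1_ge0.
apply: (@le_trans _ _ (theta0 * (coupling_l1 + 1))).
  apply: ler_pM => //; [exact: ltW|exact: sup_norm_ge0|].
  by rewrite (le_trans al)// lerDl.
by rewrite /theta0 mulVf// gt_eqF.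
Qed.

Lemma field_dirs_theta N (theta : R) : 0 < theta -> theta <= theta0 ->
  all (fun a => theta * sup_norm a <= 1) (field_dirs N).
Proof.
move=> t0 tt; apply: sub_all (field_dirs_norm N) => a al.
have c1 : 0 < coupling_l1 + 1 by rewrite ltr_wpDl// coupling_l1_ge0.
apply: (@le_trans _ _ (1 * 1)); last by rewrite mulr1.
apply: ler_pM => //; [exact: ltW|exact: sup_norm_ge0|].
by rewrite (le_trans tt)// /theta0 invf_le1// lerDr coupling_l1_ge0.
Qed.

Lemma ln_card_config N : ln #|{: config N}|%:R = N%:R * ln 2 :> R.
Proof. by rewrite card_ffun card_bool card_ord natrX lnXn// mulr_natl. Qed.

(** The upper bound for Fekete's lemma. [lse] exceeds the soft maximum of the energies by at most N
    ln 2; the couplings then cost O(N) by the maximal inequality, and the fields at most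
    [abs_mean nu] per site. *)
Lemma trunc_energy_linear (x : R) : exists C : R, forall N, (0 < N)%N ->
  E (field_base x N) <= C * N%:R.
Proof.
exists (abs_mean nu + `|x| + theta0^-1 * ln 2 +
  softmax_cst gam * theta0 * coupling_l2 + ln 2) => N N0.
have t0 := theta0_gt0.
have c0 := config0 N.
pose D := softmax_cst gam * theta0 * (\sum_(a <- sk_dirs beta_ N M) sup_norm a ^+ 2) +
  ln #|{: config N}|%:R.
have cA : admissible 1 (smax theta0 (@coord R (config N))).
  by apply: (admissible_smax c0 t0) => s; exact: admissible_coord.
have H1 : E (field_base x N) <=
    avgs nu (field_dirs N) (smax theta0 (@coord R (config N))) (field_base x N) + D.
  apply: (avgs_le nuexp _ _ (admissible_avgs_sk beta_ M N) cA) => y.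
  exact: avgs_lse_le (sk_dirs_theta N0 t0 (lexx _)).
apply: (le_trans H1).
have H2 := avgs_dist_id nuexp (field_dirs N) (field_base x N) cA.
have H3 : \sum_(a <- field_dirs N) sup_norm a <= N%:R :> R.
  rewrite big_map big_enum /= -[N in leRHS]card_ord -sumr_const.
  by apply: ler_sum => i _; apply: sup_norm_le => // s; rewrite normr_spin.
have H4 : smax theta0 (@coord R (config N)) (field_base x N) <=
    theta0^-1 * ln #|{: config N}|%:R + `|x| * N%:R.
  apply: (smax_le c0) => // s; rewrite /coord /field_base.
  rewrite (le_trans (ler_norm _))// normrM ler_wpM2l// (le_trans (ler_norm_sum _ _ _))//.
  under eq_bigr do rewrite normr_spin.
  by rewrite sumr_const card_ord.
have H5 := sk_dirs_norm_sum N0.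
have H6 : avgs nu (field_dirs N) (smax theta0 (@coord R (config N))) (field_base x N) <=
    abs_mean nu * N%:R + (theta0^-1 * ln #|{: config N}|%:R + `|x| * N%:R).
  rewrite -lerBlDr; apply: le_trans (lerB (lexx _) H4) _.
  apply: le_trans (ler_norm _) _; apply: (le_trans H2).
  by rewrite mul1r ler_wpM2l// abs_mean_ge0.
have H7 : D <= softmax_cst gam * theta0 * (coupling_l2 * N%:R) + ln #|{: config N}|%:R.
  by rewrite lerD2r ler_wpM2l// mulr_ge0 ?softmax_cst_ge0// ltW.
apply: (le_trans (lerD H6 H7)); rewrite ln_card_config.
by rewrite le_eqVlt; apply/orP; left; apply/eqP; ring.
Qed.

(** The term ln #|K| arises in passing from the logarithm of a sum over [K] to the soft maximum, and
    ln #|K| / theta in passing from the soft maximum of the averages to their maximum. In between,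
    the soft maximum crosses the coupling averages and the field averages. *)
Lemma trunc_energy_grid (K : finType) (k0 : K) N (B : config N -> R)
    (b : K -> config N -> R) (c : K -> R) (theta D m : R) :
  (0 < N)%N -> 0 < theta -> theta <= theta0 ->
  (forall s, exists k, B s <= b k s + c k + D) ->
  (forall k, E (b k) + c k <= m) ->
  E B <= m + D + (1 + theta^-1) * ln #|K|%:R +
    theta * (softmax_cst gam * coupling_l2 + softmax_cst nu) * N%:R.
Proof.
move=> N0 t0 tt HB Hm.
have c0 := config0 N.
have lseA := @admissible_lse R _ c0.
pose F k (y : config N -> R) : R := lse (fun s => b k s + y s) + c k.
have FA k : admissible 1 (F k).
  rewrite -[1]addr0; apply: admissibleD; last exact: admissible_cst.
  exact: admissible_shift.
pose lg := sk_dirs beta_ N M; pose lf := field_dirs N : seq (config N -> R).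
have H1 (y : config N -> R) : lse (fun s => B s + y s) <=
    smax theta F y + (D + ln #|K|%:R).
  have : lse (fun k => F k y) <= ln #|K|%:R + smax theta F y.
    by apply: (lse_le_card k0) => k; exact: (le_smax F).
  suff : lse (fun s => B s + y s) <= lse (fun k => F k y) + D by lra.
  rewrite -ler_expR expRD (expR_lse c0) (expR_lse k0) mulr_suml.
  under [leRHS]eq_bigr do rewrite /F expRD (expR_lse c0) mulr_suml mulr_suml.
  rewrite exchange_big /=; apply: ler_sum => s _.
  have [k hk] := HB s; rewrite (bigD1 k)//=.
  apply: (@le_trans _ _ (expR (b k s + y s) * expR (c k) * expR D)).
    by rewrite -!expRD ler_expR; lra.
  by rewrite lerDl sumr_ge0// => j _; rewrite -!expRD expR_ge0.
have B0 : B = (fun s => B s + 0) by apply/funext => s; rewrite addr0.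
have sA := admissible_smax k0 t0 FA.
(* All systems are put at the base point 0, where their log-partition functions depend on common
   random energies. *)
have EB (Q : config N -> R) : E Q =
    avgs nu lf (avgs gam lg (fun y => lse (fun s => Q s + y s))) (fun=> 0).
  rewrite /trunc_energy {1}(_ : Q = (fun s => Q s + 0)); last first.
    by apply/funext => s; rewrite addr0.
  rewrite (avgs_shift nu lf _ Q (fun=> 0)); congr (avgs _ _ _ _).
  by apply/funext => y; rewrite avgs_shift.
pose G k := avgs gam lg (F k).
have GA k : admissible 1 (G k) := admissible_avgs gexp lg (FA k).
have H2 y : avgs gam lg (fun y => lse (fun s => B s + y s)) y <=
   smax theta G y + (softmax_cst gam * theta * (\sum_(a <- lg) sup_norm a ^+ 2) + (D + ln #|K|%:R)).
  apply: le_trans (avgs_le gexp lg y (admissible_shift B lseA) sA H1) _.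
  have h := avgs_smax_le gexp k0 y t0 FA (sk_dirs_theta N0 t0 tt).
  by apply: le_trans (lerD h (lexx _)) _; rewrite -addrA.
rewrite EB.
have lfA := admissible_avgs gexp lg (admissible_shift B lseA).
apply: le_trans (avgs_le nuexp lf (fun=> 0) lfA (admissible_smax k0 t0 GA) H2) _.
have H3 := avgs_smax_le nuexp k0 (fun=> 0) t0 GA (field_dirs_theta N t0 tt).
have H4 : smax theta (fun k => avgs nu lf (G k)) (fun=> 0) <= theta^-1 * ln #|K|%:R + m.
  apply: (smax_le k0) => // k; apply: le_trans (Hm k).
  rewrite EB -(avgs_addr nuexp (c k) _ _ (admissible_avgs gexp lg (admissible_shift (b k) lseA))).
  rewrite le_eqVlt; apply/orP; left; apply/eqP; congr (avgs _ _ _ _).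
  by apply/funext => y; rewrite /G -(avgs_addr gexp (c k) _ _ (admissible_shift (b k) lseA)).
have H5 : softmax_cst nu * theta * \sum_(a <- lf) sup_norm a ^+ 2 <= softmax_cst nu * theta * N%:R.
  by rewrite ler_wpM2l ?field_dirs_norm_sum// mulr_ge0 ?softmax_cst_ge0// ltW.
have H6 : softmax_cst gam * theta * (\sum_(a <- lg) sup_norm a ^+ 2) <=
    softmax_cst gam * theta * (coupling_l2 * N%:R).
  by rewrite ler_wpM2l ?sk_dirs_norm_sum// mulr_ge0 ?softmax_cst_ge0// ltW.
lra.
Qed.

End truncated_bounds.

(** * Independence and iterated averages *)

Section distributions.
Context {d d' : measure_display} {T : measurableType d} {T' : measurableType d'}
  {R : realType}.
Variables (P : probability T R) (X : {mfun T >-> T'}).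

Lemma integrable_distribution (g : T' -> R) : measurable_fun setT g ->
  (distribution P X).-integrable setT (EFin \o g) <->
  P.-integrable setT (EFin \o (g \o X)).
Proof.
move=> mg; have mgX : measurable_fun setT (g \o X) by exact: measurableT_comp.
have E : (\int[distribution P X]_y `|(EFin \o g) y| =
    \int[P]_x `|(EFin \o (g \o X)) x|)%E.
  rewrite (@ge0_integral_distribution _ _ _ _ _ P X)//.
  by apply: measurableT_comp => //; exact/measurable_EFinP.
split => /integrableP[_ H]; apply/integrableP.
  by split; [exact/measurable_EFinP|rewrite -E].
by split; [exact/measurable_EFinP|rewrite E].
Qed.

Lemma Rintegral_distribution (g : T' -> R) : measurable_fun setT g ->
  P.-integrable setT (EFin \o (g \o X)) ->
  \int[distribution P X]_y g y = \int[P]_x g (X x).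
Proof.
move=> mg ig; congr fine; apply: (@integral_distribution _ _ _ _ _ P X) => //.
exact/measurable_EFinP.
Qed.

End distributions.

Section transfer.
Context {d : measure_display} {T : measurableType d} {R : realType}.
Variable P : probability T R.
Context {I : choiceType}.
Variables (D : set I) (X : I -> {RV P >-> R}).
Hypothesis indep : mutually_independent D X.

Lemma independence_seq (K : seq I) (B : I -> set R) : uniq K ->
  (forall i, i \in K -> D i) -> (forall i, i \in K -> measurable (B i)) ->
  P (\bigcap_(i in [set` K]) X i @^-1` B i) = (\prod_(i <- K) P (X i @^-1` B i))%E.
Proof.
move=> uK DK mB.
have mem i : (i \in [fset j in K]%fset) = (i \in K) by rewrite in_fset.
have := indep (J := [fset j in K]%fset) (B := B).
rewrite (_ : [set` [fset j in K]%fset] = [set` K]); last first.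
  by apply/seteqP; split => i /=; rewrite mem.
rewrite (perm_big K); last first.
  apply: uniq_perm => //; exact: fset_uniq.
by apply => i; rewrite mem; [exact: DK|exact: mB].
Qed.

Section conditioning.
Variables (i : I) (K : seq I).
Hypothesis uK : uniq (i :: K).
Hypothesis DK : forall j, j \in i :: K -> D j.

(* [X i] is independent of the sigma-algebra [TG] generated by the other variables,
   so the law of [w |-> (X i w, w)] on [R * TG] is a product and Fubini applies. *)
Let cylinders : set (set T) := [set A | exists2 B : I -> set R,
  (forall j, measurable (B j)) & A = \bigcap_(j in [set` K]) X j @^-1` B j].

Let mX j (B : set R) : measurable B -> measurable (X j @^-1` B).
Proof. by move=> mB; rewrite -[_ @^-1` _]setTI; exact: measurable_funP. Qed.

Let measurable_cylinders : cylinders `<=` measurable.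
Proof.
move=> A [B mB ->]; apply: fin_bigcap_measurable => [|j _]; [exact: finite_seq|exact: mX].
Qed.

Let setI_cylinders : setI_closed cylinders.
Proof.
move=> A1 A2 [B1 mB1 ->] [B2 mB2 ->]; exists (fun j => B1 j `&` B2 j).
  by move=> j; exact: measurableI.
by rewrite -bigcapI; apply: eq_bigcapr => j _; rewrite preimage_setI.
Qed.

Let cylindersT : cylinders setT.
Proof.
exists (fun=> setT) => //; apply/seteqP; split => // w _ j _ //.
Qed.

Let TG := g_sigma_algebraType cylinders.

Let idG : T -> TG := id.

Let measurable_idG : measurable_fun setT idG.
Proof.
move=> _ A mA; rewrite setTI.
by move: A mA; apply: smallest_sub => //; exact: sigma_algebra_measurable.
Qed.

HB.instance Definition _ := @isMeasurableFun.Build _ _ _ _ idG measurable_idG.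

Let PG : probability TG R := distribution P (idG : {mfun T >-> TG}).

Let law : probability R R := distribution P (X i).

(** Both sides are finite measures in B that agree on the cylinders, which are stable under
    intersection; hence they agree on the generated sigma-algebra. *)
Let indep_cylinder A B : measurable A -> <<s cylinders >> B ->
  P (X i @^-1` A `&` B) = (law A * P B)%E.
Proof.
move=> mA sB.
have mXA := mX i mA.
pose m1 := mrestr P mXA.
have c0 : 0 <= fine (law A) by exact: fine_ge0.
pose m2 := mscale (NngNum c0) P.
have lawA : ((NngNum c0)%:num)%:E = law A :> \bar R.
  by rewrite /= fineK// fin_num_measure.
suff : m1 B = m2 B.
  by rewrite /m1 /m2 /mrestr /mscale lawA setIC.
apply: (@g_sigma_algebra_measure_unique _ _ _ cylinders measurable_cylinders
  (fun=> setT) (fun=> cylindersT) _ m1 m2) => //.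
- by rewrite bigcup_const.
- move=> _ [B' mB' ->].
  (* Encodes the event on X i and the cylinder over [K] in one family, so that independence applies
     to [i :: K] and to [K] with the same sets. *)
  pose B2 j := if j == i then A else B' j.
  have iK : i \notin K by move: uK => /= /andP[].
  have EK : \bigcap_(j in [set` K]) X j @^-1` B' j =
            \bigcap_(j in [set` K]) X j @^-1` B2 j.
    apply: eq_bigcapr => j /= jK; rewrite /B2; case: eqP => // ji.
    by move: iK; rewrite -ji jK.
  have mB2 j : measurable (B2 j) by rewrite /B2; case: ifP.
  have /andP[_ uK'] := uK.
  have E1 := independence_seq uK DK (fun j _ => mB2 j).
  have E2 := independence_seq uK' (fun j jK => DK (mem_behead (s := i :: K) jK)) (fun j _ => mB2 j).
  rewrite big_cons /= in E1.
  have : \bigcap_(j in [set` i :: K]) X j @^-1` B2 j =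
     X i @^-1` A `&` \bigcap_(j in [set` K]) X j @^-1` B2 j.
    apply/seteqP; split => w.
      move=> H; split; first by have := H i (mem_head _ _); rewrite /= /B2 eqxx.
      by move=> j jK; apply: H; rewrite /= inE jK orbT.
    move=> [H1 H2] j /=; rewrite inE => /orP[/eqP ->|jK]; last exact: H2.
    by rewrite /B2 eqxx.
  move=> EB; rewrite EK; set C := \bigcap_(j in [set` K]) _ in EB E2 *.
  change (P (C `&` X i @^-1` A) = (((NngNum c0)%:num)%:E * P C)%E).
  by rewrite lawA setIC -EB E1 E2 /B2 eqxx.
- move=> _; change (P (setT `&` X i @^-1` A) < +oo)%E; rewrite setTI.
  by rewrite (le_lt_trans (probability_le1 _ _))// ltry.
Qed.

Let phi : T -> R * TG := fun w => (X i w, w).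

Let measurable_phi : measurable_fun setT phi.
Proof. by apply/measurable_fun_pairP; split => //; exact: measurable_idG. Qed.

HB.instance Definition _ := @isMeasurableFun.Build _ _ _ _ phi measurable_phi.

Let joint : probability (R * TG)%type R := distribution P (phi : {mfun T >-> (R * TG)%type}).

Let jointE C : measurable C -> (law \x PG)%E C = joint C.
Proof.
apply: product_measure_unique => A B mA mB.
by rewrite -indep_cylinder.
Qed.

Let integrable_X j : exp_moments (distribution P (X j)) ->
  P.-integrable setT (EFin \o (fun w => `|X j w|)).
Proof.
move=> /integrable_abs /integrable_distribution; apply.
exact: measurableT_comp.
Qed.

(** Integrates out X i given the other variables; its contribution to the energy becomes one average
    of the functional. *)
Lemma Rintegral_conditioning (L : R) (S : finType) (a : I -> S -> R)
    (f : (S -> R) -> R) (b : S -> R) :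
  (forall j, j \in i :: K -> exp_moments (distribution P (X j))) ->
  admissible L f ->
  \int[P]_w f (fun s => b s + \sum_(j <- i :: K) X j w * a j s) =
  \int[P]_w avg law (a i) f (fun s => b s + \sum_(j <- K) X j w * a j s).
Proof.
move=> expX fL; have [L0 fLip fm] := fL.
pose Y (w : TG) s := b s + \sum_(j <- K) X j w * a j s.
pose F (p : R * TG) := f (fun s => Y p.2 s + p.1 * a i s).
have mXG j : j \in K -> measurable_fun setT (X j : TG -> R).
  move=> jK _ B mB; rewrite setTI; apply: sub_sigma_algebra.
  exists (fun k => if k == j then B else setT).
    by move=> k; case: ifP.
  apply/seteqP; split => w.
    by move=> XB k _ /=; case: eqP => // ->.
  by move=> /(_ j jK) /=; rewrite eqxx.
have mY s : measurable_fun setT (fun w : TG => Y w s).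
  apply: measurable_funD => //.
  have : {subset K <= K} by [].
  elim: {1 3}K => [_|j K' IH jK].
    by rewrite [X in measurable_fun _ X](_ : _ = cst 0)//; apply/funext => w; rewrite big_nil.
  rewrite [X in measurable_fun _ X](_ : _ = (fun w : TG =>
    X j w * a j s + \sum_(j <- K') X j w * a j s)); last by apply/funext => w; rewrite big_cons.
  apply: measurable_funD; last by apply: IH => k kK; apply: jK; rewrite inE kK orbT.
  by apply: measurable_funM => //; apply: mXG; apply: jK; exact: mem_head.
have mF : measurable_fun setT F.
  apply: fm => s; apply: measurable_funD; last exact: measurable_funM.
  exact: (measurableT_comp (mY s) measurable_snd).
(* Dominates the distance of the energy vector from [b], and is measurable for the smaller
   sigma-algebra [TG]. *)
pose W (w : T) := \sum_(j <- K) sup_norm (a j) * `|X j w|.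
have [mW iW] : measurable_fun setT (W : TG -> R) /\ P.-integrable setT (EFin \o W).
  rewrite /W; have : {subset K <= K} by [].
  elim: {1 3 4}K => [_|j K' IH jK].
    rewrite [Q in measurable_fun _ Q](_ : _ = cst 0); last by apply/funext => w; rewrite big_nil.
    rewrite (_ : EFin \o _ = EFin \o cst 0); last by apply/funext => w /=; rewrite big_nil.
    by split => //; exact: integrable_cst.
  have [|mK iK] := IH; first by move=> k kK; apply: jK; rewrite inE kK orbT.
  have jK' : j \in K by apply: jK; exact: mem_head.
  rewrite [Q in measurable_fun _ Q](_ : _ = (fun w : TG =>
    sup_norm (a j) * `|X j w| + \sum_(j <- K') sup_norm (a j) * `|X j w|)); last first.
    by apply/funext => w; rewrite big_cons.
  rewrite (_ : EFin \o _ = EFin \o (fun w =>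
    sup_norm (a j) * `|X j w| + \sum_(j <- K') sup_norm (a j) * `|X j w|)); last first.
    by apply/funext => w /=; rewrite big_cons.
  split.
    apply: measurable_funD => //; apply: measurable_funM => //.
    by apply: measurableT_comp => //; exact: mXG.
  apply: integrable_realD => //; apply: integrable_realZ; apply: integrable_X.
  by apply: expX; rewrite inE jK' orbT.
have YW w s : `|Y w s - b s| <= W w.
  rewrite /Y [b s + _]addrC addrK (le_trans (ler_norm_sum _ _ _))// ler_sum// => j _.
  by rewrite normrM mulrC ler_wpM2r// sup_norm_bound.
have W0 w : 0 <= W w by apply: sumr_ge0 => j _; rewrite mulr_ge0// sup_norm_ge0.
pose v (w : T) := `|f b| + L * W w.
(* The additional constant turns the additive bound on F into the product (1 + |z|) V, as Fubini's
   theorem is stated for product bounds. *)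
pose V (w : T) := v w + L * sup_norm (a i).
have iv : P.-integrable setT (EFin \o v).
  by apply: integrable_realD; [exact: integrable_cst|exact: integrable_realZ].
have mV : measurable_fun setT (V : TG -> R).
  by do 2 (apply: measurable_funD => //); exact: measurable_funM.
have iV : P.-integrable setT (EFin \o V).
  by apply: integrable_realD => //; exact: integrable_cst.
have iVG : PG.-integrable setT (EFin \o V).
  exact/(@integrable_distribution _ _ _ _ _ P idG V mV).
have Fv z w : `|F (z, w)| <= v w + L * (sup_norm (a i) * `|z|).
  have : `|F (z, w) - f b| <= L * (W w + sup_norm (a i) * `|z|).
    apply: fLip; first by rewrite addr_ge0 ?mulr_ge0 ?sup_norm_ge0.
    move=> s; rewrite [Q in `|Q|](_ : _ = (Y w s - b s) + z * a i s); last by rewrite /=; ring.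
    rewrite (le_trans (ler_normD _ _))// lerD//.
    by rewrite normrM mulrC ler_wpM2r// sup_norm_bound.
  have := ler_normD (F (z, w) - f b) (f b); rewrite subrK /v mulrDr; lra.
have v0 w : 0 <= v w by rewrite addr_ge0// mulr_ge0.
have V0 w : 0 <= V w by rewrite addr_ge0// mulr_ge0// sup_norm_ge0.
have Fuv z w : `|F (z, w)| <= (1 + `|z|) * V w.
  apply: (le_trans (Fv z w)); rewrite /V.
  have := v0 w; have := sup_norm_ge0 (a i); have := normr_ge0 z.
  set A := `|z|; set B := sup_norm _; set C := v w => A0 B0 C0.
  have := mulr_ge0 A0 C0; have := mulr_ge0 L0 B0; nra.
have lawexp : exp_moments law by apply: expX; exact: mem_head.
have iu : law.-integrable setT (EFin \o (fun z : R => 1 + `|z|)).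
  by apply: integrable_realD; [exact: integrable_cst|exact: integrable_abs].
have u0 (z : R) : 0 <= 1 + `|z| by rewrite addr_ge0.
have E1 := Rintegral_prod_swap mF Fuv u0 V0 iu iVG.
have E2 : \int[(law \x PG)%E]_z F z = \int[joint]_z F z.
  by rewrite /Rintegral; congr fine; apply: eq_measure_integral => C mC _; exact: jointE.
have iFphi : P.-integrable setT (EFin \o (F \o phi)).
  apply: (@integrable_dominated _ _ _ _ _ (fun w => v w + L * (sup_norm (a i) * `|X i w|))).
  - exact: measurableT_comp.
  - by move=> w; exact: Fv.
  - apply: integrable_realD => //; do 2 apply: integrable_realZ.
    by apply: integrable_X; apply: expX; exact: mem_head.
have E3 : \int[joint]_z F z = \int[P]_w F (phi w).
  exact: (@Rintegral_distribution _ _ _ _ _ P phi F mF iFphi).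
rewrite [LHS](_ : _ = \int[P]_w F (phi w)); last first.
  apply: eq_Rintegral => w _; rewrite /F /phi /Y /=; congr f; apply/funext => s.
  by rewrite big_cons [X _ _ * _ + _]addrC addrA.
rewrite -E3 -E2 E1.
have fA := admissible_avg lawexp (a i) fL; have [_ fALip fAm] := fA.
pose g (w : TG) := avg law (a i) f (Y w).
have mg : measurable_fun setT g by exact: fAm.
have ig : P.-integrable setT (EFin \o (g \o idG)).
  apply: (@integrable_dominated _ _ _ _ _ (fun w => `|avg law (a i) f b| + L * W w)).
  - exact: measurableT_comp.
  - move=> w; have := fALip (Y w) b (W w) (W0 w) (YW w).
    have := ler_normD (g w - avg law (a i) f b) (avg law (a i) f b).
    by rewrite subrK /g /=; lra.
  - by apply: integrable_realD; [exact: integrable_cst|exact: integrable_realZ].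
exact: (@Rintegral_distribution _ _ _ _ _ P idG g mg ig).
Qed.

End conditioning.
End transfer.

Section equal_laws.
Context {R : realType} {S : finType}.
Variables (nu1 nu2 : probability R R).
Hypothesis nuE : forall A, measurable A -> nu1 A = nu2 A.

Lemma Rintegral_eq_law (f : R -> R) : \int[nu1]_z f z = \int[nu2]_z f z.
Proof. by congr fine; apply: eq_measure_integral => A mA _; exact: nuE. Qed.

Lemma avg_eq_law (a : S -> R) f : avg nu1 a f = avg nu2 a f.
Proof. by apply/funext => x; exact: Rintegral_eq_law. Qed.

Lemma exp_moments_eq_law : exp_moments nu2 -> exp_moments nu1.
Proof.
move=> H t; have /integrableP[m2 i2] := H t; apply/integrableP; split => //.
by rewrite (eq_measure_integral nu2)// => A mA _; exact: nuE.
Qed.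

End equal_laws.

Section transfer_theorem.
Context {d : measure_display} {T : measurableType d} {R : realType}.
Variable P : probability T R.
Context {I : choiceType}.
Variables (D : set I) (X : I -> {RV P >-> R}).
Hypothesis indep : mutually_independent D X.
Variable nu : I -> probability R R.
Hypothesis nu_law : forall j A, D j -> measurable A -> distribution P (X j) A = nu j A.
Hypothesis nu_exp : forall j, D j -> exp_moments (nu j).

(** Conditioning on one variable at a time turns an expectation over independent disorder into
    iterated averages. *)
Lemma Rintegral_transfer (K : seq I) (L : R) (S : finType) (a : I -> S -> R)
    (f : (S -> R) -> R) (b : S -> R) :
  uniq K -> (forall j, j \in K -> D j) -> admissible L f ->
  \int[P]_w f (fun s => b s + \sum_(j <- K) X j w * a j s) =
  foldr (fun j F => avg (nu j) (a j) F) f K b.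
Proof.
elim: K f => [|i K IH] f uK DK fL /=.
  rewrite -[RHS](Rintegral_probability_cst P); apply: eq_Rintegral => w _.
  by congr f; apply/funext => s; rewrite big_nil addr0.
have Di : D i by apply: DK; exact: mem_head.
have DK' j : j \in K -> D j by move=> jK; apply: DK; rewrite inE jK orbT.
have /andP[_ uK'] := uK.
have eqlaw j (Dj : D j) A (mA : measurable A) := nu_law Dj mA.
rewrite (Rintegral_conditioning indep uK DK a b _ fL); last first.
  by move=> j jK; apply: (exp_moments_eq_law (eqlaw j (DK j jK))); apply: nu_exp; exact: DK.
rewrite (avg_eq_law (eqlaw i Di)).
(* Conditioning leaves the average over X i innermost, while the fold has it outermost. *)
have commute g : admissible L g ->
    foldr (fun j F => avg (nu j) (a j) F) (avg (nu i) (a i) g) K =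
    avg (nu i) (a i) (foldr (fun j F => avg (nu j) (a j) F) g K) /\
    admissible L (foldr (fun j F => avg (nu j) (a j) F) g K).
  move=> gL; elim: K DK' {IH uK DK uK'} => //= j K IHK DK'.
  have Dj : D j by apply: DK'; exact: mem_head.
  have [|-> AL] := IHK; first by move=> k kK; apply: DK'; rewrite inE kK orbT.
  split; last by apply: admissible_avg => //; exact: nu_exp.
  by apply/funext => x; apply: (@avgC _ _ _ _ L) => //; exact: nu_exp.
have [<- _] := commute f fL.
apply: IH => //; apply: admissible_avg => //; exact: nu_exp.
Qed.

End transfer_theorem.

Lemma foldr_avg_map {R : realType} {S : finType} {I J : eqType}
    (nu : I -> probability R R) (nu0 : probability R R) (a : I -> S -> R)
    (e : J -> I) (g : J -> S -> R) (l : seq J) (f : (S -> R) -> R) :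
  (forall x, x \in l -> nu (e x) = nu0) -> (forall x, x \in l -> a (e x) = g x) ->
  foldr (fun j F => avg (nu j) (a j) F) f [seq e x | x <- l] =
  avgs nu0 [seq g x | x <- l] f.
Proof.
elim: l => //= x l IH nul al; rewrite IH; last 2 first.
- by move=> y yl; apply: nul; rewrite inE yl orbT.
- by move=> y yl; apply: al; rewrite inE yl orbT.
by rewrite nul ?mem_head// al ?mem_head.
Qed.

Section disorder_transfer.
Context {d : measure_display} {T : measurableType d} {R : realType}.
Variable P : probability T R.
Variables (beta_ : nat -> R) (h_ : nat -> {RV P >-> R}) (g : seq nat -> {RV P >-> R}).
Variable nu : probability R R.
Hypothesis nuexp : exp_moments nu.
Hypothesis h_law : forall i A, measurable A -> distribution P (h_ i) A = nu A.
Hypothesis g_gaussian : forall s : seq nat, coupling_index s -> standard_gaussian (g s).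
Hypothesis disorder_independent : mutually_independent disorder_index (disorder h_ g).
Local Notation gam := (normal_law (0 : R) 1).
Local Notation gexp := (@normal_law01_exp_moments R).

Definition disorder_law (j : nat + seq nat) : probability R R :=
  if j is inl _ then nu else gam.

Lemma disorder_lawE j A : disorder_index j -> measurable A ->
  distribution P (disorder h_ g j) A = disorder_law j A.
Proof. by case: j => [i|s] /= Dj mA; [exact: h_law|rewrite g_gaussian]. Qed.

Lemma disorder_law_exp j : disorder_index j -> exp_moments (disorder_law j).
Proof. by case: j => [i|s] /= _; [exact: nuexp|exact: gexp]. Qed.

(** The disorder is indexed by natural numbers, for all N at once; the default 0 stands for sites
    outside the system. *)
Definition nat_spin N (s : config N) (n : nat) : R :=
  if insub n is Some i then spin s i else 0.

Lemma nat_spinE N (s : config N) (i : 'I_N) : nat_spin s (val i) = spin s i.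
Proof. by rewrite /nat_spin valK. Qed.

Definition disorder_dir N (j : nat + seq nat) (s : config N) : R :=
  match j with
  | inl n => nat_spin s n
  | inr t => coupling_coef beta_ N (size t)./2 * \prod_(n <- t) nat_spin s n
  end.

Definition tuple_sites N p (t : (2 * p).-tuple 'I_N) : seq nat := [seq val k | k <- t].

Lemma disorder_dir_coupling N p (t : (2 * p).-tuple 'I_N) :
  @disorder_dir N (inr (tuple_sites t)) = coupling_dir beta_ t.
Proof.
apply/funext => s; rewrite /= size_map /coupling_dir big_map.
by congr (_ * _); apply: eq_bigr => k _; rewrite nat_spinE.
Qed.

Definition field_indices N : seq (nat + seq nat) := [seq inl (val i) | i <- enum 'I_N].

Definition coupling_indices N p : seq (nat + seq nat) :=
  [seq inr (tuple_sites t) | t <- enum {: (2 * p).-tuple 'I_N}].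

Definition sk_indices N M : seq (nat + seq nat) :=
  flatten [seq coupling_indices N p | p <- index_iota 1 M.+1].

Lemma coupling_indices_uniq N p : uniq (coupling_indices N p).
Proof.
rewrite map_inj_uniq ?enum_uniq// => t1 t2 [] /(inj_map val_inj).
exact: val_inj.
Qed.

Lemma sk_indices_uniq N M : uniq (sk_indices N M).
Proof.
apply: (@allpairs_uniq_dep _ (fun p => (2 * p).-tuple 'I_N) _
  (fun p t => inr (tuple_sites t)) (index_iota 1 M.+1) (fun p => enum {: (2 * p).-tuple 'I_N})).
- exact: iota_uniq.
- by move=> p _; exact: enum_uniq.
move=> [p t] [q u] _ _ /= [tu].
(* Interactions of different orders have site sequences of different lengths. *)
have pq : p = q.
  have := congr1 size tu; rewrite !size_map !size_tuple => /eqP.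
  by rewrite eqn_pmul2l// => /eqP.
move: t tu; rewrite pq => t /(inj_map val_inj) tu.
by congr Tagged; exact: val_inj.
Qed.

Lemma indices_uniq N M : uniq (field_indices N ++ sk_indices N M).
Proof.
rewrite cat_uniq sk_indices_uniq andbT; apply/andP; split.
  by rewrite map_inj_uniq ?enum_uniq// => i j [] /val_inj.
apply/hasPn => j /flattenP[l /mapP[p _ ->] /mapP[t _ ->]].
by apply/negP => /mapP[].
Qed.

Lemma coupling_indicesP N p j : (0 < p)%N -> j \in coupling_indices N p -> disorder_index j.
Proof.
by move=> p0 /mapP[t _ ->] /=; exists p => //; rewrite size_map size_tuple.
Qed.

Lemma sk_indicesP N M j : j \in field_indices N ++ sk_indices N M -> disorder_index j.
Proof.
rewrite mem_cat => /orP[/mapP[i _ ->]//|/flattenP[l /mapP[p pI ->] jl]].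
by apply: coupling_indicesP jl; move: pI; rewrite mem_index_iota => /andP[].
Qed.

Definition coupling_term N p (s : config N) (w : T) : R :=
  beta_ p / (N%:R `^ (p%:R - 2^-1)) *
     \sum_(i : (2 * p).-tuple 'I_N) g [seq val k | k <- i] w * \prod_(k <- i) spin s k.

Lemma coupling_term_sum N p (s : config N) w : coupling_term p s w =
  \sum_(j <- coupling_indices N p) disorder h_ g j w * disorder_dir j s.
Proof.
rewrite big_map big_enum /= /coupling_term mulr_sumr; apply: eq_bigr => t _.
by rewrite -[coupling_coef _ _ _ * _]/(disorder_dir (inr _) s) disorder_dir_coupling
  coupling_dir_tuple /coupling_coef /spin_prod mulrCA mulrA.
Qed.

Lemma energy_transfer M N (B : config N -> R) :
  \int[P]_w lse (fun s => B s + \sum_(1 <= p < M.+1) coupling_term p s w +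
     \sum_(i < N) h_ i w * spin s i) = trunc_energy nu beta_ M B.
Proof.
have H := Rintegral_transfer disorder_independent disorder_lawE disorder_law_exp
  (@disorder_dir N) B (indices_uniq N M) (@sk_indicesP N M) (admissible_lse (R := R) (config0 N)).
transitivity (\int[P]_w lse (fun s => B s +
   \sum_(j <- field_indices N ++ sk_indices N M) disorder h_ g j w * disorder_dir j s)).
  apply: eq_Rintegral => w _; congr lse; apply/funext => s.
  rewrite -addrA big_cat /=; congr (_ + _); rewrite addrC; congr (_ + _).
    by rewrite big_map big_enum /=; apply: eq_bigr => i _; rewrite nat_spinE.
  rewrite big_flatten big_map /=; apply: eq_bigr => p _.
  by rewrite coupling_term_sum.
rewrite H foldr_cat.
rewrite (foldr_avg_map (nu0 := nu) (g := fun i s => spin s i))//; last first.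
  by move=> i _; apply/funext => s; rewrite /= nat_spinE.
rewrite /trunc_energy; congr (avgs _ _ _ _).
rewrite /sk_indices /sk_dirs; elim: (index_iota _ _) => //= p ps IH.
rewrite avgs_cat foldr_cat IH; apply: foldr_avg_map => // t _.
by rewrite disorder_dir_coupling.
Qed.

End disorder_transfer.

(** * The interaction series *)

Section coupling_supremum.
Context {d : measure_display} {T : measurableType d} {R : realType}.
Variable P : probability T R.
Variables (beta_ : nat -> R) (h_ : nat -> {RV P >-> R}) (g : seq nat -> {RV P >-> R}).
Variable nu : probability R R.
Hypothesis nuexp : exp_moments nu.
Hypothesis h_law : forall i A, measurable A -> distribution P (h_ i) A = nu A.
Hypothesis g_gaussian : forall s : seq nat, coupling_index s -> standard_gaussian (g s).
Hypothesis disorder_independent : mutually_independent disorder_index (disorder h_ g).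
Local Notation gam := (normal_law (0 : R) 1).
Local Notation gexp := (@normal_law01_exp_moments R).
Local Notation term := (coupling_term beta_ g).

Lemma integrable_disorder j : disorder_index j ->
  P.-integrable setT (EFin \o (fun w => `|disorder h_ g j w|)).
Proof.
move=> Dj.
have := exp_moments_eq_law (fun A mA => disorder_lawE h_law g_gaussian Dj mA)
  (disorder_law_exp nuexp Dj).
move=> /integrable_abs /integrable_distribution; apply.
exact: measurableT_comp.
Qed.

Lemma measurable_coupling_term N p (s : config N) :
  measurable_fun setT (fun w => term p s w).
Proof.
apply: measurable_funM => //; apply: measurable_sum => t.
by apply: measurable_funM.
Qed.

Lemma integrable_coupling_term N p (s : config N) : (0 < p)%N ->
  P.-integrable setT (EFin \o (fun w => term p s w)).
Proof.
move=> p0; apply: integrable_realZ.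
have : P.-integrable setT (fun w => \sum_(t : (2 * p).-tuple 'I_N)
    (\prod_(k <- t) spin s k * g [seq val k | k <- t] w)%:E)%E.
  apply: integrable_sum => // t _; apply: integrable_realZ.
  have Dt : disorder_index (inr [seq val k | k <- t] : nat + seq nat).
    by exists p => //; rewrite size_map size_tuple.
  exact: (integrable_dominated _ _ (integrable_disorder Dt)).
apply: eq_integrable => // w _ /=; rewrite sumEFin; congr EFin.
by apply: eq_bigr => t _; rewrite mulrC.
Qed.

(** Attaching a sign to each configuration makes the maximum over pairs equal to the maximum of
    |a|. *)
Definition signed N (a : config N -> R) (se : config N * bool) : R :=
  (if se.2 then 1 else -1) * a se.1.

Lemma sup_norm_signed N (a : config N -> R) : sup_norm (signed a) <= sup_norm a.
Proof.
apply: sup_norm_le; first exact: sup_norm_ge0.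
move=> [s e]; rewrite /signed /= normrM (_ : `|if e then 1 else -1| = 1); last first.
  by case: e; rewrite ?normrN normr1.
by rewrite mul1r; exact: sup_norm_bound.
Qed.

(* A soft maximum of [`|coupling_term p s w|] over [s], at the inverse temperature
   [`|beta_ p|^-1]; it is [0] when [beta_ p = 0]. *)
Definition coupling_sup N p (w : T) : R :=
  `|beta_ p| * lse (fun se => `|beta_ p|^-1 * signed (fun s : config N => term p s w) se).

Lemma coupling_sup_ge N p (s : config N) w : `|term p s w| <= coupling_sup N p w.
Proof.
have [b0|b0] := eqVneq (beta_ p) 0.
  by rewrite /coupling_sup /coupling_term b0 !mul0r normr0 mul0r.
have b0' : 0 < `|beta_ p| by rewrite normr_gt0.
rewrite /coupling_sup -ler_pdivrMl//.
have [t0|t0] := leP 0 (term p s w).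
  rewrite (ger0_norm t0).
  have := le_lse (s, true) (fun se => `|beta_ p|^-1 * signed (fun s : config N => term p s w) se) (s, true).
  by rewrite /signed /= mul1r.
rewrite (ltr0_norm t0).
have := le_lse (s, true) (fun se => `|beta_ p|^-1 * signed (fun s : config N => term p s w) se) (s, false).
by rewrite /signed /= mulN1r.
Qed.

Lemma coupling_sup_ge0 N p w : 0 <= coupling_sup N p w.
Proof. by apply: le_trans (coupling_sup_ge p (config0 N) w). Qed.

Lemma measurable_coupling_sup N p : measurable_fun setT (coupling_sup N p).
Proof.
apply: measurable_funM => //; apply: measurable_lse => -[s e].
do 2 (apply: measurable_funM => //); exact: measurable_coupling_term.
Qed.

Lemma integrable_coupling_sup N p : (0 < p)%N ->
  P.-integrable setT (EFin \o coupling_sup N p).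
Proof.
move=> p0; have [b0|b0] := eqVneq (beta_ p) 0.
  rewrite (_ : coupling_sup N p = fun=> 0); first exact: integrable_cst.
  by apply/funext => w; rewrite /coupling_sup b0 normr0 mul0r.
have b0' : 0 < `|beta_ p| by rewrite normr_gt0.
pose M w := \sum_(s : config N) `|term p s w|.
have iM : P.-integrable setT (EFin \o M).
  have : P.-integrable setT (fun w => \sum_(s : config N) (`|term p s w|)%:E)%E.
    apply: integrable_sum => // s _; apply: integrable_norm; exact: integrable_coupling_term.
  by apply: eq_integrable => // w _ /=; rewrite sumEFin.
apply: (@integrable_dominated _ _ _ _ _
  (fun w => `|beta_ p| * ln #|{: config N * bool}|%:R + M w)).
- exact: measurable_coupling_sup.
- move=> w; rewrite ger0_norm ?coupling_sup_ge0// -[M w](mulVKf (_ : `|beta_ p| != 0)) ?gt_eqF//.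
  rewrite -mulrDr ler_pM2l//; apply: (lse_le_card (config0 N, true)) => -[s e].
  rewrite ler_pM2l ?invr_gt0//; apply: le_trans (ler_norm _) _.
  rewrite /signed /= normrM (_ : `|if e then 1 else -1| = 1); last first.
    by case: e; rewrite ?normrN normr1.
  by rewrite mul1r /M (bigD1 s)//= lerDl sumr_ge0.
- by apply: integrable_realD => //; exact: integrable_cst.
Qed.

Definition coupling_sup_cst : R := 2 * ln 2 + softmax_cst gam.

(** At theta = 1 / |beta_p| the entropy term, ln (2^(N+1)) / theta, and the averaging cost, of order
    theta beta_p^2 N, are both of order N |beta_p|; the norms of the directions are at most
    |beta_p|, as theta requires. *)
Lemma Rintegral_coupling_sup N p : (0 < N)%N -> (0 < p)%N ->
  \int[P]_w coupling_sup N p w <= coupling_sup_cst * N%:R * `|beta_ p|.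
Proof.
move=> N0 p0; have [b0|b0] := eqVneq (beta_ p) 0.
  rewrite /coupling_sup b0 normr0 mulr0; under eq_Rintegral do rewrite mul0r.
  by rewrite Rintegral_probability_cst.
have b0' : 0 < `|beta_ p| by rewrite normr_gt0.
pose theta := `|beta_ p|^-1.
have t0 : 0 < theta by rewrite invr_gt0.
have c0 := (config0 N, true).
pose dir j := signed (@disorder_dir _ beta_ N j).
have fA := admissible_smax c0 t0 (@admissible_coord R (config N * bool)%type).
have Dp j : j \in coupling_indices N p -> disorder_index j by exact: coupling_indicesP.
have H := Rintegral_transfer disorder_independent (disorder_lawE h_law g_gaussian)
  (disorder_law_exp nuexp) dir (fun=> 0) (coupling_indices_uniq N p) Dp fA.
rewrite [leLHS](_ : _ = \int[P]_w smax theta (@coord R (config N * bool)%type)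
  (fun s => 0 + \sum_(j <- coupling_indices N p) disorder h_ g j w * dir j s)); last first.
  apply: eq_Rintegral => w _; rewrite /smax /coupling_sup invrK; congr (_ * _).
  congr lse; apply/funext => se; rewrite /coord add0r /signed; congr (_ * _).
  rewrite (coupling_term_sum _ h_) mulr_sumr; apply: eq_bigr => j _.
  by rewrite /dir /signed mulrCA.
rewrite H.
have dirE : forall t, t \in enum {: (2 * p).-tuple 'I_N} ->
    dir (inr (tuple_sites t)) = signed (coupling_dir beta_ t).
  by move=> t _; rewrite /dir disorder_dir_coupling.
rewrite (foldr_avg_map (nu0 := gam) (g := fun t => signed (coupling_dir beta_ (tval t))) _ _ dirE)//.
set l := map _ _.
have lE : l = [seq signed a | a <- coupling_dirs beta_ N p] by rewrite -map_comp.
have lt : all (fun a => theta * sup_norm a <= 1) l.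
  rewrite lE all_map; apply: sub_all (coupling_dirs_norm beta_ N0 p0) => a /= ab.
  by rewrite ler_pdivrMl// mulr1 (le_trans (sup_norm_signed _)).
apply: le_trans (avgs_smax_coord_le c0 _ t0 lt) _.
have l2 : \sum_(a <- l) sup_norm a ^+ 2 <= beta_ p ^+ 2 * N%:R.
  apply: le_trans (coupling_dirs_norm_sum beta_ N0 p0); rewrite lE big_map.
  by apply: ler_sum => a _; rewrite lerXn2r ?nnegrE ?sup_norm_ge0// sup_norm_signed.
have s0 : smax theta (@coord R (config N * bool)%type) (fun=> 0) <=
    theta^-1 * ln #|{: config N * bool}|%:R + 0.
  by apply: (smax_le c0).
rewrite addr0 card_prod card_bool natrM lnM ?posrE ?ltr0n// in s0; last first.
  by apply/card_gt0P; exists (config0 N).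
rewrite ln_card_config /theta invrK in s0.
have N1 : (1 : R) <= N%:R by rewrite ler1n.
have ln20 : 0 <= ln 2 :> R by rewrite ln_ge0// ler1n.
have s0' : `|beta_ p| * (N%:R * ln 2 + ln 2) <= `|beta_ p| * (2 * ln 2 * N%:R).
  by rewrite ler_pM2l//; nra.
have C0 := softmax_cst_ge0 gam.
have l2' : softmax_cst gam * theta * \sum_(a <- l) sup_norm a ^+ 2 <=
   softmax_cst gam * theta * (beta_ p ^+ 2 * N%:R).
  by rewrite ler_wpM2l// mulr_ge0// ltW.
have E : softmax_cst gam * theta * (beta_ p ^+ 2 * N%:R) = softmax_cst gam * N%:R * `|beta_ p|.
  by rewrite /theta -[beta_ p ^+ 2]real_normK ?num_real//; field; rewrite gt_eqF.
rewrite E in l2'; rewrite /coupling_sup_cst; lra.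
Qed.

End coupling_supremum.

Section measurable_limit.
Context {d : measure_display} {T : measurableType d} {R : realType}.

(** The convergence set is measurable by Cauchy's criterion; outside it [limn] takes the constant
    default value [point]. This covers [H_SK], which is a [limn] at every sample point. *)
Lemma measurable_limn (u : nat -> T -> R) : (forall n, measurable_fun setT (u n)) ->
  measurable_fun setT (fun w => limn (u^~ w)).
Proof.
move=> mu.
pose A := \bigcap_(k : nat) \bigcup_(n : nat) \bigcap_(m : nat)
  [set w | `|u (n + m)%N w - u n w| <= k.+1%:R^-1].
have mA : measurable A.
  apply: bigcapT_measurable => k; apply: bigcupT_measurable => n.
  apply: bigcapT_measurable => m.
  have mD : measurable_fun setT (fun w => `|u (n + m)%N w - u n w|).
    by apply: measurableT_comp => //; exact: measurable_funB.
  rewrite (_ : [set w | _] = setT `&` (fun w => `|u (n + m)%N w - u n w|) @^-1`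
      [set` `]-oo, k.+1%:R^-1 : R]]); first exact: (mD measurableT _ (measurable_itv _)).
  apply/seteqP; split => w /=; rewrite in_itv/=; first by [].
  by case.
have AP w : A w <-> cvgn (u^~ w).
  split => [Aw|/cvg_ex[l /cvgrPdist_le cu] k _].
    apply/cauchy_cvgP/cauchy_exP => e e0.
    have [k ke] : exists k : nat, k.+1%:R^-1 < e.
      by have [k] := ltr_add_invr e0; rewrite add0r => ?; exists k.
    have [n _ An] := Aw k I; exists (u n w).
    exists n => // m /= nm; rewrite -ball_normE /= distrC.
    apply: le_lt_trans ke.
    by have := An (m - n)%N I; rewrite /= subnKC.
  have e0 : 0 < k.+1%:R^-1 / 2 :> R by rewrite divr_gt0.
  have [n _ cn] := cu _ e0; exists n => // m _ /=.
  have h1 := cn _ (leqnn n); have h2 := cn _ (leq_addr m n).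
  rewrite (_ : _ - _ = (l - u n w) - (l - u (n + m)%N w)); last by ring.
  by rewrite (le_trans (ler_normB _ _))// [leRHS]splitr lerD.
have mA' : measurable (~` A) by exact: measurableC.
rewrite -(setvU A); apply/measurable_funU => //; split.
  apply: (eq_measurable_fun (cst (point : R))); last exact: measurable_cst.
  move=> w; rewrite inE => Aw /=; apply/esym/dvgP.
  by move=> /AP.
apply: (@measurable_fun_cvg _ _ _ _ u).
  by move=> m; exact: measurable_funTS.
by move=> w /AP.
Qed.
End measurable_limit.

(** * Summability of the couplings and removal of the truncation *)

Section summability.
Context {R : realType}.
Variable beta_ : nat -> R.
Hypothesis beta_summable :
     (\sum_(1 <= p <oo) (2 ^+ p * beta_ p ^+ 2)%:E < +oo)%E.

Lemma sum_half_pow n : \sum_(1 <= p < n) (2^-1 : R) ^+ p <= 1.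
Proof.
case: n => [|n]; first by rewrite big_geq.
suff -> : \sum_(1 <= p < n.+1) (2^-1 : R) ^+ p = 1 - 2^-1 ^+ n.
  by rewrite gerBl exprn_ge0.
elim: n => [|n IH]; first by rewrite big_geq// expr0 subrr.
by rewrite big_nat_recr//= IH exprS; field.
Qed.

(** From |b| <= 2^p b^2 + 2^-p, both terms being summable over p >= 1; the value at p = 0 is added
    separately. *)
Lemma coupling_l1_summable : (\sum_(0 <= p <oo) (`|beta_ p|)%:E < +oo)%E.
Proof.
have Slty := beta_summable; set S := (\sum_(1 <= p <oo) _)%E in Slty.
have S0 : (0 <= S)%E.
  by apply: nneseries_ge0 => p _ _; rewrite lee_fin mulr_ge0 ?sqr_ge0 ?exprn_ge0.
have Sfin : S = (fine S)%:E by rewrite fineK// ge0_fin_numE.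
have partial n : \sum_(1 <= p < n) 2 ^+ p * beta_ p ^+ 2 <= fine S.
  rewrite -lee_fin -Sfin -sumEFin; apply: nneseries_lim_ge => p _ _.
  by rewrite lee_fin mulr_ge0 ?sqr_ge0 ?exprn_ge0.
have amgm p : `|beta_ p| <= 2 ^+ p * beta_ p ^+ 2 + 2^-1 ^+ p.
  have p0 : 0 < (2 : R) ^+ p by rewrite exprn_gt0.
  rewrite exprVn -(ler_pM2r p0) mulrDl mulVf ?gt_eqF//.
  rewrite -[beta_ p ^+ 2]real_normK ?num_real//.
  set b := `|beta_ p|; have := sqr_ge0 (2 ^+ p * b - 1); have := normr_ge0 (beta_ p).
  rewrite -/b; set q := 2 ^+ p in p0 *; nra.
apply: (@le_lt_trans _ _ (`|beta_ 0%N| + fine S + 1)%:E); last exact: ltry.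
apply: lime_le; first by apply: is_cvg_nneseries => n _ _.
apply: nearW => n; rewrite sumEFin lee_fin.
case: n => [|n]; first by rewrite big_geq// !addr_ge0 ?fine_ge0.
rewrite big_ltn// -addrA lerD2l.
apply: (@le_trans _ _ (\sum_(1 <= p < n.+1) (2 ^+ p * beta_ p ^+ 2 + 2^-1 ^+ p))).
  by apply: ler_sum => p _; exact: amgm.
by rewrite big_split/= lerD// sum_half_pow.
Qed.

Definition coupling_tail (M : nat) : R := fine (\sum_(M.+1 <= p <oo) (`|beta_ p|)%:E)%E.

Lemma coupling_tail_cvg : coupling_tail M @[M --> \oo] --> 0.
Proof.
have h : (\sum_(M <= p <oo) (`|beta_ p|)%:E)%E @[M --> \oo] --> 0%:E.
  exact: nneseries_tail_cvg coupling_l1_summable (fun k _ => normr_ge0 _).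
have := fine_cvg h; rewrite -cvg_shiftS.
exact.
Qed.

Lemma coupling_tailE M :
  (\sum_(M.+1 <= p <oo) (`|beta_ p|)%:E)%E = (coupling_tail M)%:E.
Proof.
rewrite /coupling_tail fineK// ge0_fin_numE; last first.
  by apply: nneseries_ge0 => p _ _.
apply: le_lt_trans coupling_l1_summable.
rewrite [leRHS](@nneseries_split _ _ 0 M.+1) ?add0n; last by move=> p _; rewrite lee_fin.
by rewrite leeDr// sume_ge0// => p _; rewrite lee_fin.
Qed.

End summability.

Section full_energy.
Context {d : measure_display} {T : measurableType d} {R : realType}.
Variable P : probability T R.
Variables (beta_ : nat -> R) (h_ : nat -> {RV P >-> R}) (g : seq nat -> {RV P >-> R}).
Hypothesis beta_summable :
     (\sum_(1 <= p <oo) (2 ^+ p * beta_ p ^+ 2)%:E < +oo)%E.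
Variable nu : probability R R.
Hypothesis nuexp : exp_moments nu.
Hypothesis h_law : forall i A, measurable A -> distribution P (h_ i) A = nu A.
Hypothesis g_gaussian : forall s : seq nat, coupling_index s -> standard_gaussian (g s).
Hypothesis disorder_independent : mutually_independent disorder_index (disorder h_ g).
Variable N : nat.
Hypothesis N0 : (0 < N)%N.
Local Notation term := (coupling_term beta_ g).
Local Notation csup := (coupling_sup beta_ g N).
Local Notation cst := (@coupling_sup_cst R).

Let csup0 p w : 0 <= csup p w. Proof. exact: coupling_sup_ge0. Qed.

(** Dominates the interactions of order above 2 M for all configurations at once. It is
    extended-real because the sum may be infinite on a null set. *)
Definition sup_tail (M : nat) (w : T) : \bar R :=
  (\sum_(M.+1 <= p <oo) (csup p w)%:E)%E.

Lemma sup_tailE M w :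
  sup_tail M w = (\sum_(0 <= p <oo) (csup (p + M.+1) w)%:E)%E.
Proof. by rewrite /sup_tail -nneseries_addn// => p; rewrite lee_fin. Qed.

Lemma sup_tail_ge0 M w : (0 <= sup_tail M w)%E.
Proof. by apply: nneseries_ge0 => p _ _; rewrite lee_fin. Qed.

Lemma measurable_sup_tail M : measurable_fun setT (sup_tail M).
Proof.
rewrite (_ : sup_tail M = fun w => (\sum_(0 <= p <oo) (csup (p + M.+1) w)%:E)%E); last first.
  by apply/funext => w; exact: sup_tailE.
apply: ge0_emeasurable_sum => [p w _ _|p _]; first by rewrite lee_fin.
by apply/measurable_EFinP; exact: measurable_coupling_sup.
Qed.

Lemma coupling_sup_cst_ge0 : 0 <= cst.
Proof.
by rewrite addr_ge0 ?softmax_cst_ge0// mulr_ge0// ln_ge0// ler1n.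
Qed.

Lemma integral_sup_tail M :
  (\int[P]_w sup_tail M w <= (cst * N%:R * coupling_tail beta_ M)%:E)%E.
Proof.
under eq_integral do rewrite sup_tailE.
rewrite integral_nneseries//; last 2 first.
- by move=> p; apply/measurable_EFinP; exact: measurable_coupling_sup.
- by move=> p w _; rewrite lee_fin.
rewrite EFinM -(coupling_tailE beta_summable) -nneseriesZl; last by move=> p _; rewrite lee_fin.
rewrite -[leRHS]nneseries_addn; last first.
  by move=> p; rewrite mule_ge0 ?lee_fin// mulr_ge0 ?ler0n// coupling_sup_cst_ge0.
apply: lee_nneseries => p _.
  by move=> _; apply: integral_ge0 => w _; rewrite lee_fin.
have p0 : (0 < p + M.+1)%N by rewrite addnS.
have ip := integrable_coupling_sup beta_ nuexp h_law g_gaussian N p0.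
rewrite -EFinM -[leLHS]fineK; last exact: integrable_fin_num.
by rewrite lee_fin; exact: (Rintegral_coupling_sup beta_ nuexp h_law g_gaussian disorder_independent).
Qed.

Lemma sup_tail_fin_ae : {ae P, forall w, (sup_tail 0 w < +oo)%E}.
Proof.
have i0 : P.-integrable setT (sup_tail 0).
  apply/integrableP; split; first exact: measurable_sup_tail.
  under eq_integral do rewrite gee0_abs ?sup_tail_ge0//.
  by apply: le_lt_trans (integral_sup_tail 0) _; rewrite ltry.
have := integrable_ae measurableT i0.
by apply: filterS => w /(_ I); rewrite ge0_fin_numE ?sup_tail_ge0.
Qed.

Lemma sup_tail_le0 M w : (sup_tail M w <= sup_tail 0 w)%E.
Proof.
rewrite [leRHS](@nneseries_split _ _ 1 M) ?add1n; last by move=> p _; rewrite lee_fin.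
by rewrite leeDr// sume_ge0// => p _; rewrite lee_fin.
Qed.

(** At a sample point where the suprema are summable the interaction series converges absolutely,
    and its tail is bounded by theirs. *)
Lemma H_SK_tail M (s : config N) w : (sup_tail 0 w < +oo)%E ->
  `|H_SK g beta_ s w - \sum_(1 <= p < M.+1) term p s w| <= fine (sup_tail M w).
Proof.
move=> fin0.
pose S n := \sum_(1 <= p < n) term p s w.
have finE k : sup_tail k w = (fine (sup_tail k w))%:E.
  by rewrite fineK// ge0_fin_numE ?sup_tail_ge0// (le_lt_trans (sup_tail_le0 _ _)).
have diff k n : (k.+1 <= n)%N -> `|S n - S k.+1| <= fine (sup_tail k w).
  move=> kn; rewrite /S (big_cat_nat (n := k.+1))//= addrAC subrr add0r.
  rewrite -lee_fin -finE.
  apply: (@le_trans _ _ (\sum_(k.+1 <= p < n) (csup p w)%:E)%E).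
    rewrite sumEFin lee_fin (le_trans (ler_norm_sum _ _ _))//.
    by apply: ler_sum => p _; exact: coupling_sup_ge.
  by apply: nneseries_lim_ge => p _ _; rewrite lee_fin.
have cS : cvgn S.
  apply/cauchy_cvgP/cauchy_exP => e e0.
  have tc : fine (sup_tail k w) @[k --> \oo] --> 0.
    have tot : (\sum_(0 <= p <oo) (csup p w)%:E < +oo)%E.
      rewrite (@nneseries_split _ _ 0 1) ?add0n; last by move=> p _; rewrite lee_fin.
      by rewrite big_nat1 lte_add_pinfty// ltry.
    have h : (\sum_(k <= p <oo) (csup p w)%:E)%E @[k --> \oo] --> 0%:E.
      by apply: nneseries_tail_cvg tot _ => p _; rewrite lee_fin.
    by have := fine_cvg h; rewrite -cvg_shiftS; exact.
  have e20 : 0 < e / 2 by rewrite divr_gt0.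
  move/cvgrPdist_lt : tc => /(_ _ e0)[k _ /(_ _ (leqnn k))] ke.
  rewrite sub0r normrN ger0_norm ?fine_ge0 ?sup_tail_ge0// in ke.
  exists (S k.+1); exists k.+1 => // n /= kn; rewrite -ball_normE /= distrC.
  by apply: le_lt_trans ke; exact: diff.
rewrite /H_SK -/(coupling_term beta_ g _ s w).
have -> : \big[+%R/0]_(1 <= p <oo) term p s w = limn S by [].
apply/ler_addgt0Pr => e e0.
(* The index is beyond both the convergence threshold and the truncation. *)
have [n _ /(_ (maxn n M.+1) (leq_maxl _ _)) ln] := (cvgrPdist_le _ _).1 cS _ e0.
rewrite (_ : _ - _ = (limn S - S (maxn n M.+1)) + (S (maxn n M.+1) - S M.+1)); last by rewrite /S; ring.
rewrite (le_trans (ler_normD _ _))// addrC lerD//; apply: diff; exact: leq_maxr.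
Qed.

Variable B : config N -> R.

Definition field_energy (s : config N) (w : T) : R := \sum_(i < N) h_ i w * spin s i.

Definition log_partition (w : T) : R :=
  lse (fun s => B s + H_SK g beta_ s w + field_energy s w).

Definition trunc_log_partition M (w : T) : R :=
  lse (fun s => B s + \sum_(1 <= p < M.+1) term p s w + field_energy s w).

Lemma measurable_field_energy s : measurable_fun setT (field_energy s).
Proof. by apply: measurable_sum => i; exact: measurable_funM. Qed.

Lemma measurable_log_partition : measurable_fun setT log_partition.
Proof.
apply: measurable_lse => s; apply: measurable_funD; last exact: measurable_field_energy.
apply: measurable_funD => //; apply: measurable_limn => n.
by apply: measurable_sum => p; exact: measurable_coupling_term.
Qed.

Lemma measurable_trunc_log_partition M : measurable_fun setT (trunc_log_partition M).
Proof.
apply: measurable_lse => s; apply: measurable_funD; last exact: measurable_field_energy.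
apply: measurable_funD => //.
by apply: measurable_sum => p; exact: measurable_coupling_term.
Qed.

Lemma integrable_trunc_log_partition M :
  P.-integrable setT (EFin \o trunc_log_partition M).
Proof.
pose b := lse B.
have iC : P.-integrable setT (EFin \o (fun w => \sum_(i < M) csup i.+1 w)).
  have : P.-integrable setT (fun w => \sum_(i < M) (csup i.+1 w)%:E)%E.
    by apply: integrable_sum => // i _; exact: (integrable_coupling_sup beta_ nuexp h_law g_gaussian).
  by apply: eq_integrable => // w _ /=; rewrite sumEFin.
have iH : P.-integrable setT (EFin \o (fun w => \sum_(i < N) `|h_ i w|)).
  have : P.-integrable setT (fun w => \sum_(i < N) (`|h_ i w|)%:E)%E.
    apply: integrable_sum => // i _.
    exact: (integrable_disorder nuexp h_law g_gaussian (j := inl (val i))).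
  by apply: eq_integrable => // w _ /=; rewrite sumEFin.
apply: (@integrable_dominated _ _ _ _ _
  (fun w => `|b| + (\sum_(i < M) csup i.+1 w + \sum_(i < N) `|h_ i w|))).
- exact: measurable_trunc_log_partition.
- move=> w.
  have : `|trunc_log_partition M w - b| <= \sum_(i < M) csup i.+1 w + \sum_(i < N) `|h_ i w|.
    apply: (lse_lipschitz (config0 N)) => s.
    rewrite [X in `|X|](_ : _ = \sum_(1 <= p < M.+1) term p s w + field_energy s w); last by ring.
    rewrite (le_trans (ler_normD _ _))// lerD// (le_trans (ler_norm_sum _ _ _))//.
      rewrite big_add1 /= big_mkord; apply: ler_sum => i _; exact: coupling_sup_ge.
    by apply: ler_sum => i _; rewrite normrM normr_spin mulr1.
  have := ler_normD (trunc_log_partition M w - b) b; rewrite subrK; lra.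
- by apply: integrable_realD; [exact: integrable_cst|exact: integrable_realD].
Qed.

Lemma integrable_fine_sup_tail M : P.-integrable setT (EFin \o (fine \o sup_tail M)) /\
  \int[P]_w fine (sup_tail M w) <= cst * N%:R * coupling_tail beta_ M.
Proof.
have mt : measurable_fun setT (fine \o sup_tail M).
  by apply: measurableT_comp => //; exact: measurable_sup_tail.
have f0 w : 0 <= fine (sup_tail M w) by rewrite fine_ge0 ?sup_tail_ge0.
have le : (\int[P]_w (fine (sup_tail M w))%:E <= (cst * N%:R * coupling_tail beta_ M)%:E)%E.
  apply: le_trans (integral_sup_tail M); apply: ge0_le_integral => //.
  - by move=> w _; rewrite lee_fin.
  - exact/measurable_EFinP.
  - exact: measurable_sup_tail.
  - by move=> w _; move: (sup_tail_ge0 M w); case: (sup_tail M w) => [r|_|] //=; rewrite leey.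
have i : P.-integrable setT (EFin \o (fine \o sup_tail M)).
  apply/integrableP; split; first exact/measurable_EFinP.
  under eq_integral do rewrite /= ger0_norm//.
  by apply: le_lt_trans le _; rewrite ltry.
split => //; rewrite -lee_fin fineK//; exact: integrable_fin_num i.
Qed.

(** [lse] is 1-Lipschitz, so the error is at most the expected tail: linear in N, vanishing with M
    after division by N, and the same for every [B]. *)
Lemma log_partition_approx M :
  `|\int[P]_w log_partition w - trunc_energy nu beta_ M B| <=
  cst * N%:R * coupling_tail beta_ M.
Proof.
have [iT leT] := integrable_fine_sup_tail M.
have mL := measurable_log_partition; have mLM := measurable_trunc_log_partition M.
have iLM := integrable_trunc_log_partition M.
(* Off the null set where [sup_tail 0] is infinite, [H_SK] is only a junk limit. *)
pose L' w := if (sup_tail 0 w < +oo)%E then log_partition w else trunc_log_partition M w.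
have mL' : measurable_fun setT L'.
  apply: measurable_fun_ifT => //; apply: measurable_fun_lte => //.
  exact: measurable_sup_tail.
have L'd w : `|L' w - trunc_log_partition M w| <= fine (sup_tail M w).
  rewrite /L'; case: ifPn => [good|_]; last first.
    by rewrite subrr normr0 fine_ge0 ?sup_tail_ge0.
  apply: (lse_lipschitz (config0 N)) => s.
  rewrite [X in `|X|](_ : _ = H_SK g beta_ s w - \sum_(1 <= p < M.+1) term p s w); last by ring.
  exact: H_SK_tail.
have iL' : P.-integrable setT (EFin \o L').
  apply: (@integrable_dominated _ _ _ _ _
    (fun w => `|trunc_log_partition M w| + fine (sup_tail M w))) => //.
    move=> w; have := ler_normD (L' w - trunc_log_partition M w) (trunc_log_partition M w).
    by rewrite subrK; have := L'd w; lra.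
  by apply: integrable_realD => //; exact: integrable_norm.
rewrite (_ : \int[P]_w log_partition w = \int[P]_w L' w); last first.
  congr fine; apply: ae_eq_integral => //.
  - exact/measurable_EFinP.
  - exact/measurable_EFinP.
  have := sup_tail_fin_ae; apply: filterS => w good _.
  by rewrite /L' good.
rewrite -(energy_transfer beta_ nuexp h_law g_gaussian disorder_independent).
apply: le_trans leT; exact: (Rintegral_dist_le iL' iLM iT).
Qed.

End full_energy.

(** * The thermodynamic limit *)

Section limits.
Context {d : measure_display} {T : measurableType d} {R : realType}.
Variable P : probability T R.
Variables (beta_ : nat -> R) (h_ : nat -> {RV P >-> R}) (g : seq nat -> {RV P >-> R}).
Hypothesis beta_summable :
     (\sum_(1 <= p <oo) (2 ^+ p * beta_ p ^+ 2)%:E < +oo)%E.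
Variable nu : probability R R.
Hypothesis nuexp : exp_moments nu.
Hypothesis h_law : forall i A, measurable A -> distribution P (h_ i) A = nu A.
Hypothesis g_gaussian : forall s : seq nat, coupling_index s -> standard_gaussian (g s).
Hypothesis disorder_independent : mutually_independent disorder_index (disorder h_ g).

Definition base_energy (beta x : R) N : config N -> R :=
  fun s => beta * N%:R / 2 * magnetization s ^+ 2 + field_base x N s.

Arguments base_energy beta x N : clear implicits.

Lemma base_energy0 x N : base_energy 0 x N = field_base x N.
Proof. by apply/funext => s; rewrite /base_energy !mul0r add0r. Qed.

Lemma F_E (beta x : R) N : F_ P g beta beta_ (fun i w => x + h_ i w) N =
  N%:R^-1 * \int[P]_w log_partition beta_ h_ g (base_energy beta x N) w.
Proof.
rewrite /F_ unlock; congr (_ * _); apply: eq_Rintegral => w _.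
rewrite /Z /log_partition /lse; congr ln; apply: eq_bigr => s _; congr expR.
rewrite /H /base_energy /field_base /field_energy.
rewrite (_ : \sum_(i < N) (x + h_ i w) * spin s i =
  x * (\sum_(i < N) spin s i) + \sum_(i < N) h_ i w * spin s i); first by ring.
by rewrite mulr_sumr -big_split; apply: eq_bigr => i _; rewrite mulrDl.
Qed.

(** [M] comes before beta, x and N, so one truncation serves the ferromagnetic model and all the SK
    models with which it is compared. *)
Lemma F_trunc (e : R) : 0 < e -> exists M, forall (beta x : R) N, (0 < N)%N ->
  `|F_ P g beta beta_ (fun i w => x + h_ i w) N -
    N%:R^-1 * trunc_energy nu beta_ M (base_energy beta x N)| <= e.
Proof.
move=> e0.
have tc := coupling_tail_cvg beta_summable.
have c0 := @coupling_sup_cst_ge0 R.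
have c1 : 0 < @coupling_sup_cst R + 1 by rewrite ltr_wpDl.
have ec : 0 < e / (@coupling_sup_cst R + 1) by rewrite divr_gt0.
move/cvgrPdist_le : tc => /(_ _ ec)[M _ /(_ _ (leqnn M))].
rewrite sub0r normrN => tM; exists M => beta x N N0.
have N0' : (0 : R) < N%:R by rewrite ltr0n.
rewrite F_E -mulrBr normrM gtr0_norm ?invr_gt0// ler_pdivrMl//.
apply: le_trans (log_partition_approx beta_summable nuexp h_law g_gaussian
  disorder_independent N0 _ M) _.
rewrite mulrAC [leRHS]mulrC; apply: ler_wpM2r; first exact: ltW.
apply: (@le_trans _ _ ((@coupling_sup_cst R + 1) * (e / (@coupling_sup_cst R + 1)))).
  apply: le_trans (ler_norm _) _; rewrite normrM (ger0_norm c0).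
  by apply: ler_pM => //; rewrite lerDl.
by rewrite mulrC divfK// gt_eqF.
Qed.

Lemma trunc_cvg M x :
  cvgn (fun N => N%:R^-1 * trunc_energy nu beta_ M (field_base x N)).
Proof.
have [C HC] := trunc_energy_linear beta_ M nuexp x.
apply: (fekete (C := C)) => //.
by move=> m n m0 n0; exact: trunc_energy_superadditive.
Qed.

Lemma cvgn_approx (u : nat -> R) :
  (forall e, 0 < e -> exists2 v : nat -> R, cvgn v &
     forall n, (0 < n)%N -> `|u n - v n| <= e) -> cvgn u.
Proof.
move=> H; apply/cauchy_cvgP/cauchy_exP => e e0.
have e40 : 0 < e / 4 by rewrite divr_gt0.
have [v /cvg_ex[l /cvgrPdist_le vl] uv] := H _ e40.
have [n _ vn] := vl _ e40.
exists l; exists n.+1 => // m /= nm; rewrite -ball_normE /=.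
rewrite (_ : l - u m = (l - v m) - (u m - v m)); last by ring.
apply: le_lt_trans (ler_normB _ _) _.
have h1 := vn m (ltnW nm); have h2 := uv m (leq_trans (ltn0Sn _) nm); rewrite /= in h1.
lra.
Qed.

Lemma SK_cvg x : cvgn (F_ P g 0 beta_ (fun i w => x + h_ i w)).
Proof.
apply: cvgn_approx => e e0; have [M HM] := F_trunc e0.
exists (fun N => N%:R^-1 * trunc_energy nu beta_ M (field_base x N)); first exact: trunc_cvg.
by move=> n n0; rewrite -base_energy0; exact: HM.
Qed.

Definition SK_limit (x : R) : R := F_SK P g beta_ (fun i w => x + h_ i w).

Lemma SK_limitP x : F_ P g 0 beta_ (fun i w => x + h_ i w) N @[N --> \oo] --> SK_limit x.
Proof. exact: SK_cvg. Qed.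

Lemma normr_sum_spin N (s : config N) : `|\sum_(i < N) spin s i| <= N%:R :> R.
Proof.
rewrite (le_trans (ler_norm_sum _ _ _))//; under eq_bigr do rewrite normr_spin.
by rewrite sumr_const card_ord.
Qed.

(** Replacing x by y changes each energy by at most |x - y| N. The comparison is made in the
    truncated model, and the slack [e] pays for the truncation. *)
Lemma F_lipschitz (e x y : R) N : 0 < e -> (0 < N)%N ->
  F_ P g 0 beta_ (fun i w => x + h_ i w) N <=
  F_ P g 0 beta_ (fun i w => y + h_ i w) N + `|x - y| + e.
Proof.
move=> e0 N0; have e20 : 0 < e / 2 by rewrite divr_gt0.
have [M HM] := F_trunc e20; have := HM 0 x N N0; have := HM 0 y N N0.
rewrite !base_energy0 !ler_norml => /andP[h1 h1'] /andP[h2 h2'].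
have N0' : (0 : R) < N%:R by rewrite ltr0n.
have : trunc_energy nu beta_ M (field_base x N) <=
    trunc_energy nu beta_ M (field_base y N) + `|x - y| * N%:R.
  apply: trunc_energy_mono => // s; rewrite -lerBlDl /field_base -mulrBl.
  by rewrite (le_trans (ler_norm _))// normrM ler_wpM2l// normr_sum_spin.
rewrite -(ler_pM2l (_ : 0 < N%:R^-1)) ?invr_gt0// mulrDr [_ * (`|x - y| * _)]mulrC mulfK ?gt_eqF//.
lra.
Qed.

(** Gives continuity of the variational functional, and thereby a maximum that is attained. *)
Lemma SK_limit_lipschitz (x y : R) : `|SK_limit x - SK_limit y| <= `|x - y|.
Proof.
have main u v : SK_limit u <= SK_limit v + `|u - v|.
  apply/ler_addgt0Pr => /= e e0.
  have e30 : 0 < e / 3 by rewrite divr_gt0.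
  have /cvgrPdist_le/(_ _ e30)[n _ un] := @SK_limitP u.
  have /cvgrPdist_le/(_ _ e30)[m _ vm] := @SK_limitP v.
  pose N := (maxn (maxn n m) 1)%N.
  have nN : (n <= N)%N by rewrite !leq_max leqnn.
  have mN : (m <= N)%N by rewrite !leq_max leqnn orbT.
  have N0 : (0 < N)%N by rewrite leq_max leqnn orbT.
  have := un N nN; have := vm N mN; have := F_lipschitz u v e30 N0.
  move: (SK_limit u) (SK_limit v) => a b.
  by rewrite /= !ler_norml => ? /andP[? ?] /andP[? ?]; lra.
rewrite ler_norml; apply/andP; split.
  by have := main y x; rewrite distrC; move: (SK_limit x) (SK_limit y) => a b; lra.
by have := main x y; move: (SK_limit x) (SK_limit y) => a b; lra.
Qed.

Section ferromagnetic.
Variable beta : R.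
Hypothesis beta_ge0 : 0 <= beta.

Definition variational (mu : R) : R := SK_limit (beta * mu) - beta * mu ^+ 2 / 2.

Lemma continuous_variational : continuous variational.
Proof.
move=> x; apply: cvgB.
  have cSK : continuous SK_limit.
    apply: (@lipschitzR_continuous _ 1) => u v; rewrite mul1r; exact: SK_limit_lipschitz.
  apply: (@continuous_comp _ _ _ (fun mu => beta * mu) SK_limit); last exact: cSK.
  by apply: cvgM; [exact: cvg_cst|exact: cvg_id].
apply: cvgM; last exact: cvg_cst.
by apply: cvgM; [exact: cvg_cst|exact: sqr_continuous].
Qed.

Lemma magnetization_bound N (s : config N) : (0 < N)%N -> -1 <= (magnetization s : R) <= 1.
Proof.
move=> N0; rewrite -ler_norml /magnetization normrM ger0_norm ?invr_ge0//.
by rewrite ler_pdivrMl ?ltr0n// mulr1 normr_sum_spin.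
Qed.

Lemma field_base_magnetization (x : R) N (s : config N) : (0 < N)%N ->
  field_base x N s = x * N%:R * magnetization s.
Proof.
by move=> N0; rewrite /field_base /magnetization; field; rewrite gt_eqF// ltr0n.
Qed.

Lemma grid_point (n : nat) (m : R) : -1 <= m <= 1 ->
  exists k : 'I_n.+2, `|m - (2 * k%:R / n.+1%:R - 1)| <= 2 / n.+1%:R.
Proof.
move=> /andP[m1 m2].
have n0 : (0 : R) < n.+1%:R by rewrite ltr0n.
(* Position of m in units of the mesh. Its integer part can reach n + 1, at m = 1, whence n + 2 grid
   points. *)
pose t : R := (m + 1) / 2 * n.+1%:R.
have t0 : 0 <= t by rewrite mulr_ge0// divr_ge0//; lra.
have tn : t <= n.+1%:R by rewrite ler_piMl// ler_pdivrMr//; lra.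
have kt : (Num.truncn t)%:R <= t by rewrite truncn_le.
have tk : t < (Num.truncn t).+1%:R by exact: truncnS_gt.
have kn : (Num.truncn t < n.+2)%N.
  by rewrite ltnS -(ler_nat R) (le_trans kt).
exists (Ordinal kn) => /=; set k := (Num.truncn t)%:R in kt *.
have mE : m = 2 * t / n.+1%:R - 1 by rewrite /t; field; rewrite gt_eqF.
rewrite mE (_ : _ - _ = 2 * (t - k) / n.+1%:R); last by ring.
rewrite ger0_norm; last by rewrite divr_ge0 ?mulr_ge0 ?subr_ge0.
rewrite ler_wpM2r ?invr_ge0// ler_piMr//.
by rewrite -natr1 -/k in tk; lra.
Qed.

Lemma F_lower (mu e : R) : 0 < e ->
  \forall N \near \oo, variational mu - e <= F_ P g beta beta_ (fun i w => 0 + h_ i w) N.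
Proof.
move=> e0; have e30 : 0 < e / 3 by rewrite divr_gt0.
have [M HM] := F_trunc e30.
have /cvgrPdist_le/(_ _ e30)[n _ un] := @SK_limitP (beta * mu).
near=> N.
have N0 : (0 < N)%N by near: N; exists 1%N.
have N0' : (0 : R) < N%:R by rewrite ltr0n.
have nN : (n <= N)%N by near: N; exists n.
have := un N nN; have := HM beta 0 N N0; have := HM 0 (beta * mu) N N0.
have : trunc_energy nu beta_ M (field_base (beta * mu) N) <=
    trunc_energy nu beta_ M (base_energy beta 0 N) + beta * mu ^+ 2 / 2 * N%:R.
  apply: trunc_energy_mono => // s.
  rewrite /base_energy !field_base_magnetization// -subr_ge0.
  (* The gap between the two energies is a square; this is where beta >= 0 enters. *)
  rewrite [X in 0 <= X](_ : _ = beta * N%:R / 2 * (magnetization s - mu) ^+ 2); last by field.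
  by rewrite mulr_ge0 ?sqr_ge0// divr_ge0// mulr_ge0.
rewrite -(ler_pM2l (_ : 0 < N%:R^-1)) ?invr_gt0// mulrDr [_ * (beta * _ / 2 * _)]mulrC mulfK ?gt_eqF//.
rewrite base_energy0 /= !ler_norml /variational => ? /andP[? ?] /andP[? ?] /andP[? ?].
lra.
Unshelve. all: by end_near. Qed.

Lemma F_upper (top e : R) : 0 < e ->
  (forall mu, -1 <= mu <= 1 -> variational mu <= top) ->
  \forall N \near \oo, F_ P g beta beta_ (fun i w => 0 + h_ i w) N <= top + e.
Proof.
(* Six errors: truncation of the model itself and of the SK models, convergence of the latter, mesh
   of the grid, its cardinality, and the soft maximum. *)
move=> e0 Htop; have e10 : 0 < e / 6 by rewrite divr_gt0.
set e1 := e / 6 in e10.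
have [M HM] := F_trunc e10.
pose C := softmax_cst (normal_law (0 : R) 1) * coupling_l2 beta_ M + softmax_cst nu.
have l20 : 0 <= coupling_l2 beta_ M by apply: sumr_ge0 => p _; exact: sqr_ge0.
have C0 : 0 <= C by rewrite addr_ge0 ?mulr_ge0 ?softmax_cst_ge0.
have C1 : 0 < C + 1 by rewrite ltr_wpDl.
(* The first bound keeps theta admissible in every direction, the second keeps the soft maximum cost
   below [e1] per site. *)
pose theta := Num.min (theta0 beta_ M) (e1 / (C + 1)).
have t0 : 0 < theta by rewrite lt_min theta0_gt0 divr_gt0.
have tt : theta <= theta0 beta_ M by rewrite ge_min lexx.
have tC : theta * C <= e1.
  have : theta <= e1 / (C + 1) by rewrite ge_min lexx orbT.
  rewrite ler_pdivlMr// => h; apply: le_trans h.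
  by apply: ler_wpM2l; [exact: ltW|rewrite lerDl].
have [n nE] : exists n : nat, beta / 2 * (2 / n.+1%:R) ^+ 2 <= e1.
  exists (Num.truncn (2 * beta / e1)); set n := Num.truncn _.
  have n0 : (0 : R) < n.+1%:R by rewrite ltr0n.
  have n1 : (1 : R) <= n.+1%:R by rewrite ler1n.
  have : 2 * beta / e1 < n.+1%:R by exact: truncnS_gt.
  rewrite ltr_pdivrMr// => h.
  rewrite (_ : _ * _ = 2 * beta / n.+1%:R ^+ 2); last by field; rewrite gt_eqF.
  rewrite ler_pdivrMr ?exprn_gt0//; apply: (le_trans (ltW h)).
  by rewrite mulrC ler_wpM2l ?(ltW e10)// expr2 ler_peMr// ltW.
pose mu (k : 'I_n.+2) : R := 2 * k%:R / n.+1%:R - 1.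
have mu1 k : -1 <= mu k <= 1.
  have n0 : (0 : R) < n.+1%:R by rewrite ltr0n.
  have k0 : 0 <= k%:R / n.+1%:R :> R by rewrite divr_ge0.
  have kn : k%:R / n.+1%:R <= 1 :> R by rewrite ler_pdivrMr// mul1r ler_nat -ltnS.
  by rewrite /mu -mulrA; move: (k%:R / _) k0 kn => q q0 q1; apply/andP; split; lra.
(* The grid is finite and independent of N, so convergence holds at all its points
   simultaneously. *)
have conv : \forall N \near \oo, forall k : 'I_n.+2,
    `|SK_limit (beta * mu k) - F_ P g 0 beta_ (fun i w => beta * mu k + h_ i w) N| <= e1.
  apply: filter_forall => k.
  have /cvgrPdist_le/(_ _ e10) := @SK_limitP (beta * mu k); exact.
near=> N.
have N0 : (0 < N)%N by near: N; exists 1%N.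
have N0' : (0 : R) < N%:R by rewrite ltr0n.
have cN : forall k : 'I_n.+2,
    `|SK_limit (beta * mu k) - F_ P g 0 beta_ (fun i w => beta * mu k + h_ i w) N| <= e1.
  by near: N.
have lnN : (1 + theta^-1) * ln n.+2%:R <= e1 * N%:R.
  rewrite -ler_pdivrMl//; near: N; exact: nbhs_infty_ger.
pose D := beta * N%:R / 2 * (2 / n.+1%:R) ^+ 2.
have DE : D <= e1 * N%:R.
  rewrite /D (_ : _ * _ = beta / 2 * (2 / n.+1%:R) ^+ 2 * N%:R); last by ring.
  by rewrite ler_pM2r.
pose b (k : 'I_n.+2) := field_base (beta * mu k) N.
pose c (k : 'I_n.+2) : R := - (beta * mu k ^+ 2 / 2 * N%:R).
have H1 s : exists k, base_energy beta 0 N s <= b k s + c k + D.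
  have [k hk] := grid_point n (magnetization_bound s N0); exists k.
  rewrite /base_energy /b /c !field_base_magnetization// mul0r mul0r addr0 /D.
  rewrite -/(mu k) in hk.
  have : (magnetization s - mu k) ^+ 2 <= (2 / n.+1%:R) ^+ 2.
    by rewrite -[leLHS]real_normK ?num_real// lerXn2r ?nnegrE// divr_ge0.
  have b0 : 0 <= beta * N%:R / 2 by rewrite divr_ge0// mulr_ge0.
  move=> /(ler_wpM2l b0) h.
  rewrite (_ : beta * N%:R / 2 * magnetization s ^+ 2 =
    beta * mu k * N%:R * magnetization s + - (beta * mu k ^+ 2 / 2 * N%:R) +
    beta * N%:R / 2 * (magnetization s - mu k) ^+ 2); last by field.
  by rewrite lerD2l.
have H2 k : trunc_energy nu beta_ M (b k) + c k <= (top + 2 * e1) * N%:R.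
  have := HM 0 (beta * mu k) N N0; have := cN k; have := Htop _ (mu1 k).
  rewrite base_energy0 /variational !ler_norml => h1 /andP[h2 h3] /andP[h4 h5].
  have : N%:R^-1 * trunc_energy nu beta_ M (field_base (beta * mu k) N) <=
     top + 2 * e1 + beta * mu k ^+ 2 / 2 by lra.
  by rewrite /b /c ler_pdivrMl// lerBlDr -mulrDl [N%:R * _]mulrC.
have H := trunc_energy_grid nuexp ord0 N0 t0 tt H1 H2.
rewrite card_ord in H.
have HN : trunc_energy nu beta_ M (base_energy beta 0 N) <=
    (top + 5 * e1) * N%:R.
  have tCN : theta * C * N%:R <= e1 * N%:R by rewrite ler_pM2r.
  rewrite -/C in H; lra.
have := HM beta 0 N N0; rewrite ler_norml => /andP[_ h].
rewrite mulrC -ler_pdivrMl// in HN.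
rewrite (_ : e = 6 * e1); last by rewrite /e1; field.
lra.
Unshelve. all: by end_near. Qed.

End ferromagnetic.
End limits.

Lemma gaussian_exp_moments {d : measure_display} {T : measurableType d} {R : realType}
  (P : probability T R) (X : {RV P >-> R}) : gaussian X -> exp_moments (distribution P X).
Proof.
move=> [m [s [s0 HX]]]; case: (eqVneq s 0) HX => [_|sN0] HX.
  have E A : measurable A -> distribution P X A = \d_m A.
    by move=> mA; rewrite HX.
  exact: (exp_moments_eq_law E (dirac_exp_moments m)).
have E A : measurable A -> distribution P X A = normal_law m s A.
  by move=> mA; rewrite HX// normal_lawE.
exact: (exp_moments_eq_law E (normal_exp_moments m sN0)).
Qed.

Theorem theorem1 (R : realType) (d : measure_display) (T : measurableType d)
  (P : probability T R)
  (beta : R) (beta_ : nat -> R)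
  (h : {RV P >-> R}) (h_ : nat -> {RV P >-> R})
  (g : seq nat -> {RV P >-> R})
  (beta_ge0 : 0 <= beta)
  (beta_summable :
     (\sum_(1 <= p <oo) (2 ^+ p * beta_ p ^+ 2)%:E < +oo)%E)
  (h_gaussian : gaussian h)
  (h_copies : forall i : nat, same_law (h_ i) h)
  (g_gaussian : forall s : seq nat, coupling_index s -> standard_gaussian (g s))
  (disorder_independent :
     mutually_independent disorder_index (disorder h_ g)) :
  exists F : R,
    (F_ P g beta beta_ h_ N @[N --> \oo] --> F) /\
    is_max [set F_SK P g beta_ (fun i w => beta * mu + h_ i w)
                - beta * mu ^+ 2 / 2 | mu in `[-1, 1]] F.
Proof.
have nuexp := gaussian_exp_moments h_gaussian.
have h_law i A : measurable A -> distribution P (h_ i) A = distribution P h A.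
  exact: h_copies.
have F0 : F_ P g beta beta_ h_ = F_ P g beta beta_ (fun i w => 0 + h_ i w).
  by congr (F_ _ _ _ _ _); apply/funext => i; apply/funext => w; rewrite add0r.
have V x := @continuous_variational _ _ _ P beta_ h_ g beta_summable _ nuexp
  h_law g_gaussian disorder_independent beta x.
have N11 : -1 <= 1 :> R by lra.
(* A maximizer [c] exists by compactness. The lower bound at [c] and the upper bound by the value at
   [c] enclose the free energy. *)
have [c c1 cmax] := EVT_max N11 (continuous_subspaceT V).
have c1' : -1 <= c <= 1 by move: c1; rewrite in_itv.
exists (variational beta_ h_ g beta c); split; last first.
  split; first by exists c => //; rewrite /= in_itv.
  move=> _ [mu /= mu1 <-]; apply: cmax; exact: mu1.
rewrite F0; apply/cvgrPdist_le => e e0.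
have Hl := F_lower beta_summable nuexp h_law g_gaussian disorder_independent
  beta_ge0 c e0.
have Hu := F_upper beta_summable nuexp h_law g_gaussian disorder_independent
  beta_ge0 e0 (fun mu mu1 => cmax mu mu1).
near=> N.
have l : variational beta_ h_ g beta c - e <= F_ P g beta beta_ (fun i w => 0 + h_ i w) N.
  by near: N.
have u : F_ P g beta beta_ (fun i w => 0 + h_ i w) N <= variational beta_ h_ g beta c + e.
  by near: N.
by rewrite ler_norml; apply/andP; split; lra.
Unshelve. all: by end_near. Qed.
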